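(* Let $f\in L^p(\mathbb{R}^n)$, $p\ge 1$, be such that $\operatorname{supp}\widehat f$ is contained in a set $E\subseteq\mathbb{R}^n$ with $\mathcal{P}^{\alpha}(E)<\infty$ for some $0\le\alpha<n$. Then $f\equiv 0$, provided $p\le\frac{2n}{\alpha}$.
   Context: Here $n\ge 1$ is an integer. $\widehat f$ denotes the Fourier transform of $f$ in the sense of tempered distributions on $\mathbb{R}^n$, normalized on $L^1$ by $\widehat f(t)=(2\pi)^{-n/2}\int_{\mathbb{R}^n}f(x)e^{-ix\cdot t}\,dx$, and $\operatorname{supp}\widehat f$ is its (closed) distributional support. Packing measure. Let $0\le s<\infty$. For $0<\epsilon<1$ and $A\subseteq\mathbb{R}^n$, an $\epsilon$-packing of $A$ is a (countable) collection of pairwise disjoint open balls $\{B_{r_k}(x_k)\}_k$ with centres $x_k\in A$ and radii $0<r_k\le\epsilon/2$. Put $P^s_\epsilon(A)=\sup\sum_k(2r_k)^s$, the supremum over all $\epsilon$-packings of $A$; put $P^s_0(A)=\lim_{\epsilon\downarrow0}P^s_\epsilon(A)$, with $P^s_0(\emptyset)=0$. The packing $s$-measure of $A$ is $\mathcal{P}^s(A)=\inf\{\sum_{i=1}^\infty P^s_0(A_i): A=\bigcup_{i=1}^\infty A_i\}$. *)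

(* Defs.v *)
From HB Require Import structures.
From mathcomp Require Import all_boot all_order all_algebra.
From mathcomp Require Import complex.
From mathcomp Require Import all_classical all_reals all_analysis.

Set Implicit Arguments.
Unset Strict Implicit.
Unset Printing Implicit Defensive.

Import Order.TTheory GRing.Theory Num.Theory.
Import numFieldNormedType.Exports.

Local Open Scope classical_set_scope.
Local Open Scope ring_scope.

(* R^n is ['rV[R]_n].  Its library topology (coordinatewise convergence) is the
   usual one, but its library norm and [ball] are those of the sup norm, so the
   Euclidean structure is introduced here. *)

Definition dot (R : realType) (n : nat) (x y : 'rV[R]_n) : R :=
  \sum_(i < n) x 0 i * y 0 i.

Definition enorm (R : realType) (n : nat) (x : 'rV[R]_n) : R :=
  Num.sqrt (dot x x).

Definition eball (R : realType) (n : nat) (x : 'rV[R]_n) (r : R) :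
    set 'rV[R]_n :=
  [set y | enorm (y - x) < r].

(* The sigma-algebra on R^n generated by the coordinates, i.e. the Borel one. *)

Definition measure_rV_display : measure_display -> measure_display.
Proof. exact. Qed.

Section measurable_rV.
Context {d} {T : measurableType d}.
Variable n : nat.

Let coors : 'I_n -> 'rV[T]_n -> T := fun i x => x 0 i.

Let rV_set0 : g_sigma_preimage coors set0.
Proof. exact: sigma_algebra0. Qed.

Let rV_setC A : g_sigma_preimage coors A -> g_sigma_preimage coors (~` A).
Proof. exact: sigma_algebraC. Qed.

Let rV_bigcup (F : _^nat) : (forall i, g_sigma_preimage coors (F i)) ->
  g_sigma_preimage coors (\bigcup_i (F i)).
Proof. exact: sigma_algebra_bigcup. Qed.

HB.instance Definition _ := @isMeasurable.Build (measure_rV_display d)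
  'rV[T]_n (g_sigma_preimage coors) rV_set0 rV_setC rV_bigcup.

End measurable_rV.

Lemma measurable_coord d (T : measurableType d) (n : nat) (i : 'I_n) :
  measurable_fun [set: 'rV[T]_n] (fun x : 'rV[T]_n => x 0 i).
Proof.
move=> _ Y mY; rewrite setTI; apply: sub_sigma_algebra => /=.
rewrite -bigcup_seq/=; exists i => /=; first by rewrite mem_index_enum.
by exists Y => //; rewrite setTI.
Qed.

Lemma measurable_fun_coordP d1 d2 (T1 : measurableType d1)
    (T2 : measurableType d2) (n : nat) (f : T1 -> 'rV[T2]_n) :
  measurable_fun [set: T1] f <->
  forall i, measurable_fun [set: T1] (fun x => f x 0 i).
Proof.
split=> [mf i|mf].
  exact: (measurableT_comp (@measurable_coord _ _ _ i) mf).
have H : g_sigma_preimage (fun i : 'I_n => (fun x : 'rV[T2]_n => x 0 i) \o f)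
    `<=` measurable.
  apply: smallest_sub; first exact: sigma_algebra_measurable.
  case: n => [|n] in f mf *; first by rewrite big_ord0.
  rewrite -bigcup_mkord_ord; apply: bigcup_sub => i Ii.
  by move=> A [B mB <-]; exact: mf.
rewrite g_sigma_preimage_comp in H => _ A mA.
by apply: H; exists A.
Qed.

Definition rV_cons (R : realType) (n : nat) (z : R * 'rV[R]_n) : 'rV[R]_n.+1 :=
  row_mx z.1%:M z.2 : 'rV[R]_(1 + n).

Definition rV_uncons (R : realType) (n : nat) (v : 'rV[R]_n.+1) :
    R * 'rV[R]_n :=
  (v 0 ord0, \row_j v 0 (lift ord0 j)).

Lemma rV_consK (R : realType) (n : nat) : cancel (@rV_cons R n) (@rV_uncons R n).
Proof.
move=> [x v]; rewrite /rV_uncons /rV_cons/=; congr pair.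
  transitivity (row_mx x%:M v 0 (lshift n ord0)).
    by congr (row_mx _ _ _ _); exact: val_inj.
  by rewrite row_mxEl mxE eqxx mulr1n.
apply/rowP => j; rewrite mxE.
transitivity (row_mx (x%:M : 'M[R]_1) v 0 (rshift 1 j)); last by rewrite row_mxEr.
by congr (row_mx _ _ _ _); exact: val_inj.
Qed.

Lemma measurable_rV_cons (R : realType) (n : nat) :
  measurable_fun [set: R * 'rV[R]_n] (@rV_cons R n).
Proof.
apply/measurable_fun_coordP => i; rewrite /rV_cons.
case: (split_ordP (i : 'I_(1 + n))) => j ->.
  rewrite (_ : (fun _ => _) = fst); first exact: measurable_fst.
  apply/funext => z; transitivity ((z.1%:M : 'M[R]_1) 0 j).
    exact: row_mxEl.
  by rewrite mxE (ord1 j) eqxx mulr1n.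
rewrite (_ : (fun _ => _) = (fun x : 'rV[R]_n => x 0 j) \o snd).
  exact: (measurableT_comp (@measurable_coord _ _ _ j) measurable_snd).
by apply/funext => z; exact: row_mxEr.
Qed.

Lemma measurable_rV_uncons (R : realType) (n : nat) :
  measurable_fun [set: 'rV[R]_n.+1] (@rV_uncons R n).
Proof.
apply: measurable_fun_pair; first exact: measurable_coord.
apply/measurable_fun_coordP => i.
under eq_fun do rewrite mxE.
exact: measurable_coord.
Qed.

Section lebesgue_rV_step.
Context {R : realType} {n : nat}.
Variable mu : {sigma_finite_measure set 'rV[R]_n -> \bar R}.
Local Open Scope ereal_scope.

Definition lebesgue_rV_step : set 'rV[R]_n.+1 -> \bar R :=
  pushforward (lebesgue_measure \x mu) (@rV_cons R n).

Let step0 : lebesgue_rV_step set0 = 0.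
Proof. by rewrite /lebesgue_rV_step /pushforward preimage_set0 measure0. Qed.

Let step_ge0 A : 0 <= lebesgue_rV_step A.
Proof. by rewrite /lebesgue_rV_step /pushforward measure_ge0. Qed.

Let step_sigma_additive : semi_sigma_additive lebesgue_rV_step.
Proof.
move=> F mF tF mUF; rewrite /lebesgue_rV_step /pushforward preimage_bigcup.
have mc B : measurable B -> measurable (@rV_cons R n @^-1` B).
  by move=> mB; rewrite -[X in measurable X]setTI; exact: measurable_rV_cons.
apply: measure_semi_sigma_additive => [i||]; first exact: mc.
- apply/trivIsetP => /= i j _ _ ij; rewrite -preimage_setI.
  by move/trivIsetP : tF => /(_ _ _ _ _ ij) ->//; rewrite preimage_set0.
- by rewrite -preimage_bigcup; exact: mc.
Qed.

HB.instance Definition _ := isMeasure.Build _ _ _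
  lebesgue_rV_step step0 step_ge0 step_sigma_additive.

Let step_sigma_finite : sigma_finite setT lebesgue_rV_step.
Proof.
have /sigma_finiteP[F [FT ndF Foo]] := sigma_finiteT (@lebesgue_measure R).
have /sigma_finiteP[G [GT ndG Goo]] := sigma_finiteT mu.
exists (fun k => @rV_uncons R n @^-1` (F k `*` G k)).
  rewrite -preimage_bigcup -[LHS](@preimage_setT _ _ (@rV_uncons R n)).
  congr (_ @^-1` _); rewrite -setXTT FT GT predeqE => -[x y]; split.
    move=> [/= [i _ Fix] [j _ Gjy]]; exists (maxn i j) => //; split.
    - by move: x Fix; exact/subsetPset/ndF/leq_maxl.
    - by move: y Gjy; exact/subsetPset/ndG/leq_maxr.
  by move=> [i _ []/= ? ?]; split; exists i.
move=> k; have [mF Fk] := Foo k; have [mG Gk] := Goo k; split.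
  rewrite -[X in measurable X]setTI; apply: measurable_rV_uncons => //.
  exact: measurableX.
rewrite /lebesgue_rV_step /pushforward -comp_preimage.
rewrite (_ : _ \o _ = id); last by apply/funext => z /=; rewrite rV_consK.
by rewrite preimage_id product_measure1E// lte_mul_pinfty// ge0_fin_numE.
Qed.

HB.instance Definition _ := Measure_isSigmaFinite.Build _ _ _
  lebesgue_rV_step step_sigma_finite.

End lebesgue_rV_step.

(* Lebesgue measure on R^n, as the n-fold product of the one on R. *)
Fixpoint lebesgue_rV (R : realType) (n : nat) :
    {sigma_finite_measure set 'rV[R]_n -> \bar R} :=
  match n with
  | 0%N => dirac (0 : 'rV[R]_0)
  | m.+1 => lebesgue_rV_step (lebesgue_rV R m)
  end.

Section complex_integral.
Context {R : realType} {n : nat}.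
Implicit Types f g phi : 'rV[R]_n -> R[i].

Definition cintegral f : R[i] :=
  ((\int[lebesgue_rV R n]_x complex.Re (f x)) +i*
   (\int[lebesgue_rV R n]_x complex.Im (f x)))%C.

Definition cmeasurable f : Prop :=
  measurable_fun setT (fun x => complex.Re (f x)) /\
  measurable_fun setT (fun x => complex.Im (f x)).

Definition in_Lp (p : R) f : Prop :=
  cmeasurable f /\ finite_norm (lebesgue_rV R n) p%:E (fun x => Normc.normc (f x)).

End complex_integral.

Definition expi (R : realType) (theta : R) : R[i] := (cos theta +i* sin theta)%C.

Definition fourier (R : realType) (n : nat) (phi : 'rV[R]_n -> R[i])
    (t : 'rV[R]_n) : R[i] :=
  (((2 * pi) `^ (- (n%:R / 2)))%:C)%C *
  cintegral (fun x => phi x * expi (- dot x t)).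

Section distributions.
Context {R : realType} {n : nat}.

Definition partial (i : 'I_n) (g : 'rV[R]_n -> R) : 'rV[R]_n -> R :=
  fun x => 'D_(delta_mx 0 i) g x.

Definition partials (s : seq 'I_n) (g : 'rV[R]_n -> R) : 'rV[R]_n -> R :=
  foldr partial g s.

Definition smooth (g : 'rV[R]_n -> R) : Prop :=
  forall s : seq 'I_n, continuous (partials s g) /\
    forall (i : 'I_n) (x : 'rV[R]_n),
      derivable (partials s g) x (delta_mx 0 i).

Definition fun_support (phi : 'rV[R]_n -> R[i]) : set 'rV[R]_n :=
  closure [set x | phi x != 0].

(* C_c^oo(U) *)
Definition test_function (U : set 'rV[R]_n) (phi : 'rV[R]_n -> R[i]) : Prop :=
  [/\ smooth (fun x => complex.Re (phi x)),
      smooth (fun x => complex.Im (phi x)),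
      compact (fun_support phi) & fun_support phi `<=` U].

(* A distribution is represented by its pairing with functions, which is
   meaningful on the Schwartz functions only: for f in L^p, the values
   [regular_distr f phi] and [distr_fourier (regular_distr f) phi] are those
   of the tempered distributions f and \hat f whenever phi is Schwartz. *)
Definition distribution : Type := ('rV[R]_n -> R[i]) -> R[i].

Definition regular_distr (f : 'rV[R]_n -> R[i]) : distribution :=
  fun phi => cintegral (fun x => f x * phi x).

Definition distr_fourier (u : distribution) : distribution :=
  fun phi => u (fourier phi).

Definition distr_vanishes_on (u : distribution) (U : set 'rV[R]_n) : Prop :=
  forall phi, test_function U phi -> u phi = 0.

Definition distr_support (u : distribution) : set 'rV[R]_n :=
  ~` \bigcup_(U in [set U | open U /\ distr_vanishes_on u U]) U.

End distributions.

Section packing.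
Context {R : realType} {n : nat}.
Implicit Types A E : set 'rV[R]_n.
Local Open Scope ereal_scope.

(* The packing is the family of the balls of centre [x k] and radius [r k] for
   k in D; finite packings, including the empty one, are those with finite D. *)
Definition is_packing (eps : R) A (D : set nat) (x : nat -> 'rV[R]_n)
    (r : nat -> R) : Prop :=
  (forall k, D k -> A (x k) /\ (0 < r k <= eps / 2)%R) /\
  trivIset D (fun k => eball (x k) (r k)).

Definition packing_eps (s eps : R) A : \bar R :=
  ereal_sup [set z | exists D x r, is_packing eps A D x r /\
                     z = \esum_(k in D) ((2 * r k) `^ s)%:E].

Definition packing_pre (s : R) A : \bar R :=
  lim (packing_eps s eps A @[eps --> 0%R^'+]).

Lemma packing_pre0 (s : R) : packing_pre s set0 = 0.
Proof.
have packing_eps0 eps : packing_eps s eps set0 = 0.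
  rewrite /packing_eps [X in ereal_sup X](_ : _ = [set 0]) ?ereal_sup1//.
  apply/seteqP; split=> [z [D [x [r [[Dxr _] ->]]]]|z ->] /=.
    rewrite (_ : D = set0) ?esum_set0//.
    by apply/seteqP; split=> // k /Dxr[].
  exists set0, (fun=> 0%R), (fun=> 0%R); rewrite esum_set0; split => //.
  by split=> //; exact: trivIset_set0.
rewrite /packing_pre.
by under eq_fun do rewrite packing_eps0; exact: lim_cst.
Qed.

Definition packing_measure (s : R) E : \bar R :=
  ereal_inf [set \sum_(0 <= i <oo) packing_pre s (B i) |
             B in [set B : nat -> set 'rV[R]_n | E = \bigcup_i B i]].

End packing.

(* Main.v *)
Require Import Defs.
From mathcomp Require Import all_boot all_order all_algebra.
From mathcomp Require Import complex.
From mathcomp Require Import all_classical all_reals all_analysis.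
From mathcomp Require Import measurable_realfun.
From mathcomp Require Import ring lra zify.

(** The support [K] of the transform of [f] is shown to be empty; a function
    whose transform has empty support is then zero almost everywhere.

    Let [psi] be a test function such that [K] meets its support inside the
    closure of a set [B] of finite packing content. At scale [e], a smooth
    partition of unity over a grid of mesh [e] cuts [psi] into cells, and the
    cells that miss [K] pair to zero with the transform of [f]. The remaining
    ones are at most [C * e `^ (- alpha)] in number, because well separated
    points of [B] are the centres of a packing ([grid_count]). Their sum [phi]
    therefore has an L^1 norm of order [e `^ (n - alpha)], which bounds its
    Fourier transform, of modulus [z], uniformly. With the weight [w], the
    product of the [1 + (e * x_i) ^+ 2], the integral of [w * z ^+ 2] is at most
    a multiple of the squared L^2 norm of [\prod_i (1 + e * d_i) phi]
    ([weighted_plancherel]), which is again of order [e `^ (n - alpha)].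

    The pairing of [psi] is thus at most the integral of [|f| * z]. Where
    [|f| >= l] the uniform bound on [z] wins as [e] tends to 0. Where [|f| < l],
    the inequality between arithmetic and geometric means splits [|f| * z] into
    [c * e `^ (alpha - n) * z ^+ 2 * w], of integral of order [c], and
    [c^-1 * e `^ (n - alpha) * |f| ^+ 2 / w]. For [p * alpha <= 2 * n] the latter
    is at most [c^-1] times the sum of [k * e ^+ n / w], where [e ^+ n / w] has
    integral [pi ^+ n], and of a multiple of [|f| `^ p] that depends on [k]
    ([square_le_power]); the integral of [|f| `^ p] over the set [|f| < l] is
    small with [l]. Choosing [c], [k],
    [l] and [e] in this order, the pairing is zero ([pairing_local_eq0]).

    A set of finite packing measure is a countable union of sets of finite
    packing content. If [K] were nonempty, Baire's theorem would give a ball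
    centred in [K] where [K] is contained in the closure of a single one of
    them; the transform of [f] would vanish on that ball, which contradicts the
    definition of [K] ([distr_support_eq0]).

    When [K] is empty, [f] is orthogonal to the Fourier transforms of all test
    functions, among them modulated and dilated bumps, whose transforms are the
    translates of an approximate identity. Integrating the translation over a
    box and letting the scale tend to 0 shows that [f] has integral zero over
    every box ([Rintegral_cbox_eq0]), so [f] is zero almost everywhere
    ([cbox_integrals_eq0]).

    All functions are split into real and imaginary parts, hence Fourier
    transforms into cosine and sine transforms. *)

Set Implicit Arguments.
Unset Strict Implicit.
Unset Printing Implicit Defensive.

Import Order.TTheory GRing.Theory Num.Theory.
Import numFieldNormedType.Exports.

Local Open Scope classical_set_scope.
Local Open Scope ring_scope.

(** * Integrals over products and over R^n *)

Section real_fubini.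
Context d1 d2 (T1 : measurableType d1) (T2 : measurableType d2) (R : realType).
Variables (m1 : {sigma_finite_measure set T1 -> \bar R})
          (m2 : {sigma_finite_measure set T2 -> \bar R}).
Variables (F : T1 * T2 -> R) (a : T1 -> R) (b : T2 -> R).
Hypothesis mF : measurable_fun setT F.
Hypothesis ia : m1.-integrable setT (EFin \o a).
Hypothesis ib : m2.-integrable setT (EFin \o b).
Hypothesis Fab : forall x y, `|F (x, y)| <= a x * b y.

Let Fab' x y : `|F (x, y)| <= `|a x| * `|b y|.
Proof. by rewrite -normrM (le_trans (Fab _ _))// ler_norm. Qed.

Lemma dominated_section1 x : m2.-integrable setT (EFin \o (fun y => F (x, y))).
Proof.
have mFx : measurable_fun setT (fun y => F (x, y)) by exact: measurableT_comp.
apply: (@le_integrable _ _ _ m2 setT _ _ (fun y => (a x)%:E * (b y)%:E)%E) => //.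
- exact/measurable_EFinP.
- by move=> y _; rewrite -EFinM !abse_EFin lee_fin normrM.
- exact: integrableZl.
Qed.

Lemma dominated_section2 y : m1.-integrable setT (EFin \o (fun x => F (x, y))).
Proof.
have mFx : measurable_fun setT (fun x => F (x, y)) by exact: measurableT_comp.
apply: (@le_integrable _ _ _ m1 setT _ _ (fun x => (b y)%:E * (a x)%:E)%E) => //.
- exact/measurable_EFinP.
- by move=> x _; rewrite -EFinM !abse_EFin lee_fin normrM mulrC.
- exact: integrableZl.
Qed.

Lemma dominated_integrable_prod : (m1 \x m2)%E.-integrable setT (EFin \o F).
Proof.
apply/integrable12ltyP; first exact/measurable_EFinP.
have [_ Ib] := integrableP _ _ _ ib; have [_ Ia] := integrableP _ _ _ ia.
pose B := (\int[m2]_y `|(b y)%:E|)%E.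
have B0 : (0 <= B)%E by exact: integral_ge0.
have mb : measurable_fun setT (fun y => `|(b y)%:E|%E).
  by apply: measurableT_comp => //; exact: measurable_int ib.
have ma : measurable_fun setT (fun y => `|(a y)%:E|%E).
  by apply: measurableT_comp => //; exact: measurable_int ia.
apply: (@le_lt_trans _ _ (\int[m1]_x (B * `|(a x)%:E|))%E).
  apply: ge0_le_integral => //.
  - by move=> x _; exact: integral_ge0.
  - apply: (@measurable_fun_fubini_tonelli_F _ _ _ _ _ m2 (fun z => `|(F z)%:E|%E)) => //.
    by apply: measurableT_comp => //; exact/measurable_EFinP.
  - exact: measurable_funeM.
  - move=> x _; rewrite muleC -ge0_integralZl//.
    apply: ge0_le_integral => //.
    + apply: measurableT_comp => //.
      by apply/measurable_EFinP; exact: measurableT_comp.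
    + exact: measurable_funeM.
    + by move=> y _; rewrite !abse_EFin -EFinM lee_fin.
by rewrite ge0_integralZl//= lte_mul_pinfty// ge0_fin_numE.
Qed.

Lemma EFin_Rintegral_section1 x :
  (\int[m2]_y F (x, y))%:E = (\int[m2]_y (F (x, y))%:E)%E.
Proof. by rewrite /Rintegral fineK// integrable_fin_num//; exact: dominated_section1. Qed.

Lemma EFin_Rintegral_section2 y :
  (\int[m1]_x F (x, y))%:E = (\int[m1]_x (F (x, y))%:E)%E.
Proof. by rewrite /Rintegral fineK// integrable_fin_num//; exact: dominated_section2. Qed.

Lemma integrable_Rintegral_section1 :
  m1.-integrable setT (EFin \o (fun x => \int[m2]_y F (x, y))).
Proof.
apply: eq_integrable (integrable_fubini_F dominated_integrable_prod) => // x _.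
by rewrite /fubini_F/= EFin_Rintegral_section1.
Qed.

Lemma Rfubini1 :
  \int[(m1 \x m2)%E]_z F z = \int[m1]_x \int[m2]_y F (x, y).
Proof.
rewrite /Rintegral; congr fine.
rewrite -(integral12_prod_meas1 dominated_integrable_prod).
by apply: eq_integral => x _; exact: (esym (EFin_Rintegral_section1 _)).
Qed.

Lemma Rfubini2 :
  \int[(m1 \x m2)%E]_z F z = \int[m2]_y \int[m1]_x F (x, y).
Proof.
rewrite /Rintegral; congr fine.
rewrite -(integral21_prod_meas1 dominated_integrable_prod).
by apply: eq_integral => x _; exact: (esym (EFin_Rintegral_section2 _)).
Qed.

Lemma Rfubini :
  \int[m1]_x (\int[m2]_y F (x, y)) = \int[m2]_y (\int[m1]_x F (x, y)).
Proof. by rewrite -Rfubini1 Rfubini2. Qed.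

End real_fubini.

Lemma ge0_integrable d (T : measurableType d) (R : realType)
    (m : {measure set T -> \bar R}) (f : T -> R) :
  measurable_fun setT f -> (forall x, 0 <= f x) ->
  (\int[m]_x (f x)%:E < +oo)%E -> m.-integrable setT (EFin \o f).
Proof.
move=> mf f0 fi; apply/integrableP; split; first exact/measurable_EFinP.
apply: le_lt_trans fi; rewrite le_eqVlt; apply/orP; left; apply/eqP.
by apply: eq_integral => x _; rewrite /= ger0_norm.
Qed.

Lemma integrable_bounded_mul d (T : measurableType d) (R : realType)
    (m : {measure set T -> \bar R}) (f g : T -> R) (M : R) :
  m.-integrable setT (EFin \o f) -> measurable_fun setT g ->
  (forall x, `|g x| <= M) ->
  m.-integrable setT (EFin \o (fun x => f x * g x)).
Proof.
move=> fi mg gM.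
apply: (@le_integrable _ _ _ m setT _ _ (fun x => M%:E * (f x)%:E)%E) => //.
- apply/measurable_EFinP; apply: measurable_funM => //.
  by apply/measurable_EFinP; exact: measurable_int fi.
- move=> x _; rewrite -EFinM !abse_EFin lee_fin !normrM mulrC ler_wpM2r//.
  by rewrite (le_trans (gM x))// ler_norm.
- exact: integrableZl.
Qed.

Lemma Rintegral_dominated_cvg d (T : measurableType d) (R : realType)
    (m : {measure set T -> \bar R}) (f_ : nat -> T -> R) (f g : T -> R) :
  (forall k, measurable_fun setT (f_ k)) -> measurable_fun setT f ->
  {ae m, forall x, f_ ^~ x @ \oo --> f x} -> m.-integrable setT (EFin \o g) ->
  (forall k x, `|f_ k x| <= g x) ->
  (fun k => \int[m]_x f_ k x) @ \oo --> \int[m]_x f x.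
Proof.
move=> mf_ mf cf ig dom.
have mE_ k : measurable_fun setT (EFin \o f_ k) by exact/measurable_EFinP.
have mE : measurable_fun setT (EFin \o f) by exact/measurable_EFinP.
have cE : {ae m, forall x, setT x -> (fun k => (EFin \o f_ k) x) @ \oo --> (EFin \o f) x}.
  by apply: filterS cf => x cx _; apply: cvg_EFin => //; near=> k.
have dE : {ae m, forall x k, setT x -> (`|(EFin \o f_ k) x| <= (EFin \o g) x)%E}.
  by apply: aeW => x k _; rewrite /= lee_fin.
have [fi _ L] := dominated_convergence measurableT mE_ mE cE ig dE.
apply/fine_cvg; rewrite /Rintegral fineK//; exact: integrable_fin_num fi.
Unshelve. all: by end_near. Qed.

(** A parametric integral is measurable even where the parameter does not
    decay: damping by an integrable [w] brings Fubini's theorem into play. *)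
Lemma measurable_Rintegral_damped d1 d2 (T1 : measurableType d1) (T2 : measurableType d2)
    (R : realType) (m1 : {sigma_finite_measure set T1 -> \bar R})
    (m2 : {sigma_finite_measure set T2 -> \bar R})
    (w : T1 -> R) (phi : T2 -> R) (c : T1 * T2 -> R) :
  (forall x, 0 < w x) -> m1.-integrable setT (EFin \o w) ->
  measurable_fun setT (fun x => (w x)^-1) -> m2.-integrable setT (EFin \o phi) ->
  measurable_fun setT c -> (forall z, `|c z| <= 1) ->
  measurable_fun setT (fun x => \int[m2]_y (phi y * c (x, y))).
Proof.
move=> w0 iw mwV iphi mc c1.
have mw : measurable_fun setT w by apply/measurable_EFinP; exact: measurable_int iw.
have mphi : measurable_fun setT phi by apply/measurable_EFinP; exact: measurable_int iphi.
have H : measurable_fun setT (fun x => \int[m2]_y (w x * (phi y * c (x, y)))).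
  apply/measurable_EFinP; apply: measurable_int.
  apply: (@integrable_Rintegral_section1 _ _ _ _ R m1 m2
    (fun z => w z.1 * (phi z.2 * c z)) w (fun y => `|phi y|)) => //.
  - apply: measurable_funM; first exact: (measurableT_comp mw measurable_fst).
    by apply: measurable_funM => //; exact: (measurableT_comp mphi measurable_snd).
  - exact: integrable_norm.
  - move=> x y /=; rewrite !normrM (gtr0_norm (w0 x)) ler_wpM2l ?(ltW (w0 x))//.
    by rewrite ler_piMr.
rewrite (_ : (fun x => _) = fun x => (w x)^-1 * \int[m2]_y (w x * (phi y * c (x, y)))).
  exact: measurable_funM.
apply/funext => x; rewrite RintegralZl ?mulKf ?gt_eqF//.
apply: integrable_bounded_mul iphi _ (fun y => c1 _).
exact: measurableT_comp.
Qed.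

Lemma Rintegral_eq0 d (T : measurableType d) (R : realType)
    (m : {measure set T -> \bar R}) (f : T -> R) :
  (forall x, f x = 0) -> \int[m]_x f x = 0.
Proof. by move=> f0; rewrite /Rintegral integral0_eq// => x _; rewrite f0. Qed.

Section integral_rV.
Context {R : realType}.
Notation mu := (@lebesgue_rV R).

Lemma integral_rV0 (f : 'rV[R]_0 -> \bar R) : (\int[mu 0]_x f x)%E = f (0 : 'rV[R]_0).
Proof.
rewrite (eq_integral (cst (f (0 : 'rV[R]_0)))); last by move=> x _; rewrite [x]thinmx0.
by rewrite integral_cst//= diracT mule1.
Qed.

Lemma ge0_integral_rV_prod n (f : 'rV[R]_n.+1 -> \bar R) :
  measurable_fun setT f -> (forall x, 0 <= f x)%E ->
  (\int[mu n.+1]_x f x = \int[lebesgue_measure \x mu n]_z f (rV_cons z))%E.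
Proof.
move=> mf f0.
rewrite (eq_measure_integral (pushforward (lebesgue_measure \x mu n)%E (@rV_cons R n)))//.
  exact: measurable_rV_cons.
by move=> mc; rewrite ge0_integral_pushforward.
Qed.

Lemma integrable_rV_prod n (f : 'rV[R]_n.+1 -> \bar R) :
  measurable_fun setT f ->
  (lebesgue_measure \x mu n)%E.-integrable setT (f \o @rV_cons R n) ->
  (mu n.+1).-integrable setT f.
Proof.
move=> mf /integrableP[_ fi]; apply/integrableP; split => //.
by rewrite ge0_integral_rV_prod//; exact: measurableT_comp.
Qed.

Lemma integral_rV_prod n (f : 'rV[R]_n.+1 -> \bar R) :
  measurable_fun setT f ->
  (lebesgue_measure \x mu n)%E.-integrable setT (f \o @rV_cons R n) ->
  (\int[mu n.+1]_x f x = \int[lebesgue_measure \x mu n]_z f (rV_cons z))%E.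
Proof.
move=> mf fi.
rewrite (eq_measure_integral (pushforward (lebesgue_measure \x mu n)%E (@rV_cons R n)))//.
  exact: measurable_rV_cons.
by move=> mc; rewrite integral_pushforward.
Qed.

Lemma rV_cons_ord0 n (z : R * 'rV[R]_n) : rV_cons z 0 ord0 = z.1.
Proof. by have /(congr1 fst) := rV_consK z. Qed.

Lemma rV_cons_lift n (z : R * 'rV[R]_n) j : rV_cons z 0 (lift ord0 j) = z.2 0 j.
Proof. by have /(congr1 snd)/rowP/(_ j) := rV_consK z; rewrite mxE. Qed.

Lemma rV_unconsK n (v : 'rV[R]_n.+1) : rV_cons (rV_uncons v) = v.
Proof.
apply/rowP => i; case: (unliftP ord0 i) => [j|] ->.
  by rewrite rV_cons_lift mxE.
by rewrite rV_cons_ord0.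
Qed.

Lemma dot_cons n (z w : R * 'rV[R]_n) :
  dot (rV_cons z) (rV_cons w) = z.1 * w.1 + dot z.2 w.2.
Proof.
rewrite /dot big_ord_recl !rV_cons_ord0; congr (_ + _).
by apply: eq_bigr => i _; rewrite !rV_cons_lift.
Qed.

Section dominated_rV.
Variables (n : nat) (F : 'rV[R]_n.+1 -> R) (a : R -> R) (b : 'rV[R]_n -> R).
Hypothesis mF : measurable_fun setT F.
Hypothesis ia : lebesgue_measure.-integrable setT (EFin \o a).
Hypothesis ib : (mu n).-integrable setT (EFin \o b).
Hypothesis Fab : forall s v, `|F (rV_cons (s, v))| <= a s * b v.

Let mFc : measurable_fun [set: measurableTypeR R * 'rV[R]_n] (F \o @rV_cons R n).
Proof. by apply: measurableT_comp => //; exact: measurable_rV_cons. Qed.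

Lemma dominated_integrable_rV : (mu n.+1).-integrable setT (EFin \o F).
Proof.
apply: integrable_rV_prod; first exact/measurable_EFinP.
exact: (dominated_integrable_prod mFc ia ib Fab).
Qed.

Lemma Rintegral_rV1 :
  \int[mu n.+1]_x F x = \int[lebesgue_measure]_s \int[mu n]_v F (rV_cons (s, v)).
Proof.
rewrite -(Rfubini1 mFc ia ib Fab) /Rintegral integral_rV_prod//.
  exact/measurable_EFinP.
exact: (dominated_integrable_prod mFc ia ib Fab).
Qed.

Lemma Rintegral_rV2 :
  \int[mu n.+1]_x F x = \int[mu n]_v \int[lebesgue_measure]_s F (rV_cons (s, v)).
Proof. by rewrite Rintegral_rV1; exact: (Rfubini mFc ia ib Fab). Qed.

End dominated_rV.

Definition tensor n (g : 'I_n -> R -> R) (x : 'rV[R]_n) : R :=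
  \prod_i g i (x 0 i).

Lemma tensor_cons n (g : 'I_n.+1 -> R -> R) z :
  tensor g (rV_cons z) = g ord0 z.1 * tensor (fun j => g (lift ord0 j)) z.2.
Proof.
rewrite /tensor big_ord_recl rV_cons_ord0; congr (_ * _).
by apply: eq_bigr => i _; rewrite rV_cons_lift.
Qed.

Lemma measurable_tensor n (g : 'I_n -> R -> R) :
  (forall i, measurable_fun setT (g i)) -> measurable_fun setT (tensor g).
Proof.
move=> mg; apply: measurable_prod => i _.
by apply: measurableT_comp => //; exact: measurable_coord.
Qed.

(** Fubini's theorem, one coordinate at a time; a product of integrable factors
    dominates itself. *)
Lemma integral_tensor n (g : 'I_n -> R -> R) :
  (forall i, lebesgue_measure.-integrable setT (EFin \o g i)) ->
  (mu n).-integrable setT (EFin \o tensor g) /\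
  \int[mu n]_x tensor g x = \prod_i \int[lebesgue_measure]_s g i s.
Proof.
elim: n g => [|n IH] g ig.
  split.
    apply/integrableP; split.
      by apply/measurable_EFinP; apply: measurable_tensor => -[].
    by rewrite integral_rV0/= /tensor big_ord0 normr1 ltry.
  by rewrite /Rintegral integral_rV0/= /tensor !big_ord0.
have [ib Eb] := IH (fun j => g (lift ord0 j)) (fun j => ig _).
have mF : measurable_fun setT (tensor g).
  by apply: measurable_tensor => i; apply/measurable_EFinP; exact: measurable_int (ig i).
have ia' := integrable_norm (ig ord0).
have ib' := integrable_norm ib.
have Fab s v : `|tensor g (rV_cons (s, v))| <=
    `|g ord0 s| * `|tensor (fun j => g (lift ord0 j)) v|.
  by rewrite tensor_cons normrM.
split; first exact: (dominated_integrable_rV mF ia' ib' Fab).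
rewrite (Rintegral_rV1 mF ia' ib' Fab) big_ord_recl -Eb mulrC -(RintegralZl _ measurableT (ig ord0)).
apply: eq_Rintegral => s _; rewrite mulrC -(RintegralZl _ measurableT ib).
by apply: eq_Rintegral => v _; rewrite tensor_cons.
Qed.

Lemma measurable_box n (B : 'I_n -> set R) : (forall i, measurable (B i)) ->
  measurable [set x : 'rV[R]_n | forall i, B i (x 0 i)].
Proof.
move=> mB; rewrite (_ : [set _ | _] =
    \bigcap_(i in setT) ((fun x : 'rV[R]_n => x 0 i) @^-1` B i)); last first.
  by apply/seteqP; split => [x Bx i _|x Bx i]; [exact: Bx|exact: (Bx i)].
apply: fin_bigcap_measurable => // i _.
by rewrite -[X in measurable X]setTI; exact: measurable_coord.
Qed.

Lemma ball_rVE n (x : 'rV[R]_n) e y :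
  ball x e y <-> 0 < e /\ forall i, `|x 0 i - y 0 i| < e.
Proof.
split=> -[e0 xy]; split=> //; first by move=> i; exact: xy.
by move=> i j; rewrite ord1; exact: xy.
Qed.

(** Open sets are countable unions of cubes with rational centres, so they
    belong to the sigma-algebra generated by the coordinates. *)
Lemma continuous_measurable_rV n (f : 'rV[R]_n -> R) :
  continuous f -> measurable_fun setT f.
Proof.
move=> cf; apply: (measurability _ (RGenOpens.measurableE R)) => //.
move=> _ [_ [a [b ->] <-]]; rewrite setTI.
have : open (f @^-1` `]a, b[).
  by apply: open_comp; [move=> x _; exact: cf|exact: interval_open].
move: (f @^-1` _) => B oB.
pose c (q : 'rV[rat]_n * nat) : set 'rV[R]_n :=
  [set x | ball (map_mx ratr q.1 : 'rV[R]_n) (q.2.+1%:R^-1 : R) `<=` B /\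
     ball (map_mx ratr q.1 : 'rV[R]_n) (q.2.+1%:R^-1 : R) x].
rewrite (_ : B = \bigcup_(q in setT) c q); last first.
  apply/seteqP; split => [x Bx|x [q _ [qB qx]]]; last exact: qB.
  have /nbhs_ballP[e /= e0 eB] : nbhs x B by move: oB; rewrite openE; exact.
  have [k ke] : exists k, (k.+1%:R^-1 : R) < e / 2.
    have [k _ /(_ k (leqnn k))] := near_infty_natSinv_lt (PosNum (divr_gt0 e0 (ltr0Sn R 1))).
    by exists k.
  have k0 : (0 : R) < k.+1%:R^-1 by rewrite invr_gt0 ltr0n.
  have Q i : exists q : rat, `|ratr q - x 0 i| < (k.+1%:R^-1 : R).
    have /rat_in_itvoo[q /itvP qx] : x 0 i - k.+1%:R^-1 < x 0 i + k.+1%:R^-1.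
      by rewrite ltrBlDr -addrA ltrDl addr_gt0.
    by exists q; rewrite ltr_distl !qx.
  have [q qx] := choice Q.
  have qEx i : (map_mx ratr (\row_i q i) : 'rV[R]_n) 0 i = ratr (q i) by rewrite !mxE.
  exists (\row_i q i, k) => //; split => /=; last first.
    by apply/ball_rVE; split => // i; rewrite qEx.
  move=> y /ball_rVE[_ yq]; apply: eB; apply/ball_rVE; split => // i.
  rewrite (le_lt_trans (ler_distD (ratr (q i)) _ _))// [e](splitr e) ltrD//.
    by rewrite distrC (lt_trans (qx i)).
  by have := yq i; rewrite qEx => /lt_trans; exact.
apply: countable_bigcupT_measurable => [|q]; first exact: (@countableP ('rV[rat]_n * nat)%type _).
have [qB|qB] := pselect (ball (map_mx ratr q.1 : 'rV[R]_n) (q.2.+1%:R^-1 : R) `<=` B).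
  rewrite (_ : c q = [set x : 'rV[R]_n | forall i,
      [set y | `|ratr (q.1 0 i) - y| < q.2.+1%:R^-1] (x 0 i)]); last first.
    apply/seteqP; split => [x [_ /ball_rVE[_ +]] i|x qx]; first by move=> /(_ i); rewrite mxE.
    split => //; apply/(ball_rVE _ _ _).2; split; first by rewrite invr_gt0 ltr0n.
    by move=> i; rewrite mxE; exact: qx.
  apply: (@measurable_box _ (fun i => [set y | `|ratr (q.1 0 i) - y| < q.2.+1%:R^-1])) => i.
  apply: open_measurable.
  exact: (@ball_open _ R (ratr (q.1 0 i))).
by rewrite (_ : c q = set0)//; apply/seteqP; split => // x [].
Qed.

Lemma hyperplane_null n (i : 'I_n) (a : R) :
  mu n ((fun x : 'rV[R]_n => x 0 i) @^-1` [set a]) = 0%E.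
Proof.
elim: n i => [[]//|n IH] i.
rewrite (_ : mu n.+1 _ = (lebesgue_measure \x mu n)%E
  (@rV_cons R n @^-1` ((fun x : 'rV[R]_n.+1 => x 0 i) @^-1` [set a])))//.
have mH m (j : 'I_m) : measurable ((fun x : 'rV[R]_m => x 0 j) @^-1` [set a]).
  by rewrite -[X in measurable X]setTI; exact: (@measurable_coord _ _ m j measurableT [set a] (measurable_set1 a)).
case: (unliftP ord0 i) => [j|] ->.
  rewrite (_ : _ @^-1` _ = setT `*` ((fun x : 'rV[R]_n => x 0 j) @^-1` [set a])); last first.
    by apply/seteqP; split => [z /=|z [_]] /=; rewrite rV_cons_lift.
  rewrite product_measure1E//.
    exact: (etrans (congr1 (mule _) (IH j)) (mule0 _)).
  exact: mH.
rewrite (_ : _ @^-1` _ = [set a] `*` setT); last first.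
  by apply/seteqP; split => [z /=|z [+ _]] /=; rewrite rV_cons_ord0.
by rewrite product_measure1E// [X in (X * _)%E]lebesgue_measure_set1 mul0e.
Qed.

End integral_rV.

(** * Affine substitutions and the Poisson kernel on the line *)

Section integral_R.
Context {R : realType}.
Notation leb := (@lebesgue_measure R).

Lemma measurable_affine (c d : R) :
  measurable_fun [set: measurableTypeR R] (fun x : R => (c * x + d : measurableTypeR R)).
Proof. by apply: measurable_funD => //; exact: measurable_funM. Qed.

(** Lebesgue measure is determined by its values on half-open intervals; for
    negative [c] the preimage of such an interval is half-open on the other
    side, which has the same length. *)
Lemma lebesgue_measure_affine (c d : R) (A : set R) : c != 0 -> measurable A ->
  (`|c|%:E * leb ((fun x => c * x + d)%R @^-1` A) = leb A)%E.
Proof.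
move=> c0 mA.
have mphi := measurable_affine c d.
pose nu : measure _ R := mscale (NngNum (normr_ge0 c))
  (pushforward leb (fun x : measurableTypeR R => (c * x + d : measurableTypeR R))).
rewrite [RHS](@lebesgue_measure_unique R (nu mphi))// => _ [[a b]] _ <-.
rewrite /nu/= /mscale/= /pushforward.
have [cp|cn] := ltP 0 c.
  rewrite (_ : _ @^-1` _ = `](a - d) / c, (b - d) / c]%classic); last first.
    by apply/seteqP; split => x /=; rewrite !in_itv/= ltr_pdivrMr// ler_pdivlMr// ltrBlDr lerBrDr (mulrC x).
  rewrite !lebesgue_measure_itv/= !lte_fin ltr_pM2r ?invr_gt0// ltrD2r.
  case: ifPn => ab; last by rewrite mule0.
  rewrite -!EFinB -EFinM gtr0_norm//; congr EFin; field; exact: lt0r_neq0.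
have {cn}cn : c < 0 by rewrite lt_neqAle c0.
rewrite (_ : _ @^-1` _ = `[(b - d) / c, (a - d) / c[%classic); last first.
  by apply/seteqP; split => x /=; rewrite !in_itv/= ltr_ndivlMr// ler_ndivrMr// ltrBlDr lerBrDr (mulrC x) andbC.
rewrite !lebesgue_measure_itv/= !lte_fin ltr_nM2r ?invr_lt0// ltrD2r.
case: ifPn => ab; last by rewrite mule0.
rewrite -!EFinB -EFinM ltr0_norm//; congr EFin; field; exact: ltr0_neq0.
Qed.

Lemma ge0_integral_affine (c d : R) (f : R -> \bar R) : c != 0 ->
  measurable_fun setT f -> (forall x, 0 <= f x)%E ->
  (`|c|%:E * \int[leb]_x f (c * x + d)%R = \int[leb]_x f x)%E.
Proof.
move=> c0 mf f0.
have mphi := measurable_affine c d.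
pose nu : measure _ R := mscale (NngNum (normr_ge0 c))
  (pushforward leb (fun x : measurableTypeR R => (c * x + d : measurableTypeR R))).
rewrite [RHS](@eq_measure_integral _ _ _ _ (nu mphi)); last first.
  by move=> A mA _; exact: (esym (lebesgue_measure_affine d c0 mA)).
rewrite /nu ge0_integral_mscale//= ge0_integral_pushforward//.
Qed.

Lemma integrable_affine (c d : R) (f : R -> R) : c != 0 ->
  leb.-integrable setT (EFin \o f) ->
  leb.-integrable setT (EFin \o (fun x => f (c * x + d))).
Proof.
move=> c0 /integrableP[mf fi].
have mphi := measurable_affine c d.
apply/integrableP; split.
  apply/measurable_EFinP; apply: (measurableT_comp (f := f)) => //.
  exact/measurable_EFinP.
move: fi; rewrite -(ge0_integral_affine d c0)//; last exact: measurableT_comp.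
rewrite muleC -lte_pdivlMr ?normr_gt0//=.
by rewrite gt0_mulye// lte_fin invr_gt0 normr_gt0.
Qed.

Lemma Rintegral_affine (c d : R) (f : R -> R) : c != 0 ->
  leb.-integrable setT (EFin \o f) ->
  `|c| * \int[leb]_x f (c * x + d) = \int[leb]_x f x.
Proof.
move=> c0 fi; have gi := integrable_affine d c0 fi.
have mf := measurable_int _ fi.
apply: EFin_inj; rewrite EFinM /Rintegral.
rewrite fineK; last exact: integrable_fin_num gi.
rewrite fineK; last exact: integrable_fin_num fi.
rewrite [in LHS]integralE [in RHS]integralE muleBr//; last first.
  exact: integrable_add_def gi.
congr (_ - _)%E.
- have H : measurable_fun setT ((EFin \o f)^\+%E) by exact: measurable_funepos.
  rewrite [RHS](_ : _ = \int[leb]_x ((EFin \o f)^\+%E x))%E//.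
  rewrite -(ge0_integral_affine d c0 H (fun x => funepos_ge0 (EFin \o f) x)).
  by congr (_ * _)%E; apply: eq_integral => x _; rewrite !funeposE.
- have H : measurable_fun setT ((EFin \o f)^\-%E) by exact: measurable_funeneg.
  rewrite [RHS](_ : _ = \int[leb]_x ((EFin \o f)^\-%E x))%E//.
  rewrite -(ge0_integral_affine d c0 H (fun x => funeneg_ge0 (EFin \o f) x)).
  by congr (_ * _)%E; apply: eq_integral => x _; rewrite !funenegE.
Qed.

Lemma Rintegral_odd (f : R -> R) : leb.-integrable setT (EFin \o f) ->
  (forall x, f (- x) = - f x) -> \int[leb]_x f x = 0.
Proof.
move=> fi fodd; have := @Rintegral_affine (-1) 0 f _ fi.
rewrite normrN1 mul1r => H.
have : \int[leb]_x f (-1 * x + 0) = - \int[leb]_x f x.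
  transitivity (\int[leb]_x (-1 * f x)); last by rewrite RintegralZl// mulN1r.
  by apply: eq_Rintegral => x _; rewrite mulN1r addr0 fodd mulN1r.
rewrite H; last by rewrite oppr_eq0 oner_eq0.
by move/eqP; rewrite -subr_eq0 opprK -mulr2n mulrn_eq0/= => /eqP.
Qed.

(** A damping weight whose Fourier transform, the Poisson kernel, is positive
    and integrable: the damped energy of a function is then a form to which
    Schur's test applies. *)
Definition abel (x : R) : R := expR (- `|x|).

Lemma continuous_abel : continuous abel.
Proof.
move=> x; rewrite /abel.
apply: (@continuous_comp _ _ _ (fun x : R => - `|x|) expR).
  by apply: continuousN; exact: norm_continuous.
exact: continuous_expR.
Qed.

Lemma abel_ge0 x : 0 <= abel x. Proof. exact: expR_ge0. Qed.

Lemma set_ge0_itv : [set x : R | (0 <= x)%R] = `[0%R, +oo[%classic.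
Proof. by apply/seteqP; split => x /=; rewrite in_itv/= andbT. Qed.

Lemma is_cvg_abel_cos (v : R) :
  (expR (- x) * (v * sin (v * x) - cos (v * x))) @[x --> +oo] --> (0 : R).
Proof.
apply: (@squeeze_cvgr _ _ _ _ (fun x => - ((`|v| + 1) * expR (- x))) (fun x => (`|v| + 1) * expR (- x))).
- near=> x; rewrite -ler_norml normrM ger0_norm ?expR_ge0// mulrC ler_wpM2r ?expR_ge0//.
  rewrite (le_trans (ler_normB _ _))// lerD//; last exact: cos_max.
  by rewrite normrM ler_piMr// sin_max.
- rewrite -oppr0 -(mulr0 (`|v| + 1)); apply: cvgN; apply: cvgMr; exact: cvgr_expR.
- rewrite -(mulr0 (`|v| + 1)); apply: cvgMr; exact: cvgr_expR.
Unshelve. all: by end_near. Qed.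

(** The antiderivative is explicit. Adding 1 to the cosine keeps the integrand
    nonnegative, so that its improper integral is its Lebesgue integral. *)
Lemma integral_abel_cos1 (v : R) :
  (\int[leb]_x (abel x * (1 + cos (v * x)))%:E = (2 + 2 / oneDsqr v)%:E)%E.
Proof.
have v0 : oneDsqr v != 0 by rewrite gt_eqF// (lt_le_trans ltr01)// oneDsqr_ge1.
have cE : continuous (fun x : R => expR (- x)).
  by move=> x; apply: continuous_comp; [exact: opp_continuous|exact: continuous_expR].
have cc : continuous (fun x : R => cos (v * x)).
  by move=> x; apply: continuous_comp; [exact: mulrl_continuous|exact: continuous_cos].
have cs : continuous (fun x : R => sin (v * x)).
  by move=> x; apply: continuous_comp; [exact: mulrl_continuous|exact: continuous_sin].
have ge0 x : 0 <= abel x * (1 + cos (v * x)).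
  by rewrite mulr_ge0// ?abel_ge0// -lerBlDl sub0r cos_geN1.
rewrite (@ge0_symfun_integralT R _ ge0); last 2 first.
- move=> x; apply: cvgM; first exact: continuous_abel.
  by apply: cvgD; [exact: cvg_cst|exact: cc].
- by move=> x; rewrite /abel/= normrN mulrN cosN.
rewrite set_ge0_itv.
transitivity (2%:E * \int[leb]_(x in `[0%R, +oo[) (expR (- x) * (1 + cos (v * x)))%:E)%E.
  congr (_ * _)%E; apply: eq_integral => x.
  by rewrite inE/= in_itv/= andbT => x0; rewrite /abel ger0_norm.
(* antiderivative of [expR (- x) * (1 + cos (v * x))] on the half-line *)
pose F (x : R) := - expR (- x) +
  (oneDsqr v)^-1 * (expR (- x) * (v * sin (v * x) - cos (v * x))).
have cF : continuous F.
  move=> x; apply: cvgD; first by apply: cvgN; exact: cE.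
  apply: cvgMr; apply: cvgM; first exact: cE.
  by apply: cvgB; [apply: cvgMr; exact: cs|exact: cc].
rewrite (@ge0_continuous_FTC2y R _ F 0 0).
- rewrite /F oppr0 expR0 mulr0 sin0 cos0 -EFinB -EFinM; congr EFin; field; exact: v0.
- by move=> x _; rewrite mulr_ge0// ?expR_ge0// -lerBlDl sub0r cos_geN1.
- apply: continuous_subspaceT => x; apply: cvgM; first exact: cE.
  by apply: cvgD; [exact: cvg_cst|exact: cc].
- rewrite -[X in _ --> X](_ : - 0 + (oneDsqr v)^-1 * 0 = 0 :> R); last by rewrite oppr0 mulr0 addr0.
  apply: cvgD; first by apply: cvgN; exact: cvgr_expR.
  by apply: cvgMr; exact: is_cvg_abel_cos.
- by move=> x _; rewrite /F; exact: ex_derive.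
- by apply: cvg_at_right_filter; exact: cF.
- move=> x _; rewrite derive1E /F derive_val.
  rewrite /GRing.scale/=; move: v0; rewrite /oneDsqr => v0; field; exact: v0.
Qed.

Lemma oneDsqr_gt0 (v : R) : 0 < oneDsqr v.
Proof. by rewrite (lt_le_trans ltr01)// oneDsqr_ge1. Qed.

Lemma measurable_abel : measurable_fun setT abel.
Proof. by apply: continuous_measurable_fun; exact: continuous_abel. Qed.

Lemma measurable_cosM (v : R) : measurable_fun setT (fun x : R => cos (v * x)).
Proof.
apply: continuous_measurable_fun => x.
by apply: continuous_comp; [exact: mulrl_continuous|exact: continuous_cos].
Qed.

Lemma measurable_sinM (v : R) : measurable_fun setT (fun x : R => sin (v * x)).
Proof.
apply: continuous_measurable_fun => x.
by apply: continuous_comp; [exact: mulrl_continuous|exact: continuous_sin].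
Qed.

Lemma normr_cos_le1 (x : R) : `|cos x| <= 1. Proof. exact: cos_max. Qed.
Lemma normr_sin_le1 (x : R) : `|sin x| <= 1. Proof. exact: sin_max. Qed.

Lemma integrable_abel : leb.-integrable setT (EFin \o abel) /\ \int[leb]_x abel x = 2.
Proof.
pose F (x : R) := abel x * (1 + cos (0 * x)).
have E x : abel x = 2^-1 * F x.
  by rewrite /F mul0r cos0; lra.
have iF : leb.-integrable setT (EFin \o F).
  apply: ge0_integrable => [|t|]; last by rewrite integral_abel_cos1 ltry.
    apply: measurable_funM; first exact: measurable_abel.
    by apply: measurable_funD => //; exact: measurable_cosM.
  by rewrite mulr_ge0 ?abel_ge0// mul0r cos0 addr_ge0.
split; first by apply: eq_integrable (integrableZl measurableT 2^-1 iF) => // x _ /=; rewrite E.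
transitivity (\int[leb]_x (2^-1 * F x)); first by apply: eq_Rintegral => x _; exact: E.
rewrite RintegralZl// /Rintegral integral_abel_cos1/=.
by rewrite /oneDsqr expr0n addr0; field.
Qed.

Lemma Rintegral_abel_cos (v : R) :
  \int[leb]_x (abel x * cos (v * x)) = 2 / oneDsqr v.
Proof.
have [i1 E1] := integrable_abel.
have i2 := integrable_bounded_mul i1 (measurable_cosM v) (fun x => normr_cos_le1 _).
have H : \int[leb]_x (abel x + abel x * cos (v * x)) = 2 + 2 / oneDsqr v.
  rewrite /Rintegral -[RHS]/(fine (2 + 2 / oneDsqr v)%:E) -integral_abel_cos1.
  by congr fine; apply: eq_integral => x _; rewrite mulrDr mulr1.
by move: H; rewrite RintegralD// E1 => /addrI.
Qed.

Lemma integral_oneDsqrV : (\int[leb]_x ((oneDsqr x)^-1)%:E = pi%:E)%E.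
Proof.
rewrite (@ge0_symfun_integralT R (fun x => (oneDsqr x)^-1)).
- by rewrite set_ge0_itv integral0y_oneDsqr -EFinM; congr EFin; field.
- by move=> x; rewrite invr_ge0 ltW// oneDsqr_gt0.
- exact: continuous_oneDsqrV.
- by move=> x; rewrite /= /oneDsqr sqrrN.
Qed.

Lemma integrable_oneDsqrV : leb.-integrable setT (EFin \o (fun x => (oneDsqr x)^-1)).
Proof.
apply: ge0_integrable; last by rewrite integral_oneDsqrV ltry.
  by apply: continuous_measurable_fun; exact: continuous_oneDsqrV.
by move=> x; rewrite invr_ge0 ltW// oneDsqr_gt0.
Qed.

Lemma Rintegral_oneDsqrV : \int[leb]_x (oneDsqr x)^-1 = pi.
Proof. by rewrite /Rintegral integral_oneDsqrV. Qed.

Section scaled_abel.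
Variable e : R.
Hypothesis e0 : 0 < e.
Let ne0 : e != 0. Proof. exact: lt0r_neq0. Qed.

(** The Fourier transform of the Abel weight at scale [e]. *)
Definition poisson (v : R) : R := 2 * e^-1 * (oneDsqr (e^-1 * v))^-1.

Lemma poisson_ge0 v : 0 <= poisson v.
Proof. by rewrite /poisson !mulr_ge0 ?invr_ge0 ?ltW// oneDsqr_gt0. Qed.

Lemma integrable_abelM : leb.-integrable setT (EFin \o (fun x => abel (e * x))).
Proof.
apply: eq_integrable (integrable_affine 0 ne0 integrable_abel.1) => // x _.
by rewrite /= addr0.
Qed.

Lemma Rintegral_abelM_cos v : \int[leb]_x (abel (e * x) * cos (v * x)) = poisson v.
Proof.
have := @Rintegral_affine e 0 (fun x => abel x * cos ((e^-1 * v) * x)) ne0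
  (integrable_bounded_mul integrable_abel.1 (measurable_cosM _) (fun x => normr_cos_le1 _)).
rewrite Rintegral_abel_cos gtr0_norm// => /(congr1 ( *%R e^-1)).
rewrite mulKf// mulrA (mulrC _ 2) -/(poisson v) => <-.
apply: eq_Rintegral => x _; rewrite addr0; congr (_ * cos _); field; exact: ne0.
Qed.

Lemma Rintegral_abelM_sin v : \int[leb]_x (abel (e * x) * sin (v * x)) = 0.
Proof.
apply: Rintegral_odd.
  exact: integrable_bounded_mul integrable_abelM (measurable_sinM _) (fun x => normr_sin_le1 _).
by move=> x; rewrite mulrN mulrN sinN /abel normrN mulrN.
Qed.

Lemma integrable_poisson s :
  leb.-integrable setT (EFin \o (fun t => poisson (t - s))).
Proof.
have ne0' : e^-1 != 0 by rewrite invr_eq0.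
have := integrableZl measurableT (2 * e^-1)
  (integrable_affine (- (e^-1 * s)) ne0' integrable_oneDsqrV).
by apply: eq_integrable => // x _; rewrite /= /poisson mulrBr.
Qed.

Lemma Rintegral_poisson s : \int[leb]_t poisson (t - s) = 2 * pi.
Proof.
have ne0' : e^-1 != 0 by rewrite invr_eq0.
have := Rintegral_affine (- (e^-1 * s)) ne0' integrable_oneDsqrV.
rewrite Rintegral_oneDsqrV => <-; rewrite gtr0_norm ?invr_gt0// mulrA -RintegralZl//.
  by apply: eq_Rintegral => x _; rewrite /poisson mulrBr.
exact: integrable_affine integrable_oneDsqrV.
Qed.

End scaled_abel.

End integral_R.

(** * Fourier integrals of tensor products *)

Section trig_tensor.
Context {R : realType}.
Notation leb := (@lebesgue_measure R).
Notation mu := (@lebesgue_rV R).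

Lemma measurable_dot d (T : measurableType d) n (f g : T -> 'rV[R]_n) :
  measurable_fun setT f -> measurable_fun setT g ->
  measurable_fun setT (fun z => dot (f z) (g z)).
Proof.
move=> mf mg; rewrite /dot; apply: measurable_sum => i.
by apply: measurable_funM; apply: (measurableT_comp (@measurable_coord _ _ _ i)).
Qed.

Lemma measurable_cosf d (T : measurableType d) (f : T -> R) :
  measurable_fun setT f -> measurable_fun setT (fun z => cos (f z)).
Proof.
move=> mf; apply: measurableT_comp => //.
by apply: continuous_measurable_fun; exact: continuous_cos.
Qed.

Lemma measurable_sinf d (T : measurableType d) (f : T -> R) :
  measurable_fun setT f -> measurable_fun setT (fun z => sin (f z)).
Proof.
move=> mf; apply: measurableT_comp => //.
by apply: continuous_measurable_fun; exact: continuous_sin.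
Qed.

Lemma dotC n (x y : 'rV[R]_n) : dot x y = dot y x.
Proof. by apply: eq_bigr => i _; rewrite mulrC. Qed.

Lemma dotDl n (x y z : 'rV[R]_n) : dot (x + y) z = dot x z + dot y z.
Proof. by rewrite /dot -big_split/=; apply: eq_bigr => i _; rewrite mxE mulrDl. Qed.

Lemma dotNl n (x z : 'rV[R]_n) : dot (- x) z = - dot x z.
Proof. by rewrite /dot -sumrN; apply: eq_bigr => i _; rewrite mxE mulNr. Qed.

Lemma dotBl n (x y z : 'rV[R]_n) : dot (x - y) z = dot x z - dot y z.
Proof. by rewrite dotDl dotNl. Qed.

(** Cosine and sine of the sum [s * v0 + dot x v'] are expanded one coordinate
    at a time; vanishing sine transforms leave a single term. *)
Lemma trig_tensor n (g : 'I_n -> R -> R) (v : 'rV[R]_n) :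
  (forall i, leb.-integrable setT (EFin \o g i)) ->
  (forall i, \int[leb]_s (g i s * sin (v 0 i * s)) = 0) ->
  \int[mu n]_x (tensor g x * cos (dot x v)) =
    \prod_i \int[leb]_s (g i s * cos (v 0 i * s)) /\
  \int[mu n]_x (tensor g x * sin (dot x v)) = 0.
Proof.
elim: n g v => [|n IH] g v ig sg.
  by rewrite /Rintegral !integral_rV0/= /tensor /dot !big_ord0 cos0 sin0 mulr1 mulr0.
pose g' j := g (lift ord0 j); pose v0 := v 0 ord0; pose v' := (rV_uncons v).2.
have v'E j : v' 0 j = v 0 (lift ord0 j) by rewrite mxE.
have dE s x : dot (rV_cons (s, x)) v = v0 * s + dot x v'.
  by rewrite -{1}(rV_unconsK v) dot_cons/= mulrC.
have [] := IH g' v' (fun j => ig _).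
  by move=> j; rewrite v'E; exact: sg.
set Pc := (X in _ = X) => Ec Es.
have [it _] := integral_tensor (fun j => ig (lift ord0 j)).
have ia := integrable_norm (ig ord0); have ib := integrable_norm it.
have mt : measurable_fun setT (tensor g).
  by apply: measurable_tensor => i; apply/measurable_EFinP; exact: measurable_int (ig i).
have md : measurable_fun setT (fun x : 'rV[R]_n.+1 => dot x v).
  by apply: measurable_dot => //; exact: measurable_cst.
have md' : measurable_fun setT (fun x : 'rV[R]_n => dot x v').
  by apply: measurable_dot => //; exact: measurable_cst.
have itc : (mu n).-integrable setT (EFin \o (fun x => tensor g' x * cos (dot x v'))).
  by apply: integrable_bounded_mul it _ (fun x => normr_cos_le1 _); exact: measurable_cosf.
have its : (mu n).-integrable setT (EFin \o (fun x => tensor g' x * sin (dot x v'))).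
  by apply: integrable_bounded_mul it _ (fun x => normr_sin_le1 _); exact: measurable_sinf.
have i0c : leb.-integrable setT (EFin \o (fun s => g ord0 s * cos (v0 * s))).
  exact: integrable_bounded_mul (ig ord0) (measurable_cosM _) (fun x => normr_cos_le1 _).
split.
- rewrite (Rintegral_rV1 _ ia ib); last 2 first.
  + by apply: measurable_funM => //; exact: measurable_cosf.
  + move=> s x; rewrite tensor_cons normrM (normrM (g _ _)) -[leRHS]mulr1 ler_wpM2l//.
    exact: normr_cos_le1.
  rewrite big_ord_recl mulrC.
  transitivity (\int[leb]_s (Pc * (g ord0 s * cos (v0 * s)))); last first.
    by rewrite RintegralZl//; congr (_ * _); apply: eq_bigr => j _; rewrite v'E.
  apply: eq_Rintegral => s _.
  transitivity (\int[mu n]_x (g ord0 s * cos (v0 * s) * (tensor g' x * cos (dot x v'))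
     + (- (g ord0 s * sin (v0 * s))) * (tensor g' x * sin (dot x v')))).
    by apply: eq_Rintegral => x _; rewrite tensor_cons dE cosD /= -/g'; ring.
  rewrite RintegralD//; [|exact: (integrableZl measurableT _ itc)|exact: (integrableZl measurableT _ its)].
  by rewrite !RintegralZl// Es mulr0 addr0 Ec mulrC.
- rewrite (Rintegral_rV1 _ ia ib); last 2 first.
  + by apply: measurable_funM => //; exact: measurable_sinf.
  + move=> s x; rewrite tensor_cons normrM (normrM (g _ _)) -[leRHS]mulr1 ler_wpM2l//.
    exact: normr_sin_le1.
  transitivity (\int[leb]_s (Pc * (g ord0 s * sin (v0 * s)))); last first.
    rewrite RintegralZl//; first by rewrite (sg ord0) mulr0.
    exact: integrable_bounded_mul (ig ord0) (measurable_sinM _) (fun x => normr_sin_le1 _).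
  apply: eq_Rintegral => s _.
  transitivity (\int[mu n]_x (g ord0 s * sin (v0 * s) * (tensor g' x * cos (dot x v'))
     + (g ord0 s * cos (v0 * s)) * (tensor g' x * sin (dot x v')))).
    by apply: eq_Rintegral => x _; rewrite tensor_cons dE sinD /= -/g'; ring.
  rewrite RintegralD//; [|exact: (integrableZl measurableT _ itc)|exact: (integrableZl measurableT _ its)].
  by rewrite !RintegralZl// Es mulr0 addr0 Ec mulrC.
Qed.

End trig_tensor.

Section compactly_supported.
Context {R : realType} {n : nat}.
Notation mu := (@lebesgue_rV R).
Notation leb := (@lebesgue_measure R).
Implicit Types (phi : 'rV[R]_n -> R) (x : 'rV[R]_n).

Definition box_supported (N : R) phi :=
  forall x, phi x != 0 -> forall i, `|x 0 i| <= N.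

Definition Cc phi := continuous phi /\ exists N, box_supported N phi.

Definition box_ind (N : R) : 'rV[R]_n -> R := tensor (fun _ : 'I_n => \1_(`[- N, N]%classic)).

Lemma box_ind01 N x : box_ind N x = 0 \/ box_ind N x = 1.
Proof.
rewrite /box_ind /tensor; elim/big_ind: _ => [|a b [->|->] [->|->]|i _]; rewrite ?mulr0 ?mul0r ?mulr1; auto.
by rewrite indicE; case: (_ \in _); auto.
Qed.

Lemma box_ind_ge0 N x : 0 <= box_ind N x.
Proof. by case: (box_ind01 N x) => ->. Qed.

Lemma box_ind_le1 N x : box_ind N x <= 1.
Proof. by case: (box_ind01 N x) => ->. Qed.

Lemma box_ind1 N x : (forall i, `|x 0 i| <= N) -> box_ind N x = 1.
Proof.
move=> xN; rewrite /box_ind /tensor big1// => i _.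
by rewrite indicE mem_set//= in_itv/= -ler_norml.
Qed.

Lemma box_supportedE N phi x : box_supported N phi -> phi x = box_ind N x * phi x.
Proof.
move=> Np; have [->|px] := eqVneq (phi x) 0; first by rewrite mulr0.
by rewrite box_ind1 ?mul1r//; exact: Np.
Qed.

Lemma integrable_indic_itv (a b : R) :
  leb.-integrable setT (EFin \o (\1_(`[a, b]%classic) : R -> R)).
Proof.
apply: ge0_integrable => //.
rewrite integral_indic// setIT.
suff : (leb `[a, b]%classic < +oo)%E by [].
rewrite lebesgue_measure_itv/=.
by case: ifP => // _; rewrite -EFinB ltry.
Qed.

Lemma integrable_box_ind N : (mu n).-integrable setT (EFin \o box_ind N).
Proof. by apply: (integral_tensor _).1 => i; exact: integrable_indic_itv. Qed.

Lemma compact_box (N : R) : compact [set x : 'rV[R]_n | forall i, `[- N, N]%classic (x 0 i)].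
Proof. exact: (rV_compact (fun i : 'I_n => @segment_compact R (- N) N)). Qed.

Lemma Cc_bounded phi : Cc phi -> exists M, forall x, `|phi x| <= M.
Proof.
move=> [cp [N pN]].
have /compact_bounded[M [_ MA]] : compact (phi @` [set x : 'rV[R]_n | forall i, `[- N, N]%classic (x 0 i)]).
  apply: continuous_compact; first by apply: continuous_subspaceT; exact: cp.
  exact: compact_box.
exists (`|M| + 1) => x; have [->|px] := eqVneq (phi x) 0; first by rewrite normr0 addr_ge0.
have MM : M < `|M| + 1 by rewrite (le_lt_trans (ler_norm _))// ltrDl.
apply: (MA _ MM (phi x)).
by exists x => // i; rewrite /= in_itv/= -ler_norml; exact: pN.
Qed.

Lemma Cc_measurable phi : Cc phi -> measurable_fun setT phi.
Proof. by move=> [cp _]; exact: continuous_measurable_rV. Qed.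

Lemma Cc_integrable phi : Cc phi -> (mu n).-integrable setT (EFin \o phi).
Proof.
move=> Cp; have [M pM] := Cc_bounded Cp; have [cp [N pN]] := Cp.
have := integrable_bounded_mul (integrable_box_ind N) (Cc_measurable Cp) pM.
by apply: eq_integrable => // x _ /=; rewrite -box_supportedE.
Qed.

End compactly_supported.

(** * Cosine and sine transforms, and the Plancherel inequality *)

Section transforms.
Context {R : realType} {n : nat}.
Notation mu := (@lebesgue_rV R n).
Notation leb := (@lebesgue_measure R).
Implicit Types (phi : 'rV[R]_n -> R) (x : 'rV[R]_n).

Definition cosT phi x : R := \int[mu]_t (phi t * cos (dot t x)).
Definition sinT phi x : R := \int[mu]_t (phi t * sin (dot t x)).

Lemma measurable_dotl x : measurable_fun setT (fun t : 'rV[R]_n => dot t x).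
Proof. by apply: measurable_dot => //; exact: measurable_cst. Qed.

Section bounded_kernel.
Variable c : R -> R.
Hypothesis mc : measurable_fun setT c.
Hypothesis c1 : forall u, `|c u| <= 1.

Lemma integrable_mul_kernel phi x : mu.-integrable setT (EFin \o phi) ->
  mu.-integrable setT (EFin \o (fun t => phi t * c (dot t x))).
Proof.
move=> ip; apply: integrable_bounded_mul ip _ (fun x => c1 _).
by apply: measurableT_comp => //; exact: measurable_dotl.
Qed.

Lemma transform_bound phi x : mu.-integrable setT (EFin \o phi) ->
  `|\int[mu]_t (phi t * c (dot t x))| <= \int[mu]_t `|phi t|.
Proof.
move=> ip; have ipc := integrable_mul_kernel x ip.
apply: (le_trans (le_normr_Rintegral measurableT ipc)).
apply: le_Rintegral => //; [exact: integrable_norm ipc|exact: integrable_norm ip|].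
by move=> t _ /=; rewrite normrM ler_piMr.
Qed.

Lemma transformD phi psi x : mu.-integrable setT (EFin \o phi) ->
  mu.-integrable setT (EFin \o psi) ->
  \int[mu]_t ((phi t + psi t) * c (dot t x)) =
    \int[mu]_t (phi t * c (dot t x)) + \int[mu]_t (psi t * c (dot t x)).
Proof.
move=> ip iq; rewrite -RintegralD//; [|exact: integrable_mul_kernel|exact: integrable_mul_kernel].
by apply: eq_Rintegral => t _; rewrite mulrDl.
Qed.

Lemma transformZ (a : R) phi x : mu.-integrable setT (EFin \o phi) ->
  \int[mu]_t (a * phi t * c (dot t x)) = a * \int[mu]_t (phi t * c (dot t x)).
Proof.
move=> ip; rewrite -RintegralZl//; last exact: integrable_mul_kernel.
by apply: eq_Rintegral => t _; rewrite mulrA.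
Qed.

End bounded_kernel.

Let mcos : measurable_fun setT (@cos R).
Proof. by apply: continuous_measurable_fun; exact: continuous_cos. Qed.

Let msin : measurable_fun setT (@sin R).
Proof. by apply: continuous_measurable_fun; exact: continuous_sin. Qed.

Definition integrable_mul_cos := integrable_mul_kernel mcos normr_cos_le1.
Definition integrable_mul_sin := integrable_mul_kernel msin normr_sin_le1.

Lemma cosT_bound phi x : mu.-integrable setT (EFin \o phi) ->
  `|cosT phi x| <= \int[mu]_t `|phi t|.
Proof. by move=> ip; exact: (transform_bound mcos normr_cos_le1 x ip). Qed.

Lemma sinT_bound phi x : mu.-integrable setT (EFin \o phi) ->
  `|sinT phi x| <= \int[mu]_t `|phi t|.
Proof. by move=> ip; exact: (transform_bound msin normr_sin_le1 x ip). Qed.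

Lemma cosTD phi psi x : mu.-integrable setT (EFin \o phi) -> mu.-integrable setT (EFin \o psi) ->
  cosT (fun t => phi t + psi t) x = cosT phi x + cosT psi x.
Proof. by move=> ip iq; exact: (transformD mcos normr_cos_le1 x ip iq). Qed.

Lemma sinTD phi psi x : mu.-integrable setT (EFin \o phi) -> mu.-integrable setT (EFin \o psi) ->
  sinT (fun t => phi t + psi t) x = sinT phi x + sinT psi x.
Proof. by move=> ip iq; exact: (transformD msin normr_sin_le1 x ip iq). Qed.

Lemma cosTZ (a : R) phi x : mu.-integrable setT (EFin \o phi) ->
  cosT (fun t => a * phi t) x = a * cosT phi x.
Proof. by move=> ip; exact: (transformZ mcos normr_cos_le1 a x ip). Qed.

Lemma sinTZ (a : R) phi x : mu.-integrable setT (EFin \o phi) ->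
  sinT (fun t => a * phi t) x = a * sinT phi x.
Proof. by move=> ip; exact: (transformZ msin normr_sin_le1 a x ip). Qed.

Definition abelT (e : R) : 'rV[R]_n -> R := tensor (fun _ : 'I_n => fun s => abel (e * s)).
Definition poissonT (e : R) : 'rV[R]_n -> R := tensor (fun _ : 'I_n => poisson e).

Section fixed_scale.
Variable e : R.
Hypothesis e0 : 0 < e.

Lemma abelT_gt0 x : 0 < abelT e x.
Proof. by apply: prodr_gt0 => i _; exact: expR_gt0. Qed.

Lemma poissonT_ge0 x : 0 <= poissonT e x.
Proof. by apply: prodr_ge0 => i _; exact: poisson_ge0. Qed.

Lemma integrable_abelT : mu.-integrable setT (EFin \o abelT e).
Proof. by apply: (integral_tensor _).1 => i; exact: integrable_abelM. Qed.

Lemma measurable_abelT : measurable_fun setT (abelT e).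
Proof. by apply/measurable_EFinP; exact: measurable_int integrable_abelT. Qed.

Lemma Rintegral_abelT_cos v : \int[mu]_x (abelT e x * cos (dot x v)) = poissonT e v.
Proof.
have [||-> _] := @trig_tensor R n (fun _ s => abel (e * s)) v.
- by move=> i; exact: integrable_abelM.
- by move=> i; exact: Rintegral_abelM_sin.
- by apply: eq_bigr => i _; exact: Rintegral_abelM_cos.
Qed.

Lemma poisson_le (v : R) : poisson e v <= 2 * e^-1.
Proof.
rewrite /poisson -[leRHS]mulr1 ler_wpM2l//; first by rewrite mulr_ge0// invr_ge0 ltW.
by rewrite invf_le1 ?oneDsqr_gt0// oneDsqr_ge1.
Qed.

Lemma poissonT_le x : poissonT e x <= (2 * e^-1) ^+ n.
Proof.
rewrite [leRHS](_ : _ = \prod_(i < n) (2 * e^-1)); last by rewrite prodr_const card_ord.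
by apply: ler_prod => i _; rewrite poisson_ge0//= poisson_le.
Qed.

Lemma continuous_poisson : continuous (poisson e).
Proof.
move=> v; rewrite /poisson; apply: cvgMr.
apply: (@continuous_comp _ _ _ (fun v => e^-1 * v) (fun v => (oneDsqr v)^-1)).
  exact: mulrl_continuous.
exact: continuous_oneDsqrV.
Qed.

Lemma measurable_poissonT : measurable_fun setT (poissonT e).
Proof.
by apply: measurable_tensor => i; apply: continuous_measurable_fun; exact: continuous_poisson.
Qed.

Lemma poissonTN x : poissonT e (- x) = poissonT e x.
Proof.
apply: eq_bigr => i _; rewrite mxE /poisson.
by rewrite mulrN /oneDsqr sqrrN.
Qed.

Lemma integral_poissonT s :
  mu.-integrable setT (EFin \o (fun t => poissonT e (t - s))) /\
  \int[mu]_t poissonT e (t - s) = (2 * pi) ^+ n.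
Proof.
have [|it Et] := @integral_tensor R n (fun i t => poisson e (t - s 0 i)).
  by move=> i; exact: integrable_poisson.
have E t : poissonT e (t - s) = tensor (fun i t => poisson e (t - s 0 i)) t.
  by apply: eq_bigr => i _; rewrite !mxE.
split; first by apply: eq_integrable it => // t _; rewrite /= E.
rewrite (eq_Rintegral _ (fun t _ => E t)) Et.
by rewrite (eq_bigr (fun=> 2 * pi)) ?prodr_const ?card_ord// => i _; exact: Rintegral_poisson.
Qed.

End fixed_scale.

Lemma measurable_abelTV e : measurable_fun setT (fun x => (abelT e x)^-1).
Proof.
rewrite (_ : (fun _ => _) = tensor (fun _ s => (abel (e * s))^-1)).
  apply: measurable_tensor => i; apply: continuous_measurable_fun => s.
  apply: cvgV; first by rewrite gt_eqF// expR_gt0.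
  apply: (@continuous_comp _ _ _ (fun s => e * s) abel); first exact: mulrl_continuous.
  exact: continuous_abel.
by apply/funext => x; rewrite /abelT /tensor prodfV.
Qed.

Section measurable_transforms.
Variable phi : 'rV[R]_n -> R.
Hypothesis iphi : mu.-integrable setT (EFin \o phi).

Let measurable_transform (c : R -> R) : measurable_fun setT c -> (forall u, `|c u| <= 1) ->
  measurable_fun setT (fun x => \int[mu]_t (phi t * c (dot t x))).
Proof.
move=> mc c1; apply: (@measurable_Rintegral_damped _ _ _ _ R mu mu (abelT 1) phi
  (fun z => c (dot z.2 z.1))) => //.
- exact: abelT_gt0.
- exact: integrable_abelT.
- exact: measurable_abelTV.
- apply: (measurableT_comp mc).
  by apply: measurable_dot; [exact: measurable_snd|exact: measurable_fst].
Qed.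

Lemma measurable_cosT : measurable_fun setT (cosT phi).
Proof. exact: measurable_transform mcos normr_cos_le1. Qed.

Lemma measurable_sinT : measurable_fun setT (sinT phi).
Proof. exact: measurable_transform msin normr_sin_le1. Qed.

End measurable_transforms.

Section fixed_function.
Variable e : R.
Hypothesis e0 : 0 < e.
Variable phi : 'rV[R]_n -> R.
Hypothesis Cphi : Cc phi.
Let mphi := Cc_measurable Cphi.
Let iphi := Cc_integrable Cphi.

Let mdot : measurable_fun [set: 'rV[R]_n * 'rV[R]_n] (fun z => dot z.2 z.1).
Proof. by apply: measurable_dot; [exact: measurable_snd|exact: measurable_fst]. Qed.

Let mfst (g : 'rV[R]_n -> R) : measurable_fun setT g ->
  measurable_fun [set: 'rV[R]_n * 'rV[R]_n] (fun z => g z.1).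
Proof. by move=> mg; exact: measurableT_comp. Qed.

Let msnd (g : 'rV[R]_n -> R) : measurable_fun setT g ->
  measurable_fun [set: 'rV[R]_n * 'rV[R]_n] (fun z => g z.2).
Proof. by move=> mg; exact: measurableT_comp. Qed.

Let I := \int[mu]_t `|phi t|.

Let I0 : 0 <= I. Proof. by apply: Rintegral_ge0. Qed.

(** Both squares are expanded as double integrals; they combine to the cosine
    of the difference [t - s], whose Abel-damped integral in frequency is the
    Poisson kernel. *)
Lemma damped_energy :
  \int[mu]_x (abelT e x * (cosT phi x ^+ 2 + sinT phi x ^+ 2)) =
  \int[mu]_s \int[mu]_t (phi s * phi t * poissonT e (t - s)).
Proof.
pose F1 (z : 'rV[R]_n * 'rV[R]_n) := abelT e z.1 * (cosT phi z.1 * cos (dot z.2 z.1) +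
   sinT phi z.1 * sin (dot z.2 z.1)) * phi z.2.
have mF1 : measurable_fun setT F1.
  apply: measurable_funM; last exact: msnd mphi.
  apply: measurable_funM; first exact: mfst (measurable_abelT e0).
  apply: measurable_funD; apply: measurable_funM.
  - exact: mfst (measurable_cosT iphi).
  - exact: measurable_cosf.
  - exact: mfst (measurable_sinT iphi).
  - exact: measurable_sinf.
have ia : mu.-integrable setT (EFin \o (fun x => (2 * I) * abelT e x)).
  exact: (integrableZl measurableT _ (integrable_abelT e0)).
have ib := integrable_norm iphi.
have F1ab x s : `|F1 (x, s)| <= (2 * I) * abelT e x * `|phi s|.
  rewrite /F1/= !normrM ler_wpM2r// (ger0_norm (ltW (abelT_gt0 e _))) mulrC.
  rewrite ler_wpM2r ?(ltW (abelT_gt0 e _))// (le_trans (ler_normD _ _))// mulr_natl mulr2n.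
  by apply: lerD; rewrite normrM -[leRHS]mulr1 ler_pM// ?cosT_bound ?sinT_bound ?normr_cos_le1 ?normr_sin_le1.
transitivity (\int[mu]_x \int[mu]_s F1 (x, s)).
  apply: eq_Rintegral => x _.
  transitivity (\int[mu]_s ((abelT e x * cosT phi x) * (phi s * cos (dot s x)) +
      (abelT e x * sinT phi x) * (phi s * sin (dot s x)))).
    rewrite RintegralD//; last 2 first.
    - exact: (integrableZl measurableT _ (integrable_mul_cos x iphi)).
    - exact: (integrableZl measurableT _ (integrable_mul_sin x iphi)).
    rewrite !RintegralZl//; [|exact: integrable_mul_sin|exact: integrable_mul_cos].
    by rewrite -/(cosT phi x) -/(sinT phi x); ring.
  by apply: eq_Rintegral => s _; rewrite /F1/=; ring.
rewrite (Rfubini mF1 ia ib F1ab); apply: eq_Rintegral => s _.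
(* with [s] fixed, the product of the two integrands is [cos (dot (t - s) x)] *)
pose F2 (z : 'rV[R]_n * 'rV[R]_n) := phi s * (abelT e z.1 * phi z.2 * cos (dot (z.2 - s) z.1)).
have F2ab x t : `|F2 (x, t)| <= (`|phi s| * abelT e x) * `|phi t|.
  rewrite /F2/= normrM -(mulrA `|phi s|) ler_wpM2l// !normrM (ger0_norm (ltW (abelT_gt0 e _))).
  rewrite -[leRHS]mulr1 ler_wpM2l ?normr_cos_le1//.
  by rewrite mulr_ge0// (ltW (abelT_gt0 e _)).
have ia2 : mu.-integrable setT (EFin \o (fun x => `|phi s| * abelT e x)).
  exact: (integrableZl measurableT _ (integrable_abelT e0)).
have mF2 : measurable_fun setT F2.
  apply: measurable_funM => //.
  apply: measurable_funM; first by apply: measurable_funM; [exact: mfst (measurable_abelT e0)|exact: msnd mphi].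
  apply: measurable_cosf; apply: measurable_dot; last exact: measurable_fst.
  apply/measurable_fun_coordP => i.
  rewrite (_ : (fun _ => _) = (fun z : 'rV[R]_n * 'rV[R]_n => z.2 0 i - s 0 i)).
    apply: measurable_funB => //.
    exact: (@msnd (fun x => x 0 i) (@measurable_coord _ _ _ i)).
  by apply/funext => z; rewrite !mxE.
transitivity (\int[mu]_x \int[mu]_t F2 (x, t)).
  apply: eq_Rintegral => x _.
  transitivity (\int[mu]_t
      ((phi s * abelT e x * cos (dot s x)) * (phi t * cos (dot t x)) +
       (phi s * abelT e x * sin (dot s x)) * (phi t * sin (dot t x)))).
    rewrite RintegralD//; last 2 first.
    - exact: (integrableZl measurableT _ (integrable_mul_cos x iphi)).
    - exact: (integrableZl measurableT _ (integrable_mul_sin x iphi)).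
    rewrite !RintegralZl//; [|exact: integrable_mul_sin|exact: integrable_mul_cos].
    by rewrite -/(cosT phi x) -/(sinT phi x) /F1/=; ring.
  by apply: eq_Rintegral => t _; rewrite /F2/= dotBl cosB; ring.
rewrite (Rfubini mF2 ia2 ib F2ab); apply: eq_Rintegral => t _.
rewrite -(Rintegral_abelT_cos e0) -RintegralZl//; last exact: integrable_mul_cos (integrable_abelT e0).
by apply: eq_Rintegral => x _; rewrite /F2/= (dotC x); ring.
Qed.

(** Schur's test: the Poisson kernel has integral [(2 * pi) ^+ n] in each
    variable. The indicator of a box carrying [phi] makes [phi s ^+ 2] a
    function of two variables that is integrable over the product. *)
Lemma damped_energy_le :
  \int[mu]_x (abelT e x * (cosT phi x ^+ 2 + sinT phi x ^+ 2)) <=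
  (2 * pi) ^+ n * \int[mu]_t (phi t ^+ 2).
Proof.
rewrite damped_energy; have [_ [N pN]] := Cphi; have [M pM] := Cc_bounded Cphi.
pose P := (2 * e^-1) ^+ n.
have P0 : 0 <= P by rewrite exprn_ge0// mulr_ge0// invr_ge0 ltW.
have mP : measurable_fun setT (fun z : 'rV[R]_n * 'rV[R]_n => poissonT e (z.2 - z.1)).
  apply: (measurableT_comp (measurable_poissonT e)).
  apply/measurable_fun_coordP => i.
  rewrite (_ : (fun _ => _) = (fun z : 'rV[R]_n * 'rV[R]_n => z.2 0 i - z.1 0 i)).
    apply: measurable_funB.
    - exact: (@msnd (fun x => x 0 i) (@measurable_coord _ _ _ i)).
    - exact: (@mfst (fun x => x 0 i) (@measurable_coord _ _ _ i)).
  by apply/funext => z; rewrite !mxE.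
have nP x : `|poissonT e x| <= P by rewrite ger0_norm ?poissonT_ge0// poissonT_le.
pose chi := box_ind N : 'rV[R]_n -> R.
have ichi : mu.-integrable setT (EFin \o chi) by exact: integrable_box_ind.
have mchi : measurable_fun setT chi by apply/measurable_EFinP; exact: measurable_int ichi.
have i2 : mu.-integrable setT (EFin \o (fun x => phi x ^+ 2)).
  have := integrable_bounded_mul iphi mphi pM.
  by apply: eq_integrable => // x _.
have D (a b : 'rV[R]_n -> R) : measurable_fun setT a -> measurable_fun setT b ->
    measurable_fun setT (fun z : 'rV[R]_n * 'rV[R]_n => a z.1 * b z.2 * poissonT e (z.2 - z.1)) /\
    forall s t, `|a s * b t * poissonT e (t - s)| <= (P * `|a s|) * `|b t|.
  move=> ma mb; split.
    by apply: measurable_funM => //; apply: measurable_funM; [exact: mfst|exact: msnd].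
  by move=> s t; rewrite !normrM mulrC -(mulrA P) ler_wpM2r// mulr_ge0.
have iP (a : 'rV[R]_n -> R) : mu.-integrable setT (EFin \o a) ->
    mu.-integrable setT (EFin \o (fun s => P * `|a s|)).
  by move=> ia; exact: (integrableZl measurableT _ (integrable_norm ia)).
have m2 : measurable_fun setT (fun x => phi x ^+ 2) by apply/measurable_EFinP; exact: measurable_int i2.
have [mG bG] := D _ _ mphi mphi.
have [mY bY] := D _ _ m2 mchi.
have [mZ bZ] := D _ _ mchi m2.
set G := (fun z => _) in mG; set Y := (fun z => _) in mY; set Z := (fun z => _) in mZ.
have ibG := integrable_norm iphi; have ibY := integrable_norm ichi.
have ibZ := integrable_norm i2.
have iG := dominated_integrable_prod mG (iP _ iphi) ibG bG.
have iY := dominated_integrable_prod mY (iP _ i2) ibY bY.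
have iZ := dominated_integrable_prod mZ (iP _ ichi) ibZ bZ.
have q s : \int[mu]_t (chi t * poissonT e (t - s)) <= (2 * pi) ^+ n.
  have [ip <-] := integral_poissonT e0 s; apply: le_Rintegral => //.
  - apply: (integrable_bounded_mul ichi _ (fun t => nP _)).
    by apply/measurable_EFinP; exact: measurable_int ip.
  - by move=> t _; rewrite -[leRHS]mul1r ler_wpM2r ?poissonT_ge0// box_ind_le1.
have A : \int[mu]_s (phi s ^+ 2 * \int[mu]_t (chi t * poissonT e (t - s))) <=
    (2 * pi) ^+ n * \int[mu]_t (phi t ^+ 2).
  rewrite mulrC -RintegralZr//; apply: le_Rintegral => //.
  - have := integrable_Rintegral_section1 mY (iP _ i2) ibY bY.
    apply: eq_integrable => // s _; congr EFin.
    rewrite -RintegralZl//; first by apply: eq_Rintegral => t _; rewrite /Y/= mulrA.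
    apply: (integrable_bounded_mul ichi _ (fun t => nP _)).
    by have [ip _] := integral_poissonT e0 s; apply/measurable_EFinP; exact: measurable_int ip.
  - exact: (integrableZr measurableT _ i2).
  - by move=> s _; rewrite ler_wpM2l// sqr_ge0.
have Ech s : mu.-integrable setT (EFin \o (fun t => chi t * poissonT e (t - s))).
  apply: (integrable_bounded_mul ichi _ (fun t => nP _)).
  by have [ip _] := integral_poissonT e0 s; apply/measurable_EFinP; exact: measurable_int ip.
have EY : \int[(mu \x mu)%E]_z Y z =
    \int[mu]_s (phi s ^+ 2 * \int[mu]_t (chi t * poissonT e (t - s))).
  rewrite (Rfubini1 mY (iP _ i2) ibY bY); apply: eq_Rintegral => s _.
  by rewrite -RintegralZl//; apply: eq_Rintegral => t _; rewrite /Y/= mulrA.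
have EZ : \int[(mu \x mu)%E]_z Z z =
    \int[mu]_s (phi s ^+ 2 * \int[mu]_t (chi t * poissonT e (t - s))).
  rewrite (Rfubini2 mZ (iP _ ichi) ibZ bZ); apply: eq_Rintegral => s _.
  rewrite -RintegralZl//; apply: eq_Rintegral => t _.
  by rewrite /Z/= -poissonTN opprB; ring.
rewrite -(Rfubini1 mG (iP _ iphi) ibG bG).
apply: (@le_trans _ _ (\int[(mu \x mu)%E]_z (2^-1 * (Y z + Z z)))); last first.
  have iYZ : (mu \x mu)%E.-integrable setT (EFin \o (fun z => Y z + Z z)).
    exact: (integrableD measurableT iY iZ).
  rewrite RintegralZl// RintegralD// EY EZ; apply: le_trans A.
  by rewrite le_eqVlt -mulr2n -[X in _ * X]mulr_natl mulKf ?eqxx// pnatr_eq0.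
apply: le_Rintegral => //.
  apply: (integrableZl measurableT _ (integrableD measurableT iY iZ)).
move=> [s t] _; rewrite /G /Y /Z/= -mulrDl mulrA ler_wpM2r ?poissonT_ge0//.
(* [2 * a * b <= a ^+ 2 + b ^+ 2], restricted to the box in each variable *)
rewrite (box_supportedE s pN) (box_supportedE t pN) -/chi.
have : 0 <= (phi s - phi t) ^+ 2 by exact: sqr_ge0.
rewrite /chi; have := box_ind01 N s; have := box_ind01 N t.
by move=> [->|->] [->|->]; nra.
Qed.

End fixed_function.

Lemma cvg_prod (I : Type) (r : seq I) (F : nat -> I -> R) (l : I -> R) :
  (forall i, F ^~ i @ \oo --> l i) ->
  (fun k => \prod_(i <- r) F k i) @ \oo --> \prod_(i <- r) l i.
Proof.
move=> Fl; elim: r => [|i r IH].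
  by under eq_fun do rewrite big_nil; rewrite big_nil; exact: cvg_cst.
under eq_fun do rewrite big_cons; rewrite big_cons; apply: cvgM => //; exact: Fl.
Qed.

(** The inequality half of Plancherel's theorem: the damping is removed by
    monotone convergence. *)
Lemma plancherel_le phi : Cc phi ->
  (\int[mu]_x (cosT phi x ^+ 2 + sinT phi x ^+ 2)%:E <=
   ((2 * pi) ^+ n * \int[mu]_t (phi t ^+ 2))%:E)%E.
Proof.
move=> Cp; have ip := Cc_integrable Cp.
pose E x := cosT phi x ^+ 2 + sinT phi x ^+ 2.
pose h k : R := k.+1%:R^-1; have h0 k : 0 < h k by rewrite invr_gt0 ltr0n.
have E0 x : 0 <= E x by rewrite addr_ge0// sqr_ge0.
have mE : measurable_fun setT E.
  by apply: measurable_funD; apply: measurable_funX; [exact: measurable_cosT|exact: measurable_sinT].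
pose g k x : \bar R := (abelT (h k) x * E x)%:E.
have mg k : measurable_fun setT (g k).
  by apply/measurable_EFinP; apply: measurable_funM => //; exact: measurable_abelT.
have g0 k x : (0 <= g k x)%E by rewrite lee_fin mulr_ge0// ltW// abelT_gt0.
have ndg x : {homo g^~ x : m k / (m <= k)%N >-> (m <= k)%E}.
  move=> m k mk; rewrite lee_fin ler_wpM2r// ler_prod// => i _; rewrite expR_ge0/=.
  rewrite ler_expR lerN2 !normrM ler_wpM2r// !gtr0_norm// lef_pV2 ?posrE ?ltr0n//.
  by rewrite ler_nat.
have cg x : g^~ x @ \oo --> (E x)%:E.
  apply: cvg_EFin; first by near=> k.
  rewrite -[X in _ --> X]mul1r; apply: cvgMl.
  rewrite -[X in _ --> X](_ : \prod_(i < n) 1 = 1); last by rewrite big1.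
  apply: cvg_prod => i.
  rewrite -[X in _ --> X](_ : abel (0 * x 0 i) = 1 :> R); last by rewrite mul0r /abel normr0 oppr0 expR0.
  apply: (@cvg_comp _ _ _ (fun k => h k * x 0 i) abel _ (nbhs (0 * x 0 i))); last exact: continuous_abel.
  by apply: cvgMl; exact: cvg_harmonic.
have := cvg_monotone_convergence measurableT mg (fun k x _ => g0 k x) (fun x _ => ndg x).
move=> /(_ mu) cv.
rewrite (_ : (\int[mu]_x (cosT phi x ^+ 2 + sinT phi x ^+ 2)%:E)%E =
    limn (fun k => \int[mu]_x g k x)%E); last first.
  rewrite (cvg_lim _ cv)//; apply: eq_integral => x _; apply/esym.
  by apply: cvg_lim => //; exact: cg.
apply: lime_le; first by apply/cvg_ex; eexists; exact: cv.
near=> k.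
have ik : mu.-integrable setT (EFin \o (fun x => abelT (h k) x * E x)).
  apply: (integrable_bounded_mul (integrable_abelT (h0 k)) mE).
  move=> x; rewrite ger0_norm//.
  have sq (a b : R) : `|a| <= b -> a ^+ 2 <= b ^+ 2.
    move=> ab; rewrite -(real_normK (num_real a)) lerXn2r ?nnegrE//.
    exact: le_trans (normr_ge0 _) ab.
  exact: (lerD (sq _ _ (cosT_bound x ip)) (sq _ _ (sinT_bound x ip))).
rewrite -(fineK (integrable_fin_num measurableT ik)) lee_fin.
exact: damped_energy_le.
Unshelve. all: by end_near. Qed.

End transforms.

(** * Smooth functions and integration by parts *)

Section iterated_smoothness.
Context {R : realType} {V : normedModType R} (dirs : set V).
Implicit Types (g h : V -> R) (x v : V).

(** [C^m] along a set of directions, by recursion on [m]: unlike a condition on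
    all iterated derivatives at once, this passes through the product and
    quotient rules by a plain induction. *)
Fixpoint ctimes (m : nat) (g : V -> R) : Prop :=
  match m with
  | 0 => continuous g
  | k.+1 => continuous g /\ forall v, dirs v ->
      (forall x, derivable g x v) /\ ctimes k (fun x => 'D_v g x)
  end.

Lemma ctimesW m g : ctimes m.+1 g -> ctimes m g.
Proof.
elim: m g => [|m IH] g; first by case.
move=> [cg Dg]; split => // v dv; have [gv Dvg] := Dg v dv.
by split => //; exact: IH.
Qed.

Lemma eq_ctimes m g h : g =1 h -> ctimes m h -> ctimes m g.
Proof. by move=> /funext ->. Qed.

Lemma ctimes_cst m (c : R) : ctimes m (fun=> c).
Proof.
elim: m c => [|m IH] c /=; first by move=> x; exact: cvg_cst.
split; first by move=> x; exact: cvg_cst.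
move=> v _; split; first by move=> x; exact: derivable_cst.
apply: (eq_ctimes _ (IH 0)) => x; exact: derive_cst.
Qed.

Lemma ctimesD m g h : ctimes m g -> ctimes m h -> ctimes m (fun x => g x + h x).
Proof.
elim: m g h => [|m IH] g h /=; first by move=> cg ch x; apply: continuousD; [exact: cg|exact: ch].
move=> [cg Dg] [ch Dh]; split; first by move=> x; apply: continuousD; [exact: cg|exact: ch].
move=> v dv; have [gv Dvg] := Dg v dv; have [hv Dvh] := Dh v dv.
split; first by move=> x; exact: (derivableD (gv x) (hv x)).
by apply: (eq_ctimes _ (IH _ _ Dvg Dvh)) => x; exact: (deriveD (gv x) (hv x)).
Qed.

Lemma ctimesM m g h : ctimes m g -> ctimes m h -> ctimes m (fun x => g x * h x).
Proof.
elim: m g h => [|m IH] g h; first by move=> cg ch x; apply: continuousM; [exact: cg|exact: ch].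
move=> Sg Sh; have [cg Dg] := Sg; have [ch Dh] := Sh.
split; first by move=> x; apply: continuousM; [exact: cg|exact: ch].
move=> v dv; have [gv Dvg] := Dg v dv; have [hv Dvh] := Dh v dv.
split; first by move=> x; exact: (derivableM (gv x) (hv x)).
apply: (@eq_ctimes _ _ (fun x => g x * 'D_v h x + h x * 'D_v g x)).
  by move=> x; exact: (deriveM (gv x) (hv x)).
by apply: ctimesD; apply: IH => //; exact: ctimesW.
Qed.

Lemma ctimesV m g : (forall x, g x != 0) -> ctimes m g -> ctimes m (fun x => (g x)^-1).
Proof.
move=> g0; elim: m => [|m IH] Sg.
  by move=> x; apply: cvgV; [exact: g0|exact: Sg].
have [cg Dg] := Sg; split; first by move=> x; apply: cvgV; [exact: g0|exact: cg].
move=> v dv; have [gv Dvg] := Dg v dv.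
split; first by move=> x; exact: (derivableV (g0 x) (gv x)).
apply: (@eq_ctimes _ _ (fun x => -1 * ((g x)^-1 * ((g x)^-1 * 'D_v g x)))).
  by move=> x; rewrite (deriveV (g0 x) (gv x)) /GRing.scale/= -exprVn mulN1r mulNr expr2 mulrA.
apply: ctimesM; first exact: ctimes_cst.
have IV := IH (ctimesW Sg).
by do 2 apply: ctimesM => //.
Qed.

Lemma ctimes_sum m (I : Type) (r : seq I) (P : pred I) (F : I -> V -> R) :
  (forall i, P i -> ctimes m (F i)) -> ctimes m (fun x => \sum_(i <- r | P i) F i x).
Proof.
move=> SF; elim: r => [|i r IH].
  by under eq_fun do rewrite big_nil; exact: ctimes_cst.
have [Pi|Pi] := boolP (P i).
  apply: (eq_ctimes _ (ctimesD (SF _ Pi) IH)) => x.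
  by rewrite big_cons Pi.
by apply: (eq_ctimes _ IH) => x; rewrite big_cons (negbTE Pi).
Qed.

Lemma ctimes_prod m (I : Type) (r : seq I) (F : I -> V -> R) :
  (forall i, ctimes m (F i)) -> ctimes m (fun x => \prod_(i <- r) F i x).
Proof.
move=> SF; elim: r => [|i r IH].
  by under eq_fun do rewrite big_nil; exact: ctimes_cst.
under eq_fun do rewrite big_cons.
by apply: ctimesM => //; exact: SF.
Qed.

End iterated_smoothness.

Section smooth_real.
Context {R : realType}.
Implicit Types a : R -> R.

Definition smooth1 a := forall m, ctimes [set (1 : R)] m a.

Lemma smooth1_derivable a x : smooth1 a -> derivable a x 1.
Proof. by move=> /(_ 1%N) [_ /(_ 1 erefl)[+ _]]; exact. Qed.

Lemma smooth1_derive a : smooth1 a -> smooth1 (fun x => 'D_1 a x).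
Proof. by move=> sa m; have [_ /(_ 1 erefl)[_]] := sa m.+1. Qed.

Lemma smooth1_continuous a : smooth1 a -> continuous a.
Proof. by move=> /(_ 0%N). Qed.

Lemma is_derive_affine a (c d x : R) : derivable a (c * x + d) 1 ->
  is_derive x 1 (fun x => a (c * x + d)) (c * 'D_1 a (c * x + d)).
Proof.
move=> da.
have H : is_derive (c * x + d) 1 a ('D_1 a (c * x + d)) by exact: DeriveDef.
have H2 : is_derive x (1 : R) (fun x : R => c * x + d) c.
  by apply: is_derive_eq; rewrite addr0 /GRing.scale/= mulr1.
rewrite mulrC.
exact: (@is_derive1_comp _ a (fun x : R => c * x + d) x _ _ H H2).
Qed.

End smooth_real.

Section affine_functional.
Context {R : realType}.

(** Differentiability and derivative only depend on the increments along the
    direction, so slices and substitutions transfer them between spaces. *)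
Lemma eq_difference_quotient (V W : normedModType R) (g : V -> R) x v (h : W -> R) y w :
  (forall r, g (r *: v + x) - g x = h (r *: w + y) - h y) ->
  (derivable g x v <-> derivable h y w) /\ 'D_v g x = 'D_w h y.
Proof.
move=> gh; have E : (fun r => r^-1 *: ((g \o shift x) (r *: v) - g x)) =
    (fun r => r^-1 *: ((h \o shift y) (r *: w) - h y)).
  by apply/funext => r; rewrite /= gh.
by rewrite /derivable /derive E.
Qed.

Context {V : normedModType R}.
Implicit Types (l : V -> R) (a : R -> R) (x v : V).

Lemma derive_affine_functional l a x v c :
  (forall r, l (r *: v + x) = c * r + l x) -> smooth1 a ->
  derivable (fun x => a (l x)) x v /\ 'D_v (fun x => a (l x)) x = c * 'D_1 a (l x).
Proof.
move=> lE sa; have [|H1 H2] := @eq_difference_quotient V R^o (fun x => a (l x)) x v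
    (fun s => a (c * s + l x)) 0 1.
  by move=> r; rewrite lE /GRing.scale/= mulr1 addr0 mulr0 add0r.
have [Db Eb] := is_derive_affine (@smooth1_derivable R a (c * 0 + l x) sa).
by rewrite H2 Eb mulr0 add0r; split => //; exact/H1.
Qed.

(** The chain rule along a functional [l] that is affine in the directions at
    hand: this covers affine substitutions, coordinates and inner products. *)
Lemma ctimes_affine_functional (dirs : set V) m l a : continuous l ->
  (forall v, dirs v -> exists c, forall r x, l (r *: v + x) = c * r + l x) ->
  smooth1 a -> ctimes dirs m (fun x => a (l x)).
Proof.
move=> cl lE; have cal b : smooth1 b -> continuous (fun x => b (l x)).
  by move=> sb x; apply: (@continuous_comp _ _ _ l b); [exact: cl|exact: smooth1_continuous].
elim: m a => [|m IH] a sa /=; first exact: cal.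
split; first exact: cal.
move=> v /lE[c lc]; have D x := derive_affine_functional (lc ^~ x) sa.
split; first by move=> x; have [] := D x.
apply: (eq_ctimes _ (ctimesM (ctimes_cst _ m c) (IH _ (smooth1_derive sa)))) => x.
by have [_ ->] := D x.
Qed.

End affine_functional.

Lemma smooth1_affine {R : realType} (a : R -> R) (c d : R) : smooth1 a -> smooth1 (fun s => a (c * s + d)).
Proof.
move=> sa m; apply: (ctimes_affine_functional m (l := fun s : R^o => c * s + d)) sa.
  by move=> s; apply: continuousD; [exact: mulrl_continuous|exact: cvg_cst].
by move=> _ ->; exists c => r s; rewrite /GRing.scale/= mulr1 mulrDr addrA.
Qed.

Section smooth_rV.
Context {R : realType} {n : nat}.
Implicit Types (g h phi : 'rV[R]_n -> R) (x : 'rV[R]_n).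

Definition axes : set 'rV[R]_n := [set v | exists i : 'I_n, v = delta_mx 0 i].

Definition smoothR g := forall m, ctimes axes m g.

Lemma smoothR_derivable g i x : smoothR g -> derivable g x (delta_mx 0 i).
Proof.
move=> /(_ 1%N) [_ /(_ (delta_mx 0 i))]; case; first by exists i.
by move=> + _; exact.
Qed.

Lemma smoothR_partial g i : smoothR g -> smoothR (partial i g).
Proof.
move=> sg m; have [_ /(_ (delta_mx 0 i))] := sg m.+1.
by case; [exists i|].
Qed.

Lemma smoothR_continuous g : smoothR g -> continuous g.
Proof. by move=> /(_ 0%N). Qed.

Lemma partials_rcons s i g : partials (rcons s i) g = partials s (partial i g).
Proof. by rewrite /partials foldr_rcons. Qed.

(** [ctimes] differentiates in the innermost direction first, so the list of
    directions is consumed from its end. *)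
Lemma smoothP g : smooth g <-> smoothR g.
Proof.
split=> [sg m|sg].
  elim: m g sg => [|m IH] g sg /=; first by have [] := sg [::].
  split; first by have [] := sg [::].
  move=> _ [i ->]; have [_ dg] := sg [::]; split; first by move=> x; exact: dg.
  by apply: IH => s; rewrite -partials_rcons; exact: sg.
move=> s; elim/last_ind: s g sg => [|s i IH] g sg.
  split; first exact: smoothR_continuous.
  by move=> i x; exact: smoothR_derivable.
by rewrite partials_rcons; apply: IH; exact: smoothR_partial.
Qed.

Lemma coord_axis (i j : 'I_n) (r : R) x :
  (r *: delta_mx 0 j + x) 0 i = (i == j)%:R * r + x 0 i.
Proof. by rewrite !mxE eqxx/= mulrC. Qed.

Lemma smoothR_coord (a : R -> R) (i : 'I_n) : smooth1 a -> smoothR (fun x => a (x 0 i)).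
Proof.
move=> sa m; apply: (ctimes_affine_functional m (l := fun x => x 0 i)) sa.
  exact: coord_continuous.
by move=> _ [j ->]; exists (i == j)%:R => r x; exact: coord_axis.
Qed.

Lemma smoothR_tensor (a : 'I_n -> R -> R) : (forall i, smooth1 (a i)) -> smoothR (tensor a).
Proof. by move=> sa m; apply: ctimes_prod => i; exact: smoothR_coord. Qed.

Lemma smoothRM g h : smoothR g -> smoothR h -> smoothR (fun x => g x * h x).
Proof. by move=> sg sh m; exact: ctimesM. Qed.

Lemma smoothRD g h : smoothR g -> smoothR h -> smoothR (fun x => g x + h x).
Proof. by move=> sg sh m; exact: ctimesD. Qed.

Lemma smoothR_cst (c : R) : smoothR (fun=> c).
Proof. by move=> m; exact: ctimes_cst. Qed.

Lemma partialM i g h : smoothR g -> smoothR h ->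
  partial i (fun x => g x * h x) = fun x => g x * partial i h x + h x * partial i g x.
Proof.
move=> sg sh; apply/funext => x.
exact: (deriveM (@smoothR_derivable g i x sg) (@smoothR_derivable h i x sh)).
Qed.

Lemma partialD i g h : smoothR g -> smoothR h ->
  partial i (fun x => g x + h x) = fun x => partial i g x + partial i h x.
Proof.
move=> sg sh; apply/funext => x.
exact: (deriveD (@smoothR_derivable g i x sg) (@smoothR_derivable h i x sh)).
Qed.

Lemma partialZ i (c : R) g : smoothR g ->
  partial i (fun x => c * g x) = fun x => c * partial i g x.
Proof.
move=> sg; rewrite partialM//; last exact: smoothR_cst.
apply/funext => x; rewrite [X in _ + _ * X](_ : _ = 0) ?mulr0 ?addr0//.
exact: derive_cst.
Qed.

Lemma partial_coord i (a : R -> R) : smooth1 a ->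
  partial i (fun x : 'rV[R]_n => a (x 0 i)) = fun x => 'D_1 a (x 0 i).
Proof.
move=> sa; apply/funext => x; rewrite -[RHS]mul1r.
have H r : (r *: delta_mx 0 i + x) 0 i = 1 * r + x 0 i by rewrite coord_axis eqxx.
exact: (derive_affine_functional (l := fun x : 'rV[R]_n => x 0 i) H sa).2.
Qed.

Lemma box_supported_partial N i g : box_supported N g -> box_supported N (partial i g).
Proof.
move=> gN x; apply: contra_neqP => /existsNP[j xj].
have Nx : N < `|x 0 j| by rewrite ltNge; apply/negP.
rewrite /partial (@near_eq_derive _ _ _ g (cst 0)) ?derive_cst//.
have : nbhs x [set y : 'rV[R]_n | N < `|y 0 j| ].
  apply: (@open_nbhs_nbhs _ x); split => //.
  apply: (@open_comp _ _ (fun y : 'rV[R]_n => `|y 0 j|) [set r | N < r]); last exact: open_gt.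
  by move=> y _; apply: (@continuous_comp _ _ _ (fun y : 'rV[R]_n => y 0 j) (fun r : R => `|r|)); [exact: coord_continuous|exact: norm_continuous].
apply: filterS => y yj; apply/eqP; apply: contraT => /gN /(_ j).
by rewrite leNgt yj.
Qed.

End smooth_rV.

Section integration_by_parts.
Context {R : realType}.
Notation leb := (@lebesgue_measure R).
Notation mu := (@lebesgue_rV R).

Lemma derive_out (a : R -> R) N : (forall s, N < `|s| -> a s = 0) ->
  forall s, N < `|s| -> 'D_1 a s = 0.
Proof.
move=> a0 s Ns; rewrite (@near_eq_derive _ _ _ a (cst 0)) ?derive_cst//.
have : nbhs s [set y : R | N < `|y|].
  apply: (@open_nbhs_nbhs _ s); split => //.
  apply: (@open_comp _ _ (fun y : R => `|y|) [set r | N < r]); last exact: open_gt.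
  by move=> y _; exact: norm_continuous.
by apply: filterS => y /a0.
Qed.

Lemma Rintegral_derive_eq0 (G : R -> R) (N : R) :
  continuous G -> (forall s, derivable G s 1) -> continuous (fun s => 'D_1 G s) ->
  (forall s, N < `|s| -> G s = 0) -> \int[leb]_s 'D_1 G s = 0.
Proof.
move=> cG dG cG' G0; pose M := `|N| + 1.
have M0 : - M < M by rewrite -subr_gt0 opprK /M addr_gt0// ltr_wpDl.
have GM : G M = 0 /\ G (- M) = 0.
  have NM : N < `|M|.
    by rewrite ger0_norm ?addr_ge0// (le_lt_trans (ler_norm _))// ltrDl.
  by split; apply: G0; rewrite ?normrN.
rewrite /Rintegral.
rewrite (_ : (\int[leb]_s ('D_1 G s)%:E)%E = (\int[leb]_(s in `[(- M)%R, M]) ('D_1 G s)%:E)%E).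
  rewrite (@continuous_FTC2 _ _ G)//.
  - by rewrite GM.1 GM.2 subee.
  - by apply: continuous_subspaceT.
  - split; [by move=> x _; exact: dG|exact/cvg_at_right_filter/cG|exact/cvg_at_left_filter/cG].
  - by move=> x _; rewrite derive1E.
rewrite [RHS]integral_mkcond; apply: eq_integral => s _; rewrite patchE.
case: ifPn => //; rewrite notin_setE/= in_itv/= -ler_norml => /negP; rewrite -ltNge => sM.
rewrite (derive_out G0)//; apply: lt_trans sM.
by rewrite /M (le_lt_trans (ler_norm _))// ltrDl.
Qed.

Lemma continuous_rV_cons n (s : R) : continuous (fun v : 'rV[R]_n => rV_cons (s, v)).
Proof.
move=> v; apply/(cvg_ballP (FF := nbhs_filter v)) => e e0; near=> w.
have /ball_rVE[_ H] : ball v e w by near: w; exact: nbhsx_ballx.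
apply/ball_rVE; split => // i; case: (unliftP ord0 i) => [j|] ->.
  by rewrite !rV_cons_lift; exact: H.
by rewrite !rV_cons_ord0 subrr normr0.
Unshelve. all: by end_near. Qed.

Lemma continuous_rV_consl n (v : 'rV[R]_n) : continuous (fun s : R => rV_cons (s, v)).
Proof.
move=> s; apply/(cvg_ballP (FF := nbhs_filter s)) => e e0; near=> w.
have H : ball s e w by near: w; exact: nbhsx_ballx.
apply/ball_rVE; split => // i; case: (unliftP ord0 i) => [j|] ->.
  by rewrite !rV_cons_lift subrr normr0.
by rewrite !rV_cons_ord0.
Unshelve. all: by end_near. Qed.

Lemma rV_cons_shift0 n (h s : R) (v : 'rV[R]_n) :
  h *: delta_mx 0 ord0 + rV_cons (s, v) = rV_cons (h + s, v).
Proof.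
apply/rowP => i; rewrite [LHS]mxE [X in X + _]mxE [X in _ * X]mxE eqxx/=.
case: (unliftP ord0 i) => [j|] ->.
  by rewrite !rV_cons_lift/= mulr0 add0r.
by rewrite !rV_cons_ord0 eqxx mulr1.
Qed.

Lemma rV_cons_shift_lift n (h s : R) (j : 'I_n) (v : 'rV[R]_n) :
  h *: delta_mx 0 (lift ord0 j) + rV_cons (s, v) = rV_cons (s, h *: delta_mx 0 j + v).
Proof.
apply/rowP => i; rewrite [LHS]mxE [X in X + _]mxE [X in _ * X]mxE eqxx/=.
case: (unliftP ord0 i) => [k|] ->.
  by rewrite !rV_cons_lift/= !mxE eqxx/= (inj_eq lift_inj).
by rewrite !rV_cons_ord0 (negbTE (neq_lift _ _)) mulr0 add0r.
Qed.

Lemma partial_slice0 n (G : 'rV[R]_n.+1 -> R) s v :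
  (derivable G (rV_cons (s, v)) (delta_mx 0 ord0) <-> derivable (fun s => G (rV_cons (s, v))) s 1) /\
  partial ord0 G (rV_cons (s, v)) = 'D_1 (fun s => G (rV_cons (s, v))) s.
Proof.
by apply: eq_difference_quotient => r; rewrite rV_cons_shift0 /GRing.scale/= mulr1.
Qed.

Lemma partial_slice_lift n (G : 'rV[R]_n.+1 -> R) (j : 'I_n) s v :
  (derivable G (rV_cons (s, v)) (delta_mx 0 (lift ord0 j)) <->
    derivable (fun v => G (rV_cons (s, v))) v (delta_mx 0 j)) /\
  partial (lift ord0 j) G (rV_cons (s, v)) = partial j (fun v => G (rV_cons (s, v))) v.
Proof. by apply: eq_difference_quotient => r; rewrite rV_cons_shift_lift. Qed.

(** A derivative in the first coordinate is integrated in that coordinate first,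
    by the fundamental theorem of calculus; a derivative in another one is
    covered by induction on the slices. *)
Lemma Rintegral_partial_eq0 n (i : 'I_n) (G : 'rV[R]_n -> R) (N : R) :
  continuous G -> (forall x, derivable G x (delta_mx 0 i)) -> continuous (partial i G) ->
  box_supported N G -> \int[mu n]_x partial i G x = 0.
Proof.
elim: n i G => [[]//|n IH] i G cG dG cG' GN.
have CF : Cc (partial i G) by split => //; exists N; exact: box_supported_partial.
have [M FM] := Cc_bounded CF.
have FN := @box_supported_partial _ _ N i _ GN.
have mF := Cc_measurable CF.
pose a := fun s : R => M * \1_(`[- N, N]%classic) s : R.
have ia : leb.-integrable setT (EFin \o a).
  exact: (integrableZl measurableT _ (integrable_indic_itv (- N) N)).
pose b := box_ind N : 'rV[R]_n -> R.
have ib : (mu n).-integrable setT (EFin \o b) by exact: integrable_box_ind.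
have Fab s v : `|partial i G (rV_cons (s, v))| <= a s * b v.
  have [->|F0] := eqVneq (partial i G (rV_cons (s, v))) 0.
    rewrite normr0 /a !mulr_ge0//; last exact: box_ind_ge0.
    by rewrite (le_trans _ (FM 0)).
  have sN := FN _ F0.
  rewrite /a indicE mem_set/=; last first.
    by rewrite in_itv/= -ler_norml; have := sN ord0; rewrite rV_cons_ord0.
  rewrite /b box_ind1 ?mulr1//.
  by move=> j; have := sN (lift ord0 j); rewrite rV_cons_lift.
case: (unliftP ord0 i) => [j|] Ei; rewrite Ei in cG' dG CF FM FN mF Fab *.
  rewrite (Rintegral_rV1 mF ia ib Fab).
  apply: Rintegral_eq0 => s.
  transitivity (\int[mu n]_v partial j (fun v => G (rV_cons (s, v))) v).
    by apply: eq_Rintegral => v _; rewrite (partial_slice_lift G j s v).2.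
  apply: IH.
  - by move=> v; apply: continuous_comp; [exact: continuous_rV_cons|exact: cG].
  - by move=> v; apply/(partial_slice_lift G j s v).1; exact: dG.
  - rewrite (_ : partial j _ = fun v => partial (lift ord0 j) G (rV_cons (s, v))).
      by move=> v; apply: (@continuous_comp _ _ _ (fun v => rV_cons (s, v)) (partial (lift ord0 j) G)); [exact: continuous_rV_cons|exact: cG'].
    by apply/funext => v; rewrite (partial_slice_lift G j s v).2.
  - by move=> v /GN H k; have := H (lift ord0 k); rewrite rV_cons_lift.
rewrite (Rintegral_rV2 mF ia ib Fab).
apply: Rintegral_eq0 => v.
transitivity (\int[leb]_s 'D_1 (fun s => G (rV_cons (s, v))) s).
  by apply: eq_Rintegral => s _; rewrite (partial_slice0 G s v).2.
apply: (@Rintegral_derive_eq0 _ N).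
- by move=> s; apply: (@continuous_comp _ _ _ (fun s => rV_cons (s, v)) G); [exact: continuous_rV_consl|exact: cG].
- by move=> s; apply/(partial_slice0 G s v).1; exact: dG.
- rewrite (_ : (fun s => _) = fun s => partial ord0 G (rV_cons (s, v))).
    by move=> s; apply: (@continuous_comp _ _ _ (fun s => rV_cons (s, v)) (partial ord0 G)); [exact: continuous_rV_consl|exact: cG'].
  by apply/funext => s; rewrite (partial_slice0 G s v).2.
- move=> s Ns; apply/eqP; apply: contraT => /GN /(_ ord0).
  by rewrite rV_cons_ord0 leNgt Ns.
Qed.

End integration_by_parts.

(** * Test functions, their transforms and their derivatives *)

Section smooth_trig.
Context {R : realType}.

Lemma smooth1_trig m : ctimes [set (1 : R)] m (@sin R) /\ ctimes [set (1 : R)] m (@cos R).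
Proof.
elim: m => [|m [IHs IHc]] /=; first by split; [exact: continuous_sin|exact: continuous_cos].
split.
  split; first exact: continuous_sin.
  move=> v ->; split; first by move=> x; exact: ex_derive.
  by apply: (eq_ctimes _ IHc) => x; rewrite derive_val.
split; first exact: continuous_cos.
move=> v ->; split; first by move=> x; exact: ex_derive.
apply: (eq_ctimes _ (ctimesM (ctimes_cst _ m (-1)) IHs)) => x.
by rewrite derive_val mulN1r.
Qed.

Lemma smooth1_sin : smooth1 (@sin R). Proof. by move=> m; have [] := smooth1_trig m. Qed.
Lemma smooth1_cos : smooth1 (@cos R). Proof. by move=> m; have [] := smooth1_trig m. Qed.

Context {n : nat}.
Implicit Types (x y : 'rV[R]_n).

Lemma dot_axis (j : 'I_n) (r : R) x y : dot (r *: delta_mx 0 j + x) y = y 0 j * r + dot x y.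
Proof.
rewrite dotDl; congr (_ + _); rewrite /dot (bigD1 j)//= big1 ?addr0.
  by rewrite !mxE !eqxx/= mulr1 mulrC.
by move=> i /negbTE ij; rewrite !mxE ij andbF mulr0 mul0r.
Qed.

Lemma continuous_dotl y : continuous (fun x => dot x y).
Proof.
have : ctimes axes 0 (fun x => dot x y).
  apply: ctimes_sum => i _; apply: (@ctimesM _ _ _ _ (fun x => x 0 i) (fun=> y 0 i)); last exact: ctimes_cst.
  exact: coord_continuous.
exact.
Qed.

Lemma smoothR_dot (a : R -> R) y : smooth1 a -> smoothR (fun x => a (dot x y)).
Proof.
move=> sa m; apply: (ctimes_affine_functional m (l := fun x => dot x y)) sa.
  exact: continuous_dotl.
by move=> _ [j ->]; exists (y 0 j) => r x; exact: dot_axis.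
Qed.

Lemma partial_dot (a : R -> R) j y : smooth1 a ->
  partial j (fun x => a (dot x y)) = fun x => y 0 j * 'D_1 a (dot x y).
Proof.
move=> sa; apply/funext => x; have H := fun r => dot_axis j r x y.
exact: (derive_affine_functional (l := fun x => dot x y) H sa).2.
Qed.

End smooth_trig.

Section test_functions.
Context {R : realType} {n : nat}.
Notation mu := (@lebesgue_rV R n).
Implicit Types (phi psi g h : 'rV[R]_n -> R) (x : 'rV[R]_n).

Definition testR phi := smoothR phi /\ exists N, box_supported N phi.

Lemma testR_smooth phi : testR phi -> smoothR phi. Proof. by case. Qed.

Lemma testR_Cc phi : testR phi -> Cc phi.
Proof. by move=> [sp bp]; split => //; exact: smoothR_continuous. Qed.

Lemma testR_integrable phi : testR phi -> mu.-integrable setT (EFin \o phi).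
Proof. by move=> /testR_Cc/Cc_integrable. Qed.

Lemma testR_partial i phi : testR phi -> testR (partial i phi).
Proof.
move=> [sp [N bp]]; split; first exact: smoothR_partial.
by exists N; exact: box_supported_partial.
Qed.

Lemma testRM phi g : testR phi -> smoothR g -> testR (fun x => phi x * g x).
Proof.
move=> [sp [N bp]] sg; split; first exact: smoothRM.
by exists N => x; rewrite mulf_eq0 negb_or => /andP[/bp].
Qed.

Lemma testRD phi psi : testR phi -> testR psi -> testR (fun x => phi x + psi x).
Proof.
move=> [sp [N bp]] [sq [M bq]]; split; first exact: smoothRD.
exists (Num.max N M) => x; have [px|px] := eqVneq (phi x) 0.
  by rewrite px add0r => /bq + i => /(_ i) /le_trans; apply; rewrite le_max lexx orbT.
by move=> _ i; rewrite (le_trans (bp _ px i))// le_max lexx.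
Qed.

Lemma testRZ (c : R) phi : testR phi -> testR (fun x => c * phi x).
Proof.
move=> tp; have := testRM tp (smoothR_cst c).
by congr testR; apply/funext => x; rewrite mulrC.
Qed.

Lemma testR0 : testR (fun=> 0).
Proof. by split; [exact: smoothR_cst|exists 0 => x; rewrite eqxx]. Qed.

Lemma testR_sum (I : Type) (r : seq I) (P : pred I) (F : I -> 'rV[R]_n -> R) :
  (forall i, P i -> testR (F i)) -> testR (fun x => \sum_(i <- r | P i) F i x).
Proof. by rewrite -fct_sumE => tF; apply: big_ind => //; [exact: testR0|exact: testRD]. Qed.

Lemma Rintegral_by_parts i phi g : testR phi -> smoothR g ->
  \int[mu]_t (partial i phi t * g t) = - \int[mu]_t (phi t * partial i g t).
Proof.
move=> tp sg; have tpg := testRM tp sg; have [spg [N bpg]] := tpg.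
have i1 : mu.-integrable setT (EFin \o (fun t => partial i phi t * g t)).
  by apply: testR_integrable; apply: testRM => //; exact: testR_partial.
have i2 : mu.-integrable setT (EFin \o (fun t => phi t * partial i g t)).
  by apply: testR_integrable; apply: testRM => //; exact: smoothR_partial.
apply/eqP; rewrite -subr_eq0 opprK -RintegralD//.
rewrite -(@Rintegral_partial_eq0 _ _ i _ N (smoothR_continuous spg) _ _ bpg).
- apply/eqP; apply: eq_Rintegral => t _.
  by rewrite (partialM i (testR_smooth tp) sg) addrC mulrC (mulrC (g t)) (mulrC (partial i phi t)).
- by move=> x; exact: smoothR_derivable.
- by apply: smoothR_continuous; exact: smoothR_partial.
Qed.

(** Integration by parts turns a derivative into multiplication by a coordinate
    and exchanges the cosine and sine transforms. *)
Lemma cosT_partial i phi x : testR phi -> cosT (partial i phi) x = x 0 i * sinT phi x.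
Proof.
move=> tp; rewrite /cosT (Rintegral_by_parts i tp (smoothR_dot x smooth1_cos)).
rewrite -mulN1r /sinT -!RintegralZl//; last 2 first.
- apply: testR_integrable; apply: testRM => //; apply: smoothR_partial; apply: smoothR_dot; exact: smooth1_cos.
- by apply: integrable_mul_sin; exact: testR_integrable.
apply: eq_Rintegral => t _; rewrite (partial_dot i x smooth1_cos) derive_val; ring.
Qed.

Lemma sinT_partial i phi x : testR phi -> sinT (partial i phi) x = - (x 0 i * cosT phi x).
Proof.
move=> tp; rewrite /sinT (Rintegral_by_parts i tp (smoothR_dot x smooth1_sin)).
congr (- _); rewrite /cosT -!RintegralZl//; last first.
  by apply: integrable_mul_cos; exact: testR_integrable.
apply: eq_Rintegral => t _; rewrite (partial_dot i x smooth1_sin) derive_val; ring.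
Qed.

(** The operator [\prod_(i <- s) (1 + e * d_i)]. On the Fourier side it
    multiplies the modulus by [\prod_(i <- s) sqrt (1 + (e * x_i) ^+ 2)], so one
    bound on it yields all the decay at frequencies above [1 / e] that the
    estimates need. *)
Fixpoint dop (e : R) (s : seq 'I_n) phi : 'rV[R]_n -> R :=
  if s is i :: s' then dop e s' (fun x => phi x + e * partial i phi x) else phi.

Lemma testR_dop1 e i phi : testR phi -> testR (fun x => phi x + e * partial i phi x).
Proof. by move=> tp; apply: testRD => //; apply: testRZ; exact: testR_partial. Qed.

Lemma testR_dop e s phi : testR phi -> testR (dop e s phi).
Proof. by elim: s phi => //= i s IH phi tp; apply: IH; exact: testR_dop1. Qed.

Lemma energy_dop e s phi x : testR phi ->
  cosT (dop e s phi) x ^+ 2 + sinT (dop e s phi) x ^+ 2 =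
  (\prod_(i <- s) oneDsqr (e * x 0 i)) * (cosT phi x ^+ 2 + sinT phi x ^+ 2).
Proof.
elim: s phi => [|i s IH] phi tp /=; first by rewrite big_nil mul1r.
rewrite IH; last exact: testR_dop1.
have ip := testR_integrable tp; have ipp := testR_integrable (testR_partial i tp).
have iep := testR_integrable (testRZ e (testR_partial i tp)).
rewrite cosTD// sinTD// cosTZ// sinTZ// cosT_partial// sinT_partial//.
rewrite big_cons /oneDsqr; ring.
Qed.

Lemma weighted_plancherel e phi : testR phi ->
  (\int[mu]_x (tensor (fun _ s => oneDsqr (e * s)) x * (cosT phi x ^+ 2 + sinT phi x ^+ 2))%:E <=
   ((2 * pi) ^+ n * \int[mu]_t (dop e (index_enum 'I_n) phi t ^+ 2))%:E)%E.
Proof.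
move=> tp; have := plancherel_le (testR_Cc (testR_dop e (index_enum 'I_n) tp)).
by under eq_integral => x _ do rewrite energy_dop//.
Qed.

Lemma dopD e s g h : smoothR g -> smoothR h ->
  dop e s (fun x => g x + h x) = fun x => dop e s g x + dop e s h x.
Proof.
have sm1 k i : smoothR k -> smoothR (fun x => k x + e * partial i k x).
  move=> sk; apply: smoothRD => //; apply: smoothRM; first exact: smoothR_cst.
  exact: smoothR_partial.
elim: s g h => //= i s IH g h sg sh.
rewrite -IH; [|exact: sm1|exact: sm1].
by congr (dop e s _); apply/funext => x; rewrite (partialD i sg sh); ring.
Qed.

Fixpoint partials_le (m : nat) (M : R) g : Prop :=
  (forall x, `|g x| <= M) /\
  if m is k.+1 then forall i, partials_le k M (partial i g) else True.

Lemma partials_leW m M M' g : M <= M' -> partials_le m M g -> partials_le m M' g.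
Proof.
move=> MM; elim: m g => [|m IH] g /= [gM gi]; split => //; try by move=> x; rewrite (le_trans (gM x)).
by move=> i; apply: IH.
Qed.

Lemma partials_leS m M g : partials_le m.+1 M g -> partials_le m M g.
Proof.
elim: m g => [|m IH] g /=; first by case.
by move=> [gM gi]; split => // i; apply: IH; exact: gi.
Qed.

Lemma partials_leD m M M' g h : smoothR g -> smoothR h -> partials_le m M g -> partials_le m M' h ->
  partials_le m (M + M') (fun x => g x + h x).
Proof.
elim: m g h => [|m IH] g h sg sh /= [gM gi] [hM hi]; split => //.
- by move=> x; rewrite (le_trans (ler_normD _ _))// lerD.
- by move=> x; rewrite (le_trans (ler_normD _ _))// lerD.
move=> i; rewrite (partialD i sg sh); apply: IH => //; exact: smoothR_partial.
Qed.

Lemma partials_leZ m M (c : R) g : 0 <= c <= 1 -> smoothR g -> partials_le m M g ->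
  partials_le m M (fun x => c * g x).
Proof.
move=> /andP[c0 c1]; elim: m g => [|m IH] g sg /= [gM gi]; split => //.
- by move=> x; rewrite normrM (ger0_norm c0) (le_trans _ (gM x))// ler_piMl.
- by move=> x; rewrite normrM (ger0_norm c0) (le_trans _ (gM x))// ler_piMl.
by move=> i; rewrite (partialZ i c sg); apply: IH => //; exact: smoothR_partial.
Qed.

Lemma testR_partials_le m phi : testR phi -> exists M, partials_le m M phi.
Proof.
elim: m phi => [|m IH] phi tp; have [M0 pM0] := Cc_bounded (testR_Cc tp).
  by exists M0.
have /choice[Mi pMi] : forall i, exists M, partials_le m M (partial i phi).
  by move=> i; apply: IH; exact: testR_partial.
exists (M0 + \sum_i `|Mi i|); split.
  by move=> x; rewrite (le_trans (pM0 x))// lerDl sumr_ge0.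
move=> i; apply: partials_leW (pMi i); rewrite (le_trans (ler_norm _))//.
rewrite (bigD1 i)//= addrCA lerDl addr_ge0 ?sumr_ge0//.
exact: le_trans (normr_ge0 _) (pM0 0).
Qed.

Definition upd (a : 'I_n -> R -> R) (i : 'I_n) (b : R -> R) : 'I_n -> R -> R :=
  fun j => if j == i then b else a j.

Lemma tensor_upd a i b x : tensor (upd a i b) x = b (x 0 i) * tensor (upd a i (fun=> 1)) x.
Proof.
rewrite /tensor (bigD1 i)//= [in RHS](bigD1 i)//= /upd !eqxx mul1r; congr (_ * _).
by apply: eq_bigr => j /negbTE ->.
Qed.

Lemma upd_id a i : upd a i (a i) = a.
Proof. by apply/funext => j; rewrite /upd; case: eqP => [->|]. Qed.

Lemma partial_tensor a i : (forall j, smooth1 (a j)) ->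
  partial i (tensor a) = tensor (upd a i (fun u => 'D_1 (a i) u)).
Proof.
move=> sa; have s1 : smoothR (tensor (upd a i (fun=> 1))).
  apply: smoothR_tensor => j; rewrite /upd; case: ifP => // _ m; exact: ctimes_cst.
rewrite -{1}(upd_id a i) (_ : tensor (upd a i (a i)) =
    fun x => a i (x 0 i) * tensor (upd a i (fun=> 1)) x); last first.
  by apply/funext => x; rewrite tensor_upd.
rewrite partialM//; last exact: smoothR_coord.
rewrite partial_coord//; apply/funext => x.
rewrite [RHS]tensor_upd [X in _ * X + _](_ : _ = 0) ?mulr0 ?add0r 1?mulrC//.
rewrite -(derive_cst (0 : R) (0 : R) (1 : R)); apply: (eq_difference_quotient _).2 => r.
rewrite /cst subrr; apply/eqP; rewrite subr_eq0; apply/eqP/eq_bigr => j _.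
by rewrite /upd; case: eqVneq => // /negbTE ji; rewrite coord_axis ji mul0r add0r.
Qed.

(** The product rule, one coordinate at a time: as every coordinate occurs once
    in [s], a factor [a i] is differentiated at most once. The derivatives of
    [a i] may be of size [1 / e], which the factor [e] in the operator
    compensates. *)
Lemma dop_tensor_bound e s psi (a b : 'I_n -> R -> R) M x : 0 <= e <= 1 -> uniq s ->
  smoothR psi -> partials_le (size s) M psi ->
  (forall j, smooth1 (a j)) -> (forall j u, `|a j u| <= b j u) ->
  (forall j u, j \in s -> `|e * 'D_1 (a j) u| <= b j u) ->
  `|dop e s (fun x => psi x * tensor a x) x| <= 3 ^+ size s * M * tensor b x.
Proof.
move=> e01; elim: s psi a M => [|i s IH] psi a M /=.
  move=> _ _ [pM _] sa ab _; rewrite mul1r normrM ler_pM// normr_prod.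
  by apply: ler_prod => j _; rewrite normr_ge0/= ab.
move=> /andP[ins us] sp pM sa ab ab'; have [pM0 pMi] := pM.
have st : smoothR (tensor a) by exact: smoothR_tensor.
have spp : smoothR (partial i psi) by exact: smoothR_partial.
have sep : smoothR (fun x => e * partial i psi x) by apply: smoothRM => //; exact: smoothR_cst.
pose a' := upd a i (fun u => e * 'D_1 (a i) u).
have sa' j : smooth1 (a' j).
  rewrite /a' /upd; case: eqP => // _ m; apply: ctimesM; first exact: ctimes_cst.
  exact: smooth1_derive.
have E : (fun x => psi x * tensor a x + e * partial i (fun x => psi x * tensor a x) x) =
    fun x => (psi x + e * partial i psi x) * tensor a x + psi x * tensor a' x.
  apply/funext => y; rewrite (partialM i sp st) partial_tensor// /a'.
  rewrite (tensor_upd _ _ (fun u => e * _)) (tensor_upd _ _ (fun u => 'D_1 _ u)); ring.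
rewrite E dopD; last 2 first.
- by apply: smoothRM => //; exact: smoothRD.
- by apply: smoothRM => //; exact: smoothR_tensor.
rewrite (le_trans (ler_normD _ _))//.
have M0 : 0 <= M by exact: le_trans (normr_ge0 _) (pM0 0).
have H1 : `|dop e s (fun x => (psi x + e * partial i psi x) * tensor a x) x| <=
    3 ^+ size s * (M + M) * tensor b x.
  apply: IH => //; first exact: smoothRD.
    apply: partials_leD => //; first exact: partials_leS.
    by apply: partials_leZ => //; exact: pMi.
  by move=> j u js; apply: ab'; rewrite inE js orbT.
have H2 : `|dop e s (fun x => psi x * tensor a' x) x| <= 3 ^+ size s * M * tensor b x.
  apply: IH => //; first exact: partials_leS.
    by move=> j u; rewrite /a' /upd; case: eqP => [->|_]; [apply: ab'; rewrite inE eqxx|exact: ab].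
  move=> j u js; rewrite /a' /upd; case: eqP => [ji|_]; first by rewrite -ji js in ins.
  by apply: ab'; rewrite inE js orbT.
apply: (le_trans (lerD H1 H2)); rewrite le_eqVlt; apply/orP; left; apply/eqP.
rewrite exprS; ring.
Qed.

End test_functions.

(** * A smooth partition of unity on the line *)

Section bump.
Context {R : realType}.
Implicit Types x h : R.

(** The family [x^-k * exp (- 1 / x)], extended by zero to the left of the
    origin, is closed under derivation up to linear combination. *)
Definition flat (k : nat) (x : R) : R :=
  if 0 < x then x^-1 ^+ k * expR (- x^-1) else 0.

Lemma flat_ge0 k x : 0 <= flat k x.
Proof.
rewrite /flat; case: ifPn => // x0; apply: mulr_ge0; last exact: expR_ge0.
by rewrite exprn_ge0// invr_ge0 ltW.
Qed.

Lemma flat_le k x : flat k x <= (k.+1)`!%:R * `|x|.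
Proof.
rewrite /flat; case: ifPn => [x0|_]; last by rewrite mulr_ge0.
rewrite gtr0_norm// expRN ler_pdivrMr ?expR_gt0//.
have F0 : (0 : R) < (k.+1)`!%:R by rewrite ltr0n fact_gt0.
have H : x^-1 ^+ k.+1 / (k.+1)`!%:R <= expR x^-1.
  apply: le_trans (expR_ge1Dxn k _); last by rewrite invr_ge0 ltW.
  by rewrite lerDr.
rewrite ler_pdivrMr// in H.
rewrite (_ : x^-1 ^+ k = x * x^-1 ^+ k.+1); last first.
  by rewrite exprS mulrA mulfV ?mul1r// gt_eqF.
rewrite [leRHS](_ : _ = x * (expR x^-1 * (k.+1)`!%:R)); last by ring.
by rewrite ler_wpM2l// ltW.
Qed.

Lemma cvg_flat0 k : flat k h @[h --> (0 : R)] --> (0 : R).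
Proof.
have F0 : (0 : R) < (k.+1)`!%:R by rewrite ltr0n fact_gt0.
apply/cvgrPdist_le => e e0; near=> h.
rewrite sub0r normrN ger0_norm ?flat_ge0// (le_trans (flat_le _ _))//.
rewrite mulrC -ler_pdivlMr//.
near: h; apply/nbhs_ballP; exists (e / (k.+1)`!%:R); first by rewrite /= divr_gt0.
by move=> h; rewrite /ball/= sub0r normrN => /ltW.
Unshelve. all: by end_near. Qed.

(** At the origin the difference quotient of [flat k] is [flat k.+1] itself, which
    tends to 0; elsewhere the formula is the product rule. *)
Lemma is_derive_flat k x :
  is_derive x 1 (flat k) (flat k.+2 x - k%:R * flat k.+1 x).
Proof.
have [x0|x0|->] := ltgtP x 0.
- have E : \forall y \near x, flat k y = cst 0 y.
    near=> y; rewrite /flat ifN//= -leNgt ltW//; near: y; exact: lt_nbhsl.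
  rewrite (_ : _ - _ = 0); last by rewrite /flat !ifN ?mulr0 ?subr0 -?leNgt ?(ltW x0).
  apply: DeriveDef.
    apply: (@near_eq_derivable _ _ _ (cst 0)); last exact: derivable_cst.
    by apply: filterS E => y /= ->.
  by rewrite (near_eq_derive _ E) derive_cst.
- pose F (y : R) := y^-1 ^+ k * expR (- y^-1).
  have E : \forall y \near x, flat k y = F y.
    near=> y; rewrite /flat ifT//; near: y; exact: lt_nbhsr.
  have xn0 : x != 0 by rewrite gt_eqF.
  have dV : is_derive x (1:R) (fun y : R => y^-1) (- (x^-1 ^+ 2)).
    apply: is_derive_eq; first exact: is_deriveV.
    by rewrite /GRing.scale/= mulr1 -exprVn.
  have dN : is_derive x (1:R) (fun y : R => - y^-1) (x^-1 ^+ 2).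
    by rewrite -[x^-1 ^+ 2]opprK; exact: is_deriveN dV.
  have dE : is_derive x (1:R) (fun y : R => expR (- y^-1)) (expR (- x^-1) * x^-1 ^+ 2).
    exact: (@is_derive1_comp _ expR (fun y : R => - y^-1) x _ _ (is_derive_expR _) dN).
  have dX := @is_deriveX _ _ (fun y : R => y^-1) k x 1 _ dV.
  have dF : is_derive x 1 F (flat k.+2 x - k%:R * flat k.+1 x).
    rewrite exprfctE in dX; apply: (is_derive_eq (is_deriveM dX dE)).
    rewrite /flat !x0 /GRing.scale/=; case: k {E F dX} => [|k] /=; rewrite ?mulr0n !exprS; ring.
  have [dF1 dF2] := dF.
  apply: DeriveDef; last by rewrite (near_eq_derive _ E).
  apply: (near_eq_derivable _ dF1).
  by apply: filterS E => y /= ->.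
- have E : (fun h : R => h^-1 *: ((flat k \o shift 0) (h *: (1:R)) - flat k 0)) = flat k.+1.
    apply/funext => h; rewrite /= addr0 /GRing.scale/= mulr1 /flat ltxx subr0.
    by case: ifP => h0; rewrite ?mulr0// exprS mulrA.
  have C : (flat k.+1 h @[h --> (0:R)^']) --> (0 : R).
    by apply: cvg_trans (@cvg_flat0 k.+1); apply: cvg_app; exact: nbhs_dnbhs.
  rewrite {2 3}/flat ltxx mulr0 subr0.
  apply: DeriveDef; first by rewrite /derivable E; apply/cvg_ex; exists 0.
  by rewrite /derive E; apply: cvg_lim.
Unshelve. all: by end_near. Qed.

Lemma continuous_flat k : continuous (flat k).
Proof.
move=> x; apply: differentiable_continuous; apply/derivable1_diffP.
by have [] := is_derive_flat k x.
Qed.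

Lemma smooth1_flat k : smooth1 (flat k).
Proof.
move=> m; elim: m k => [|m IH] k /=; first exact: continuous_flat.
split; first exact: continuous_flat.
move=> v ->; split; first by move=> x; have [] := is_derive_flat k x.
apply: (eq_ctimes _ (ctimesD (IH k.+2) (ctimesM (ctimes_cst _ m (- k%:R)) (IH k.+1)))) => x.
by have [_ ->] := is_derive_flat k x; rewrite mulNr.
Qed.

Let den x := flat 0 x + flat 0 (-1 * x + 1).

Let den_gt0 x : 0 < den x.
Proof.
have [x0|x0] := ltP 0 x.
  by rewrite /den ltr_wpDr ?flat_ge0// /flat x0 mul1r expR_gt0.
rewrite /den ltr_wpDl ?flat_ge0// /flat mulN1r ifT ?mul1r ?expR_gt0//.
by rewrite addrC subr_gt0 (le_lt_trans x0).
Qed.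

Definition step x : R := flat 0 x * (flat 0 x + flat 0 (-1 * x + 1))^-1.

Lemma smooth1_step : smooth1 step.
Proof.
move=> m; apply: ctimesM; first exact: smooth1_flat.
apply: ctimesV; first by move=> x; rewrite gt_eqF// den_gt0.
apply: ctimesD; first exact: smooth1_flat.
exact: (smooth1_affine (-1) 1 (smooth1_flat 0)).
Qed.

Lemma step0 x : x <= 0 -> step x = 0.
Proof. by move=> x0; rewrite /step {1}/flat ifN ?mul0r// -leNgt. Qed.

Lemma step1 x : 1 <= x -> step x = 1.
Proof.
move=> x1; have H := den_gt0 x; move: H; rewrite /step /den.
have -> : flat 0 (-1 * x + 1) = 0.
  by rewrite /flat ifN// -leNgt mulN1r addrC subr_le0.
by rewrite addr0 => H; rewrite mulfV// gt_eqF.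
Qed.

Lemma stepC x : step (1 - x) = 1 - step x.
Proof.
have H := den_gt0 x; have {H} : den x != 0 by rewrite gt_eqF.
rewrite /step /den.
have -> : -1 * (1 - x) + 1 = x by ring.
have -> : -1 * x + 1 = 1 - x by ring.
move: (flat 0 x) (flat 0 (1 - x)) => a b H.
by rewrite (addrC b); field.
Qed.

Lemma step_ge0 x : 0 <= step x.
Proof. by rewrite /step mulr_ge0 ?flat_ge0// invr_ge0 ltW// den_gt0. Qed.

Lemma step_le1 x : step x <= 1.
Proof. by rewrite -subr_ge0 -stepC step_ge0. Qed.

(** As a difference of two consecutive translates of [step], the bump has
    integer translates that telescope to the constant 1. *)
Definition bump x : R := step (1 * x + 1) - step x.

Lemma smooth1_bump : smooth1 bump.
Proof.
move=> m; have H := ctimesD (smooth1_affine 1 1 smooth1_step m)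
  (ctimesM (ctimes_cst _ m (-1)) (smooth1_step m)).
by apply: (eq_ctimes _ H) => x; rewrite /bump mulN1r.
Qed.

Lemma bump_out x : 1 <= `|x| -> bump x = 0.
Proof.
rewrite /bump mul1r ler_normr => /orP[x1|x1].
  by rewrite !step1 ?subrr// lerDr (le_trans _ x1).
by rewrite !step0 ?subrr//; lra.
Qed.

Lemma bump_even x : bump (- x) = bump x.
Proof.
have := stepC (- x); rewrite opprK => E.
by rewrite /bump !mul1r (addrC (- x)) (addrC x) stepC E; ring.
Qed.

Lemma bump0 : bump 0 = 1.
Proof. by rewrite /bump mul1r add0r step1// step0// subr0. Qed.

Lemma bump_norm_le1 x : `|bump x| <= 1.
Proof.
have := step_ge0 (1 * x + 1); have := step_ge0 x.
have := step_le1 (1 * x + 1); have := step_le1 x.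
by rewrite /bump ler_norml; lra.
Qed.

Lemma sum_bump (M : nat) x : `|x| <= M%:R ->
  \sum_(j < M.*2.+1) bump (x - (j%:R - M%:R)) = 1.
Proof.
move=> xM; rewrite -(big_mkord xpredT (fun j => bump (x - (j%:R - M%:R)))).
transitivity (\sum_(0 <= j < M.*2.+1) (- step (x + M%:R + 1 - j.+1%:R) - - step (x + M%:R + 1 - j%:R))).
  apply: eq_bigr => j _; rewrite /bump opprK [RHS]addrC -natr1; congr (step _ - step _); ring.
rewrite telescope_sumr// opprK subr0 -muln2.
move: xM; rewrite ler_norml => /andP[x1 x2].
rewrite (@step1 (x + M%:R + 1)); last by lra.
rewrite step0 ?oppr0 ?add0r//.
by rewrite -natr1 natrM; lra.
Qed.

Lemma continuous_vanishing_bounded (a : R -> R) : continuous a ->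
  (forall x, 1 < `|x| -> a x = 0) -> exists B, forall x, `|a x| <= B.
Proof.
move=> ca a0.
have /compact_bounded[M [_ MA]] : compact (a @` `[-1, 1]%classic).
  apply: continuous_compact; first by apply: continuous_subspaceT; exact: ca.
  exact: segment_compact.
exists (`|M| + 1) => x; have [x1|x1] := ltP 1 `|x|; first by rewrite a0// normr0 addr_ge0.
have MM : M < `|M| + 1 by rewrite (le_lt_trans (ler_norm _))// ltrDl.
apply: (MA _ MM (a x)).
by exists x => //; rewrite /= in_itv/= -ler_norml.
Qed.

Lemma derive_bump_out x : 1 < `|x| -> 'D_1 bump x = 0.
Proof. by apply: derive_out => s /ltW; exact: bump_out. Qed.

Lemma derive_bump_bounded : exists B, forall x, `|'D_1 bump x| <= B.
Proof.
apply: continuous_vanishing_bounded derive_bump_out.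
exact: smooth1_continuous (smooth1_derive smooth1_bump).
Qed.

End bump.

(** * The pointwise inequality behind the exponent *)

Section pointwise.
Context {R : realType}.
Implicit Types y z p alpha d e l k c H w : R.

Lemma powR_le1 e q : 0 <= e <= 1 -> 0 <= q -> e `^ q <= 1.
Proof.
move=> /andP[e0 e1] q0; apply: (@le_trans _ _ (1 `^ q)); last by rewrite powR1.
by rewrite ge0_ler_powR ?nnegrE.
Qed.

(** This is where [p <= 2 * d / alpha] enters: either [y ^+ 2] is below the
    threshold [k * e `^ alpha] and the second term wins, or the excess
    [y `^ (p - 2)] over the threshold pays for the missing power of [e]. *)
Lemma square_le_power p alpha d e k w y :
  1 <= p -> 0 <= alpha <= d -> p * alpha <= 2 * d -> 0 < e <= 1 -> 0 < k <= 1 ->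
  1 <= w -> 0 <= y <= 1 ->
  e `^ (d - alpha) * y ^+ 2 / w <= k `^ (- (p / 2)) * y `^ p + k * (e `^ d / w).
Proof.
move=> p1 /andP[a0 ad] pa /andP[e0 e1] /andP[k0 k1] w1 /andP[y0 y1].
have w0 : 0 < w by exact: lt_le_trans w1.
have p2 : 0 <= p / 2 by rewrite divr_ge0// (le_trans _ p1).
have K1 : 1 <= k `^ (- (p / 2)).
  by rewrite powRN invr_ge1 ?powR_le1 ?unitfE ?gt_eqF ?powR_gt0// (ltW k0).
pose t := k * e `^ alpha.
have t0 : 0 < t by rewrite mulr_gt0// powR_gt0.
have eda : e `^ (d - alpha) * e `^ alpha = e `^ d.
  by rewrite -powRD ?subrK// (gt_eqF e0) implybT.
have [yt|ty] := leP (y ^+ 2) t.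
  rewrite -[leLHS]add0r lerD//; first by rewrite mulr_ge0 ?powR_ge0.
  rewrite [leRHS]mulrA ler_wpM2r ?invr_ge0 ?(ltW w0)// -eda.
  by rewrite [leRHS]mulrCA ler_wpM2l ?powR_ge0.
rewrite -[leLHS]addr0 lerD//; last first.
  by rewrite mulr_ge0 ?(ltW k0)// divr_ge0 ?powR_ge0 ?(ltW w0).
have yn0 : y != 0.
  by apply/eqP => yE; move: ty; rewrite yE expr0n/= ltNge (ltW t0).
have yp : y `^ p = y ^+ 2 * y `^ (p - 2).
  have -> : y `^ p = y `^ (2 + (p - 2)) by congr (_ `^ _); lra.
  rewrite (@powRD _ y 2) ?yn0 ?implybT//; congr (_ * _).
  exact: (@powR_mulrn _ y 2 y0).
apply: (@le_trans _ _ (e `^ (d - alpha) * y ^+ 2)).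
  by rewrite ler_pdivrMr// ler_peMr// mulr_ge0 ?powR_ge0// sqr_ge0.
have [p_le2|p_gt2] := leP p 2.
  apply: (@le_trans _ _ (y ^+ 2)).
    by rewrite ler_piMl ?sqr_ge0// powR_le1 ?subr_ge0// (ltW e0).
  apply: (@le_trans _ _ (y `^ p)); last by rewrite ler_peMl// powR_ge0.
  rewrite yp ler_peMr ?sqr_ge0// -[p - 2]opprB powRN invr_ge1 ?powR_le1 ?subr_ge0 ?y0//.
  - by rewrite unitfE gt_eqF// powR_gt0// lt_neqAle eq_sym yn0.
  - by rewrite powR_gt0// lt_neqAle eq_sym yn0.
have r0 : 0 <= (p - 2) / 2 by rewrite divr_ge0// subr_ge0 ltW.
have tr : t `^ ((p - 2) / 2) <= y `^ (p - 2).
  have -> : y `^ (p - 2) = (y ^+ 2) `^ ((p - 2) / 2).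
    rewrite -(@powR_mulrn _ y 2 y0) -powRrM; congr (_ `^ _).
    by rewrite mulrCA mulfV ?mulr1// pnatr_eq0.
  by rewrite ge0_ler_powR ?nnegrE ?sqr_ge0 ?(ltW t0) ?(ltW ty).
have H1 : e `^ (d - alpha) <= k `^ (- (p / 2)) * y `^ (p - 2).
  apply: (@le_trans _ _ (k `^ (- (p / 2)) * t `^ ((p - 2) / 2))); last by rewrite ler_wpM2l ?powR_ge0.
  rewrite /t powRM ?powR_ge0 ?(ltW k0)// mulrA -powRD ?(gt_eqF k0) ?implybT// -powRrM.
  have -> : - (p / 2) + (p - 2) / 2 = -1 by field.
  apply: (@le_trans _ _ (e `^ (alpha * ((p - 2) / 2)))).
    rewrite ger_powR// ?e0//; lra.
  by rewrite ler_peMl ?powR_ge0// powRN powRr1 ?(ltW k0)// invr_ge1 ?unitfE ?gt_eqF.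
rewrite yp [leRHS](_ : _ = k `^ (- (p / 2)) * y `^ (p - 2) * y ^+ 2); last by ring.
by rewrite ler_wpM2r ?sqr_ge0.
Qed.

(** To be integrated with [y = |f|] and [z] the modulus of the transform of a test
    function: large values of [y] use the bound [H] on [z], small ones the
    inequality between arithmetic and geometric means with weight [w]. *)
Lemma product_bound p alpha d e l k c w H y z :
  1 <= p -> 0 <= alpha <= d -> p * alpha <= 2 * d -> 0 < e <= 1 -> 0 < l <= 1 ->
  0 < k <= 1 -> 0 < c -> 1 <= w -> 0 <= y -> 0 <= z <= H ->
  y * z <= H * l `^ (1 - p) * y `^ p +
    c^-1 * (k `^ (- (p / 2)) * ((y < l)%R%:R * y `^ p) + k * (e `^ d / w)) +
    c * e `^ (- (d - alpha)) * (z ^+ 2 * w).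
Proof.
move=> p1 ad pa e01 l01 k01 c0 w1 y0 /andP[z0 zH].
have /andP[l0 l1] := l01; have /andP[k0 k1] := k01; have /andP[e0 e1] := e01.
have w0 : 0 < w by exact: lt_le_trans w1.
have H0 : 0 <= H by exact: le_trans zH.
have T1 : 0 <= H * l `^ (1 - p) * y `^ p by rewrite !mulr_ge0 ?powR_ge0.
have T3 : 0 <= c * e `^ (- (d - alpha)) * (z ^+ 2 * w).
  by rewrite !mulr_ge0 ?powR_ge0 ?sqr_ge0 ?(ltW c0) ?(ltW w0).
have T2 : 0 <= k * (e `^ d / w) by rewrite mulr_ge0 ?(ltW k0)// divr_ge0 ?powR_ge0 ?(ltW w0).
have [yl|ly] := ltP y l; last first.
  rewrite mul0r mulr0 add0r -addrA -[leLHS]addr0 lerD//; last first.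
    by rewrite addr_ge0// mulr_ge0// invr_ge0 ltW.
  have y0' : 0 < y by exact: lt_le_trans ly.
  have E : y = y `^ (1 - p) * y `^ p.
    by rewrite -powRD ?subrK ?powRr1// (gt_eqF y0') implybT.
  rewrite {1}E mulrAC ler_wpM2r ?powR_ge0// mulrC ler_pM ?powR_ge0//.
  rewrite -opprB !powRN lef_pV2 ?posrE ?powR_gt0//.
  by rewrite ge0_ler_powR ?nnegrE ?subr_ge0// ltW.
rewrite mul1r -addrA -[leLHS]add0r lerD//.
have S := square_le_power p1 ad pa e01 k01 w1 (introT andP (conj y0 (ltW (lt_le_trans yl l1)))).
pose q := e `^ (d - alpha); have q0 : 0 < q by rewrite powR_gt0.
apply: (@le_trans _ _ (c^-1 * (q * y ^+ 2 / w) + c * q^-1 * (z ^+ 2 * w))); last first.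
  by rewrite (powRN e) lerD2r ler_wpM2l// invr_ge0 ltW.
pose u := c^-1 * (q * y ^+ 2 / w).
have -> : c * q^-1 * (z ^+ 2 * w) = (c * q^-1 * w) * z ^+ 2 by ring.
have -> : c^-1 * (q * y ^+ 2 / w) = (c * q^-1 * w)^-1 * y ^+ 2.
  by rewrite !invfM invrK; ring.
have : 0 < c * q^-1 * w by rewrite !mulr_gt0 ?invr_gt0.
move: (c * q^-1 * w) => {u S T3} v v0.
(* completing the square *)
rewrite -subr_ge0 (_ : _ - _ = v^-1 * ((y - v * z / 2) ^+ 2 + 3 / 4 * (v * z) ^+ 2)).
  by rewrite mulr_ge0 ?invr_ge0 ?(ltW v0)// addr_ge0 ?sqr_ge0// mulr_ge0 ?sqr_ge0.
by field; rewrite gt_eqF.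
Qed.

End pointwise.

(** * Pairing the transform of a test function with an L^p function *)

Section pairing.
Context {R : realType} {n : nat}.
Notation mu := (@lebesgue_rV R n).
Variables (p alpha : R) (y g1 g2 : 'rV[R]_n -> R).
Hypothesis p1 : 1 <= p.
Hypothesis alpha_bounds : 0 <= alpha < n%:R.
Hypothesis p_le : p * alpha <= 2 * n%:R.
Hypothesis y0 : forall x, 0 <= y x.
Hypothesis my : measurable_fun setT y.
Hypothesis iy : mu.-integrable setT (EFin \o (fun x => y x `^ p)).
Hypothesis mg1 : measurable_fun setT g1.
Hypothesis mg2 : measurable_fun setT g2.
Hypothesis g1y : forall x, `|g1 x| <= y x.
Hypothesis g2y : forall x, `|g2 x| <= y x.
Implicit Types (phi psi : 'rV[R]_n -> R) (x : 'rV[R]_n).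

Definition pairing phi : R := \int[mu]_x (g1 x * cosT phi x + g2 x * sinT phi x).

(** The factor gained on the energy by one application of
    [\prod_i (1 + e * d_i)]; its inverse is integrable, with an integral of
    order [e ^- n]. *)
Definition weight (e : R) : 'rV[R]_n -> R := tensor (fun _ s => oneDsqr (e * s)).

Definition small_mass (l : R) : R := \int[mu]_x ((y x < l)%R%:R * y x `^ p).

Lemma weight_ge1 e x : 1 <= weight e x.
Proof.
rewrite /weight /tensor; elim/big_ind: _ => // a b a1 b1.
by rewrite mulr_ege1.
Qed.

Lemma measurable_weight e : measurable_fun setT (weight e).
Proof.
apply: measurable_tensor => i; apply: continuous_measurable_fun => s.
apply: (@continuous_comp _ _ _ (fun s => e * s) oneDsqr); first exact: mulrl_continuous.
exact: continuous_oneDsqr.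
Qed.

Lemma integral_weightV e : 0 < e ->
  mu.-integrable setT (EFin \o (fun x => (weight e x)^-1)) /\
  \int[mu]_x (weight e x)^-1 = (pi / e) ^+ n.
Proof.
move=> e0; have en0 : e != 0 by rewrite gt_eqF.
have E x : (weight e x)^-1 = tensor (fun _ s => (oneDsqr (e * s + 0))^-1) x.
  by rewrite /weight /tensor prodfV; congr _^-1; apply: eq_bigr => i _; rewrite addr0.
have [|it Et] := @integral_tensor R n (fun _ s => (oneDsqr (e * s + 0))^-1).
  by move=> i; exact: (integrable_affine 0 en0 integrable_oneDsqrV).
split; first by apply: eq_integrable it => // x _; rewrite /= E.
transitivity (\int[mu]_x tensor (fun _ s => (oneDsqr (e * s + 0))^-1) x).
  by apply: eq_Rintegral => x _; rewrite E.
rewrite Et (eq_bigr (fun=> pi / e)) ?prodr_const ?card_ord// => i _.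
have := Rintegral_affine 0 en0 integrable_oneDsqrV.
by rewrite Rintegral_oneDsqrV gtr0_norm// => <-; rewrite mulrAC mulfV ?mul1r.
Qed.

Lemma measurable_powy : measurable_fun setT (fun x => y x `^ p).
Proof. by apply/measurable_EFinP; exact: measurable_int iy. Qed.

Lemma measurable_lty l : measurable_fun setT (fun x => (y x < l)%R%:R : R).
Proof.
rewrite (_ : (fun x => _) = \1_(y @^-1` `]-oo, l[%classic)).
  by apply: measurable_indic; rewrite -[X in measurable X]setTI; exact: my.
apply/funext => x; rewrite indicE; congr (nat_of_bool _)%:R.
by apply/idP/idP; rewrite inE/= in_itv.
Qed.

Lemma integrable_small l : mu.-integrable setT (EFin \o (fun x => (y x < l)%R%:R * y x `^ p)).
Proof.
have H x : `|(y x < l)%R%:R| <= 1 :> R by rewrite ger0_norm// lern1 leq_b1.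
have := integrable_bounded_mul iy (measurable_lty l) H.
by apply: eq_integrable => // x _ /=; rewrite mulrC.
Qed.

Lemma pairing_estimate phi (H A e l k c : R) : testR phi ->
  0 < e <= 1 -> 0 < l <= 1 -> 0 < k <= 1 -> 0 < c ->
  (forall x, `|cosT phi x| + `|sinT phi x| <= H) ->
  (\int[mu]_x (weight e x * (cosT phi x ^+ 2 + sinT phi x ^+ 2))%:E <= A%:E)%E ->
  (\int[mu]_x (y x * (`|cosT phi x| + `|sinT phi x|))%:E <=
   (H * l `^ (1 - p) * (\int[mu]_x y x `^ p) +
    c^-1 * (k `^ (- (p / 2)) * small_mass l + k * pi ^+ n) +
    c * e `^ (- (n%:R - alpha)) * (2 * A))%:E)%E.
Proof.
move=> tp e01 l01 k01 c0 zH zA; have Cp := testR_Cc tp.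
have [a0 an] := andP alpha_bounds; have [e0 e1] := andP e01.
have mC := measurable_cosT (testR_integrable tp); have mS := measurable_sinT (testR_integrable tp).
pose z x := `|cosT phi x| + `|sinT phi x|.
have mz : measurable_fun setT z.
  by apply: measurable_funD; exact: measurableT_comp.
have z0 x : 0 <= z x by rewrite addr_ge0.
have w0 x : 0 < weight e x by exact: lt_le_trans (weight_ge1 e x).
pose W x := weight e x * (cosT phi x ^+ 2 + sinT phi x ^+ 2).
have mW : measurable_fun setT W.
  apply: measurable_funM; first exact: measurable_weight.
  by apply: measurable_funD; apply: measurable_funX.
have W0 x : 0 <= W x by rewrite mulr_ge0 ?(ltW (w0 x))// addr_ge0 ?sqr_ge0.
have iW : mu.-integrable setT (EFin \o W).
  by apply: ge0_integrable => //; exact: le_lt_trans zA (ltry _).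
have WA : \int[mu]_x W x <= A.
  by rewrite -lee_fin /Rintegral fineK//; exact: integrable_fin_num iW.
have [iV EV] := integral_weightV e0.
pose T1 x := H * l `^ (1 - p) * y x `^ p.
pose T2 x := c^-1 * (k `^ (- (p / 2)) * ((y x < l)%R%:R * y x `^ p) + k * (e `^ n%:R * (weight e x)^-1)).
pose T3 x := c * e `^ (- (n%:R - alpha)) * (2 * W x).
have i1 : mu.-integrable setT (EFin \o T1) by exact: (integrableZl measurableT _ iy).
have i2a : mu.-integrable setT (EFin \o (fun x => k `^ (- (p / 2)) * ((y x < l)%R%:R * y x `^ p))).
  exact: (integrableZl measurableT _ (integrable_small l)).
have i2c : mu.-integrable setT (EFin \o (fun x => e `^ n%:R * (weight e x)^-1)).
  exact: (integrableZl measurableT _ iV).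
have i2b : mu.-integrable setT (EFin \o (fun x => k * (e `^ n%:R * (weight e x)^-1))).
  exact: (integrableZl measurableT _ i2c).
have i2 : mu.-integrable setT (EFin \o T2).
  exact: (integrableZl measurableT _ (integrableD measurableT i2a i2b)).
have i3a : mu.-integrable setT (EFin \o (fun x => 2 * W x)).
  exact: (integrableZl measurableT _ iW).
have i3 : mu.-integrable setT (EFin \o T3) by exact: (integrableZl measurableT _ i3a).
have i12 : mu.-integrable setT (EFin \o (fun x => T1 x + T2 x)) by exact: (integrableD measurableT i1 i2).
have i123 : mu.-integrable setT (EFin \o (fun x => T1 x + T2 x + T3 x)) by exact: (integrableD measurableT i12 i3).
apply: (@le_trans _ _ (\int[mu]_x (T1 x + T2 x + T3 x)%:E)%E).
  apply: ge0_le_integral => //.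
  - by move=> x _; rewrite lee_fin mulr_ge0.
  - by apply/measurable_EFinP; exact: measurable_funM.
  - exact: measurable_int i123.
  move=> x _; rewrite lee_fin.
  have B := @product_bound R p alpha n%:R e l k c (weight e x) H (y x) (z x)
    p1 (introT andP (conj a0 (ltW an))) p_le e01 l01 k01 c0 (weight_ge1 e x) (y0 x)
    (introT andP (conj (z0 x) (zH x))).
  apply: (le_trans B); rewrite lerD2l ler_wpM2l ?mulr_ge0 ?powR_ge0 ?(ltW c0)//.
  rewrite /W [leRHS]mulrCA [leLHS]mulrC ler_wpM2l ?(ltW (w0 x))//.
  rewrite -(real_normK (num_real (cosT phi x))) -(real_normK (num_real (sinT phi x))) /z.
  move: `|cosT phi x| `|sinT phi x| => a b.
  by have := sqr_ge0 (a - b); nra.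
have E : \int[mu]_x (T1 x + T2 x + T3 x) =
    H * l `^ (1 - p) * (\int[mu]_x y x `^ p) +
    c^-1 * (k `^ (- (p / 2)) * small_mass l + k * pi ^+ n) +
    c * e `^ (- (n%:R - alpha)) * (2 * \int[mu]_x W x).
  rewrite RintegralD// RintegralD// {1}/T1 RintegralZl// {1}/T2 RintegralZl//; last first.
    exact: (integrableD measurableT i2a i2b).
  rewrite RintegralD// RintegralZl//; last exact: integrable_small.
  rewrite RintegralZl// RintegralZl// EV {1}/T3 RintegralZl// RintegralZl//.
  rewrite -/(small_mass l); congr (_ + _ * (_ + _ * _) + _).
  by rewrite powR_mulrn ?(ltW e0)// -exprMn mulrCA mulfV ?mulr1// gt_eqF.
rewrite -(fineK (integrable_fin_num measurableT i123)) lee_fin -/(Rintegral _ _ _) E.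
rewrite lerD2l ler_wpM2l ?mulr_ge0 ?powR_ge0 ?(ltW c0)//.
by rewrite ler_wpM2l.
Qed.

(** Dominated convergence: a positive value of [y] is eventually above the
    threshold, and [y `^ p] vanishes with [y]. *)
Lemma small_mass_cvg (t : R) : 0 < t -> exists2 l, 0 < l <= 1 & small_mass l <= t.
Proof.
move=> t0; pose h k : R := k.+1%:R^-1; have h0 k : 0 < h k by rewrite invr_gt0 ltr0n.
pose f_ k x := (y x < h k)%R%:R * y x `^ p.
have L : (fun k => small_mass (h k)) @ \oo --> \int[mu]_x (0 : R).
  apply: (@Rintegral_dominated_cvg _ _ _ mu f_ _ (fun x => y x `^ p)) => //.
  - by move=> k; apply: measurable_funM; [exact: measurable_lty|exact: measurable_powy].
  - apply: aeW => x; apply: (cvg_near_cst 0); have [yx|yx] := eqVneq (y x) 0.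
      by near=> k; rewrite /f_ yx powR0 ?mulr0// gt_eqF// (lt_le_trans ltr01).
    have yx0 : 0 < y x by rewrite lt_neqAle eq_sym yx y0.
    have := near_infty_natSinv_lt (PosNum yx0); apply: filterS => k /= /ltW hk.
    by rewrite /f_ ltNge hk mul0r.
  - move=> k x; rewrite ger0_norm ?mulr_ge0 ?powR_ge0//.
    by rewrite ler_piMl ?powR_ge0// lern1 leq_b1.
move: L; rewrite Rintegral_eq0// => /cvgrPdist_le /(_ t t0)[k _ /(_ k (leqnn k))].
rewrite /= sub0r normrN => Hk; exists (h k).
  by rewrite h0 /h invf_le1 ?ltr0n// ler1n.
exact: le_trans (ler_norm _) Hk.
Unshelve. all: by end_near. Qed.

Lemma measurable_majorant phi : testR phi ->
  measurable_fun setT (fun x => y x * (`|cosT phi x| + `|sinT phi x|)).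
Proof.
move=> tp; have ip := testR_integrable tp; apply: measurable_funM => //.
by apply: measurable_funD; apply: measurableT_comp => //; [exact: measurable_cosT|exact: measurable_sinT].
Qed.

Lemma measurable_pairing_integrand phi : testR phi ->
  measurable_fun setT (fun x => g1 x * cosT phi x + g2 x * sinT phi x).
Proof.
move=> tp; apply: measurable_funD; apply: measurable_funM => //.
  exact: (measurable_cosT (testR_integrable tp)).
exact: (measurable_sinT (testR_integrable tp)).
Qed.

Lemma pairing_integrand_le phi x :
  `|g1 x * cosT phi x + g2 x * sinT phi x| <= y x * (`|cosT phi x| + `|sinT phi x|).
Proof.
rewrite (le_trans (ler_normD _ _))// mulrDr !normrM.
by rewrite lerD// ler_wpM2r.
Qed.

Lemma integrable_pairing phi : testR phi ->
  mu.-integrable setT (EFin \o (fun x => g1 x * cosT phi x + g2 x * sinT phi x)).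
Proof.
move=> tp; have ip := testR_integrable tp.
have zH x : `|cosT phi x| + `|sinT phi x| <= (\int[mu]_t `|phi t|) + \int[mu]_t `|phi t|.
  by rewrite lerD ?cosT_bound ?sinT_bound.
have one : 0 < (1 : R) <= 1 by rewrite ltr01 lexx.
have B := pairing_estimate tp one one one ltr01 zH (weighted_plancherel 1 tp).
apply/integrableP; split; first by apply/measurable_EFinP; exact: measurable_pairing_integrand.
apply: (@le_lt_trans _ _ (\int[mu]_x (y x * (`|cosT phi x| + `|sinT phi x|))%:E)%E).
  apply: ge0_le_integral => //.
  - by apply: measurableT_comp => //; apply/measurable_EFinP; exact: measurable_pairing_integrand.
  - by apply/measurable_EFinP; exact: measurable_majorant.
  - by move=> x _; rewrite /= lee_fin pairing_integrand_le.
exact: le_lt_trans B (ltry _).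
Qed.

Lemma pairing_le phi B : testR phi ->
  (\int[mu]_x (y x * (`|cosT phi x| + `|sinT phi x|))%:E <= B%:E)%E -> `|pairing phi| <= B.
Proof.
move=> tp yzB; have i := integrable_pairing tp.
have in_ := integrable_norm i.
rewrite (le_trans (le_normr_Rintegral measurableT i))// -lee_fin.
rewrite /Rintegral fineK; last exact: integrable_fin_num in_.
apply: le_trans yzB; apply: ge0_le_integral => //.
- exact: measurable_int in_.
- by apply/measurable_EFinP; exact: measurable_majorant.
- by move=> x _; rewrite lee_fin pairing_integrand_le.
Qed.

Lemma pairingD phi psi : testR phi -> testR psi ->
  pairing (fun t => phi t + psi t) = pairing phi + pairing psi.
Proof.
move=> tp tq; rewrite /pairing -RintegralD//; [|exact: integrable_pairing|exact: integrable_pairing].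
apply: eq_Rintegral => x _.
by rewrite cosTD ?sinTD; try exact: testR_integrable; ring.
Qed.

Lemma pairing0 : pairing (fun=> 0) = 0.
Proof.
apply: Rintegral_eq0 => x; rewrite [cosT _ _]Rintegral_eq0 ?[sinT _ _]Rintegral_eq0 ?mulr0 ?addr0//.
all: by move=> t; rewrite mul0r.
Qed.

Lemma pairing_sum (I : Type) (r : seq I) (P : pred I) (F : I -> 'rV[R]_n -> R) :
  (forall i, P i -> testR (F i)) ->
  pairing (fun x => \sum_(i <- r | P i) F i x) = \sum_(i <- r | P i) pairing (F i).
Proof.
move=> tF; rewrite -fct_sumE.
suff [] : testR (\sum_(i <- r | P i) F i) /\
    pairing (\sum_(i <- r | P i) F i) = \sum_(i <- r | P i) pairing (F i) by [].
apply: (big_ind2 (fun g s => testR g /\ pairing g = s)) => [|g s h t [tg <-] [th <-]|i /tF//].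
  by split; [exact: testR0|exact: pairing0].
by split; [exact: testRD|exact: pairingD].
Qed.

Lemma small_factor (a t : R) : 0 <= a -> 0 < t -> exists2 c, 0 < c <= 1 & c * a <= t.
Proof.
move=> a0 t0; have a1 : 0 < a + 1 by rewrite ltr_wpDl.
exists (Num.min 1 (t / (a + 1))).
  by rewrite lt_min ltr01 divr_gt0//= ge_min lexx.
apply: (@le_trans _ _ (t / (a + 1) * (a + 1))); last by rewrite divfK// gt_eqF.
by apply: ler_pM => //; rewrite ?ge_min ?lexx ?orbT ?lerDl// le_min ler01 divr_ge0 ?ltW.
Qed.

(** The parameters are chosen in the order [c], [k], [l], [e]: each makes one
    term of [pairing_estimate] small, the earlier ones being fixed. *)
Lemma pairing_eq0 psi (K e1 : R) : 0 <= K -> 0 < e1 ->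
  (forall e, 0 < e <= 1 -> e <= e1 -> exists phi, [/\ testR phi, pairing psi = pairing phi,
     forall x, `|cosT phi x| + `|sinT phi x| <= K * e `^ (n%:R - alpha) &
     (\int[mu]_x (weight e x * (cosT phi x ^+ 2 + sinT phi x ^+ 2))%:E <=
       (K * e `^ (n%:R - alpha))%:E)%E]) ->
  pairing psi = 0.
Proof.
move=> K0 e10 H; apply/eqP; rewrite -normr_le0; apply/ler_addgt0Pr => eta eta0; rewrite add0r.
have q0 : 0 < n%:R - alpha by case/andP: alpha_bounds => _; rewrite subr_gt0.
pose Y := \int[mu]_x y x `^ p.
have Y0 : 0 <= Y by apply: Rintegral_ge0 => x _; exact: powR_ge0.
have t0 : 0 < eta / 4 by rewrite divr_gt0.
have [c /andP[c0 c1] cK] := small_factor (mulr_ge0 (ler0n R 2) K0) t0.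
have ci0 : 0 <= c^-1 by rewrite invr_ge0 ltW.
have [k k01 kP] := small_factor (mulr_ge0 ci0 (exprn_ge0 n (pi_ge0 R))) t0.
have /andP[k0 _] := k01.
have d0 : 0 < c^-1 * k `^ (- (p / 2)) by rewrite mulr_gt0 ?invr_gt0 ?powR_gt0.
have [l l01 lP] := small_mass_cvg (divr_gt0 t0 d0).
have [s /andP[s0 s1] sP] := small_factor (mulr_ge0 (mulr_ge0 K0 (powR_ge0 l (1 - p))) Y0) t0.
(* chosen so that [e `^ (n - alpha) <= s] *)
pose e := Num.min e1 (s `^ (n%:R - alpha)^-1).
have e0 : 0 < e by rewrite lt_min e10 powR_gt0.
have ele : e <= s `^ (n%:R - alpha)^-1 by rewrite ge_min lexx orbT.
have e01 : 0 < e <= 1.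
  by rewrite e0 (le_trans ele)// powR_le1 ?invr_ge0 ?(ltW q0)// (ltW s0).
have es : e `^ (n%:R - alpha) <= s.
  apply: (@le_trans _ _ ((s `^ (n%:R - alpha)^-1) `^ (n%:R - alpha))).
    by rewrite ge0_ler_powR ?nnegrE ?(ltW q0) ?(ltW e0)// powR_ge0.
  by rewrite -powRrM mulVf ?gt_eqF// powRr1// ltW.
have [|phi [tp -> zH zA]] := H e e01; first by rewrite ge_min lexx.
have := pairing_le tp (pairing_estimate tp e01 l01 k01 c0 zH zA).
move=> /le_trans; apply.
have En : c * e `^ (- (n%:R - alpha)) * (2 * (K * e `^ (n%:R - alpha))) = c * (2 * K).
  rewrite powRN; have : e `^ (n%:R - alpha) != 0 by rewrite gt_eqF// powR_gt0.
  by move: (e `^ _) => u u0; field.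
rewrite En -/Y.
have B1 : K * e `^ (n%:R - alpha) * l `^ (1 - p) * Y <= eta / 4.
  apply: le_trans sP.
  rewrite [leLHS](_ : _ = e `^ (n%:R - alpha) * (K * l `^ (1 - p) * Y)); last by ring.
  by rewrite ler_wpM2r// !mulr_ge0 ?powR_ge0.
have B2 : c^-1 * (k `^ (- (p / 2)) * small_mass l) <= eta / 4.
  by rewrite mulrA mulrC -ler_pdivlMr.
have B3 : c^-1 * (k * pi ^+ n) <= eta / 4 by rewrite mulrCA.
by rewrite mulrDr; lra.
Qed.

End pairing.

(** * Cells of a grid *)

Section grid.
Context {R : realType} {n : nat}.
Notation mu := (@lebesgue_rV R n).
Notation leb := (@lebesgue_measure R).
Implicit Types (x : 'rV[R]_n).

Section fixed_grid.
Variables (e : R) (M : nat).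
Hypothesis e0 : 0 < e.
Let en0 : e != 0. Proof. by rewrite gt_eqF. Qed.
Let ei0 : e^-1 != 0. Proof. by rewrite invr_eq0. Qed.

Notation index := {ffun 'I_n -> 'I_M.*2.+1}.
Implicit Types k : index.

(** The grid of mesh [e] has [2 * M + 1] nodes in each coordinate, centred at
    the origin: the node of index [k i] is [e * (k i - M)]. *)
Definition cell k (i : 'I_n) (u : R) : R := bump (e^-1 * u + (M%:R - (k i)%:R)).

Definition cell_box k x := forall i, `|e^-1 * x 0 i + (M%:R - (k i)%:R)| <= 1.

Lemma smooth1_cell k i : smooth1 (cell k i).
Proof. by apply: smooth1_affine; exact: smooth1_bump. Qed.

Lemma derive_cell k i u : e * 'D_1 (cell k i) u = 'D_1 bump (e^-1 * u + (M%:R - (k i)%:R)).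
Proof.
have [_ ->] := @is_derive_affine _ bump e^-1 (M%:R - (k i)%:R) u (smooth1_derivable smooth1_bump).
by rewrite mulrA mulfV// mul1r.
Qed.

Lemma cell_boxP k x : tensor (cell k) x != 0 -> cell_box k x.
Proof.
move=> t0 i; rewrite leNgt; apply/negP => H; move/eqP: t0; apply.
by rewrite /tensor (bigD1 i)//= /cell bump_out ?mul0r// ltW.
Qed.

Lemma sum_tensor_cell x : (forall i, `|e^-1 * x 0 i| <= M%:R) ->
  \sum_k tensor (cell k) x = 1.
Proof.
move=> xM; rewrite /tensor /cell.
rewrite -(bigA_distr_bigA (fun i (j : 'I_M.*2.+1) => bump (e^-1 * x 0 i + (M%:R - j%:R)))).
rewrite big1// => i _; rewrite -[RHS](sum_bump (xM i)).
by apply: eq_bigr => j _; congr bump; ring.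
Qed.

(** A majorant of the factors of a cell and of their rescaled derivatives that
    remains a tensor product, so that its sums and integrals are explicit. *)
Definition cell_bound (B : R) k (i : 'I_n) (u : R) : R :=
  B * \1_(`[-1, 1]%classic) (e^-1 * u + (M%:R - (k i)%:R)).

Lemma cell_bound_ge0 B k i u : 0 <= B -> 0 <= cell_bound B k i u.
Proof. by move=> B0; rewrite mulr_ge0. Qed.

Lemma le_cell_bound (B : R) (a : R -> R) k i u : 0 <= B -> (forall v, `|a v| <= B) ->
  (forall v, 1 < `|v| -> a v = 0) -> `|a (e^-1 * u + (M%:R - (k i)%:R))| <= cell_bound B k i u.
Proof.
move=> B0 aB a0; rewrite /cell_bound; set v := _ + _.
have [v1|v1] := ltP 1 `|v|; first by rewrite a0// normr0 mulr_ge0.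
by rewrite indicE mem_set ?mulr1//= in_itv/= -ler_norml.
Qed.

(** Integers within distance 1 of [v] lie among three consecutive ones. *)
Lemma card_near (N : nat) (v : R) :
  \sum_(j < N) \1_(`[-1, 1]%classic) (v - j%:R) <= 3 :> R.
Proof.
pose S := [set j : 'I_N | `|v - j%:R| <= 1]%SET.
have -> : \sum_(j < N) \1_(`[-1, 1]%classic) (v - j%:R) = #|S|%:R :> R.
  rewrite -sum1_card natr_sum [RHS]big_mkcond/=; apply: eq_bigr => j _.
  rewrite indicE inE; case: ifP => H; first by rewrite mem_set//= in_itv/= -ler_norml.
  by rewrite memNset//= in_itv/= -ler_norml H.
rewrite ler_nat; have [->|[j0 Sj0]] := set_0Vmem S; first by rewrite cards0.
case: (@arg_minnP _ j0 (fun j => j \in S) (fun j => nat_of_ord j) Sj0) => jm Sjm jmin.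
rewrite cardE -(size_map val) -(size_iota jm 3).
apply: uniq_leq_size; first by rewrite map_inj_uniq ?enum_uniq//; exact: val_inj.
move=> _ /mapP[j + ->]; rewrite mem_enum => Sj; rewrite mem_iota jmin//=.
move: Sj Sjm; rewrite !inE !ler_norml => /andP[H1 H2] /andP[H3 H4].
have : (j%:R : R) <= (jm + 2)%:R by rewrite natrD; lra.
by rewrite ler_nat; lia.
Qed.

Lemma sum_tensor_cell_bound B x : 0 <= B -> \sum_k tensor (cell_bound B k) x <= (3 * B) ^+ n.
Proof.
move=> B0; rewrite /tensor /cell_bound.
rewrite -(bigA_distr_bigA (fun i (j : 'I_M.*2.+1) => B * \1_(`[-1, 1]%classic) (e^-1 * x 0 i + (M%:R - j%:R)))).
rewrite [leRHS](_ : _ = \prod_(i < n) (3 * B)); last by rewrite prodr_const card_ord.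
apply: ler_prod => i _; rewrite sumr_ge0/=; last by move=> j _; rewrite mulr_ge0.
rewrite -mulr_sumr mulrC ler_wpM2r//.
under eq_bigr do rewrite addrA.
exact: card_near.
Qed.

Lemma integral_tensor_cell_bound B k :
  mu.-integrable setT (EFin \o tensor (cell_bound B k)) /\
  \int[mu]_x tensor (cell_bound B k) x = (2 * B) ^+ n * e ^+ n.
Proof.
have i1 := integrable_indic_itv (- 1 : R) 1.
have ii i : leb.-integrable setT (EFin \o cell_bound B k i).
  exact: (integrableZl measurableT _ (integrable_affine _ ei0 i1)).
have [it ->] := integral_tensor ii; split => //.
rewrite (eq_bigr (fun=> 2 * B * e)) ?prodr_const ?card_ord ?exprMn// => i _.
rewrite /cell_bound RintegralZl//; last exact: (integrable_affine _ ei0 i1).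
have := Rintegral_affine (M%:R - (k i)%:R) ei0 i1.
rewrite (_ : \int[leb]_x \1_(`[-1, 1]%classic) x = 2).
  by rewrite gtr0_norm ?invr_gt0// => /(congr1 ( *%R e)); rewrite mulVKf// => ->; ring.
rewrite /Rintegral integral_indic// setIT.
have H : leb `[(-1)%R, 1%R]%classic = 2%:E.
  by rewrite lebesgue_measure_itv/= lte_fin (lt_trans (ltrN10 R))// -EFinB opprK.
exact: (congr1 fine H).
Qed.

End fixed_grid.
End grid.

(** * Counting cells near a set of finite packing content *)

Section counting.
Context {R : realType} {n : nat}.
Implicit Types (x y : 'rV[R]_n) (E : set 'rV[R]_n).

Lemma coord_le_enorm x i : `|x 0 i| <= enorm x.
Proof.
rewrite /enorm -sqrtr_sqr ler_sqrt; last by rewrite sumr_ge0// => j _; rewrite -expr2 sqr_ge0.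
by rewrite /dot (bigD1 i)//= -expr2 lerDl sumr_ge0// => j _; rewrite -expr2 sqr_ge0.
Qed.

(** Points with a coordinate [e] apart are the centres of disjoint balls of
    radius [e / 2]: they form a packing. *)
Lemma packing_count (s eps C e : R) E (T : finType) (G : {set T}) (y : T -> 'rV[R]_n) :
  0 < e <= eps -> (packing_eps s eps E <= C%:E)%E ->
  (forall k, k \in G -> E (y k)) ->
  (forall k k', k \in G -> k' \in G -> k != k' -> exists i, e <= `|y k 0 i - y k' 0 i|) ->
  #|G|%:R * e `^ s <= C.
Proof.
move=> /andP[e0 eeps] PC GE sep; rewrite -lee_fin; apply: le_trans PC.
have [->|[k0 Gk0]] := set_0Vmem G.
  rewrite cards0 mul0r; apply: ereal_sup_ubound.
  exists set0, (fun=> 0), (fun=> 0); rewrite esum_set0; split => //.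
  by split => //; exact: trivIset_set0.
pose c j := nth k0 (enum G) j.
have cG j : (j < #|G|)%N -> c j \in G.
  by move=> jG; rewrite -mem_enum mem_nth// -cardE.
apply: ereal_sup_ubound; exists `I_#|G|, (fun j => y (c j)), (fun=> e / 2); split; last first.
  have -> : 2 * (e / 2) = e by rewrite mulrCA mulfV ?mulr1// pnatr_eq0.
  rewrite esum_fset//; last by move=> i _; rewrite lee_fin powR_ge0.
  rewrite -fsbig_ord sumEFin sumr_const card_ord; congr EFin.
  by rewrite mulr_natl.
split.
  move=> j /= jG; split; first by apply: GE; exact: cG.
  by rewrite divr_gt0//= ler_wpM2r.
apply/trivIsetP => i j /= iG jG ij; apply/seteqP; split => // z [zi zj].
have [|l] := sep (c i) (c j) (cG _ iG) (cG _ jG).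
  by rewrite nth_uniq ?enum_uniq -?cardE.
apply/negP; rewrite -ltNge.
have := le_lt_trans (coord_le_enorm _ l) zi; have := le_lt_trans (coord_le_enorm _ l) zj.
rewrite !mxE; move: (y (c i) 0 l) (y (c j) 0 l) (z 0 l) => a b d.
by rewrite !ltr_norml => /andP[? ?] /andP[? ?]; lra.
Qed.

(** Each cell of [G] contains a point of the closure, hence has a point of [E]
    within [2 * e] of its node. Splitting the indices into residue classes
    modulo 5 keeps the nodes of a class [5 * e] apart, hence the chosen points
    [e] apart, and [packing_count] bounds each class. *)
Lemma grid_count (s eps C e : R) (M : nat) E (G : {set {ffun 'I_n -> 'I_M.*2.+1}}) :
  0 < e <= eps -> (packing_eps s eps E <= C%:E)%E ->
  (forall k, k \in G -> exists2 q, closure E q & cell_box e k q) ->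
  #|G|%:R * e `^ s <= 5 ^+ n * C.
Proof.
move=> e0e PC GE; have /andP[e0 _] := e0e.
have P k : exists y, k \in G -> E y /\ forall i, `|y 0 i - e * ((k i)%:R - M%:R)| < 2 * e.
  have [kG|kG] := boolP (k \in G); last by exists 0.
  have [q Eq kq] := GE k kG.
  have [y [Ey /ball_rVE[_ qy]]] := Eq _ (nbhsx_ballx q e e0).
  exists y => _; split => // i; have := kq i; have := qy i.
  have -> : e^-1 * q 0 i + (M%:R - (k i)%:R) = e^-1 * (q 0 i - e * ((k i)%:R - M%:R)).
    by field; rewrite gt_eqF.
  rewrite normrM gtr0_norm ?invr_gt0// ler_pdivrMl// mulr1.
  move: (q 0 i) (y 0 i) (e * _) => a b d.
  by rewrite ler_norml !ltr_norml => /andP[? ?] /andP[? ?]; apply/andP; split; lra.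
have [y yP] := choice P.
(* indices congruent modulo 5 that differ do so by at least 5 *)
pose cls (k : {ffun 'I_n -> 'I_M.*2.+1}) : {ffun 'I_n -> 'I_5} := [ffun i => inord (k i %% 5)].
have cnt c : #|[set k in G | cls k == c]%SET|%:R * e `^ s <= C.
  apply: (packing_count e0e PC (y := y)).
    by move=> k; rewrite inE => /andP[kG _]; have [] := yP k kG.
  move=> k k'; rewrite !inE => /andP[kG /eqP kc] /andP[kG' /eqP kc'] kk'.
  have [i ki] : exists i, k i != k' i.
    apply/existsP; rewrite -negb_forall; apply: contra kk' => /forallP H.
    by apply/eqP/ffunP => i; exact/eqP.
  have km : (k i = k' i %[mod 5])%N.
    have := congr1 (fun f : {ffun 'I_n -> 'I_5} => nat_of_ord (f i)) (etrans kc (esym kc')).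
    by rewrite !ffunE !inordK// ltn_pmod.
  have {}ki : (nat_of_ord (k i) != k' i)%N by [].
  exists i; have [_ /(_ i) H1] := yP k kG; have [_ /(_ i) H2] := yP k' kG'.
  have : ((k i)%:R + 5 <= (k' i)%:R :> R) \/ ((k' i)%:R + 5 <= (k i)%:R :> R).
    rewrite -!(natrD _ _ 5) !ler_nat.
    move: km ki; move: (nat_of_ord (k i)) (nat_of_ord (k' i)) => a b; lia.
  move: H1 H2; move: (y k 0 i) (y k' 0 i) (_ %:R) ((k' i)%:R) => a b u v.
  rewrite !ltr_norml ler_normr => /andP[? ?] /andP[? ?] [uv|uv]; apply/orP; [right|left]; nra.
rewrite -(sum1_card) (partition_big cls xpredT)//= natr_sum mulr_suml.
have -> : 5 ^+ n * C = \sum_(c : {ffun 'I_n -> 'I_5}) C.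
  by rewrite sumr_const card_ffun !card_ord -[RHS]mulr_natl natrX.
apply: ler_sum => c _; apply: le_trans (cnt c).
by rewrite sum1dep_card ler_wpM2r ?powR_ge0// ler_nat.
Qed.

End counting.

(** * Supports and decomposition over a grid *)

Section localisation.
Context {R : realType} {n : nat}.
Implicit Types (phi psi : 'rV[R]_n -> R) (x : 'rV[R]_n).

Definition suppR phi : set 'rV[R]_n := closure [set x | phi x != 0].

Lemma closure_min (A B : set 'rV[R]_n) : closed B -> A `<=` B -> closure A `<=` B.
Proof. by move=> cB AB; rewrite [X in _ `<=` X]((closure_id B).1 cB); exact: closureS. Qed.

Lemma suppR_in phi x : phi x != 0 -> suppR phi x.
Proof. by move=> px; apply: subset_closure. Qed.

Lemma suppR_compact phi : testR phi -> compact (suppR phi).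
Proof.
move=> [_ [N pN]]; have cN := @compact_box R n N.
apply: (subclosed_compact (@closed_closure _ _) cN).
have cB := compact_closed (@norm_hausdorff _ _) cN.
apply: closure_min => // x /pN xN i.
by rewrite /= in_itv/= -ler_norml.
Qed.

Section cells.
Variables (e : R) (M : nat).
Hypothesis e0 : 0 < e.
Notation index := {ffun 'I_n -> 'I_M.*2.+1}.

Lemma suppR_cell (k : index) psi x :
  suppR (fun x => psi x * tensor (cell e k) x) x -> suppR psi x /\ cell_box e k x.
Proof.
move=> sx; split.
  by move: x sx; apply: closureS => x /=; rewrite mulf_eq0 negb_or => /andP[].
move=> i; pose B := [set x : 'rV[R]_n | `|e^-1 * x 0 i + (M%:R - (k i)%:R)| <= 1].
have cB : closed B.
  apply: (@closed_comp _ _ (fun x : 'rV[R]_n => `|e^-1 * x 0 i + (M%:R - (k i)%:R)|) [set r | r <= 1]).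
    move=> y _; apply: (@continuous_comp _ _ _ (fun x : 'rV[R]_n => e^-1 * x 0 i + (M%:R - (k i)%:R)) (fun r : R => `|r|)); last exact: norm_continuous.
    apply: continuousD; last exact: cst_continuous.
    apply: (@continuous_comp _ _ _ (fun x : 'rV[R]_n => x 0 i) (fun r : R => e^-1 * r)).
      exact: coord_continuous.
    exact: mulrl_continuous.
  exact: closed_le.
suff : B x by [].
move: x sx; apply: closure_min => // x /=.
by rewrite mulf_eq0 negb_or => /andP[_ /cell_boxP]; exact.
Qed.

Lemma testR_cell (k : index) psi : testR psi -> testR (fun x => psi x * tensor (cell e k) x).
Proof.
by move=> tp; apply: testRM => //; apply: smoothR_tensor => i; exact: smooth1_cell.
Qed.

Lemma grid_decomposition psi N : box_supported N psi -> e^-1 * N <= M%:R ->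
  psi = fun x => \sum_k psi x * tensor (cell e (k : index)) x.
Proof.
move=> pN NM; apply/funext => x; rewrite -mulr_sumr.
have [->|px] := eqVneq (psi x) 0; first by rewrite mul0r.
rewrite sum_tensor_cell ?mulr1// => i.
rewrite normrM gtr0_norm ?invr_gt0// (le_trans _ NM)// ler_wpM2l ?invr_ge0 ?(ltW e0)//.
exact: pN.
Qed.

End cells.

Lemma exists_grid_size (e N : R) : exists M : nat, e^-1 * N <= M%:R.
Proof.
exists (Num.bound `|e^-1 * N|); apply: le_trans (ler_norm _) _.
by rewrite ltW// archi_boundP.
Qed.

(** A grid finer than a Lebesgue number of the covering decomposes [psi] into
    pieces carried by single neighbourhoods. *)
Lemma additive_local (T : ('rV[R]_n -> R) -> R) psi :
  (forall (I : finType) (F : I -> 'rV[R]_n -> R), (forall i, testR (F i)) ->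
     T (fun x => \sum_i F i x) = \sum_i T (F i)) ->
  testR psi ->
  (forall x, suppR psi x -> exists2 U, nbhs x U &
     forall phi, testR phi -> suppR phi `<=` U -> T phi = 0) ->
  T psi = 0.
Proof.
move=> Tsum tp loc.
pose P (d : R) x := exists U : set 'rV[R]_n, ball x d `<=` U /\
  (forall phi, testR phi -> suppR phi `<=` U -> T phi = 0).
have : \forall d \near (0:R)^'+, suppR psi `<=` P d.
  apply: (compact_near_coveringP _).1; first exact: suppR_compact.
  move=> x sx; have [U /nbhs_ballP[r /= r0 rU] UT] := loc x sx.
  have r20 : 0 < r / 2 by rewrite divr_gt0.
  near=> x' d => /=; exists U; split => // z zx'; apply: rU.
  rewrite [r]splitr; apply: (@ball_triangle _ _ x').
    by near: x'; exact: nbhsx_ballx.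
  apply: le_ball zx'; near: d.
  by apply: nbhs_right_le.
move=> Pd; have [d [Pd' d0]] : exists d, suppR psi `<=` P d /\ 0 < d.
  have : \forall d \near (0:R)^'+, suppR psi `<=` P d /\ 0 < d.
    by near=> d; split; [near: d; exact: Pd|near: d; exact: nbhs_right_gt].
  by move=> /(@filter_ex _ _ (at_right_proper_filter 0)).
have e0 : 0 < d / 3 by rewrite divr_gt0.
have [_ [N pN]] := tp; have [M NM] := exists_grid_size (d / 3) N.
rewrite (grid_decomposition e0 pN NM) Tsum => [|k]; last exact: testR_cell.
rewrite big1// => k _.
have [[x sx]|nx] := pselect (exists x, suppR (fun x => psi x * tensor (cell (d / 3) k) x) x).
  have [px kx] := suppR_cell sx; have [U [xU UT]] := Pd' x px.
  apply: UT; first exact: testR_cell.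
  move=> z sz; apply: xU; apply/ball_rVE; split => // i.
  have [_ kz] := suppR_cell sz; have := kx i; have := kz i.
  have D a : (d / 3)^-1 * a + (M%:R - (k i)%:R) = (d / 3)^-1 * (a - (d / 3) * ((k i)%:R - M%:R)).
    by field; rewrite gt_eqF.
  rewrite !D !normrM gtr0_norm ?invr_gt0// !ler_pdivrMl// !mulr1.
  move: (x 0 i) (z 0 i) (_ * (_ - _)) => a b c.
  by rewrite !ler_norml ltr_norml => /andP[? ?] /andP[? ?]; apply/andP; split; lra.
rewrite (_ : (fun x => _) = fun x => \sum_(i < 0) 0).
  by rewrite (Tsum _ (fun _ _ => 0)) ?big_ord0// => _; exact: testR0.
apply/funext => x; rewrite big_ord0; apply/eqP; apply: contraT => px.
by exfalso; apply: nx; exists x; exact: suppR_in.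
Unshelve. all: by end_near. Qed.

End localisation.

(** * Cut-offs at one scale *)

Section cut_off.
Context {R : realType} {n : nat}.
Notation mu := (@lebesgue_rV R n).
Implicit Types (phi psi : 'rV[R]_n -> R) (x : 'rV[R]_n).

Lemma partials_le_norm m M psi x : partials_le m M psi -> `|psi x| <= M.
Proof. by case: m => [|m] []. Qed.

Lemma dop0 e s : dop e s (fun=> 0) = (fun=> 0) :> ('rV[R]_n -> R).
Proof.
elim: s => //= i s IH; rewrite -[RHS]IH; congr (dop e s _); apply/funext => x.
by rewrite /partial derive_cst mulr0 addr0.
Qed.

Lemma dop_sum e s (I : Type) (r : seq I) (P : pred I) (F : I -> 'rV[R]_n -> R) :
  (forall i, smoothR (F i)) ->
  dop e s (fun x => \sum_(i <- r | P i) F i x) = fun x => \sum_(i <- r | P i) dop e s (F i) x.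
Proof.
move=> sF; rewrite -!fct_sumE.
suff [] : smoothR (\sum_(i <- r | P i) F i) /\
    dop e s (\sum_(i <- r | P i) F i) = \sum_(i <- r | P i) dop e s (F i) by [].
apply: (big_ind2 (fun g h => smoothR g /\ dop e s g = h)) => [|g g' h h' [sg <-] [sh <-]|i _].
- by split; [exact: smoothR_cst|exact: dop0].
- by split; [exact: smoothRD|exact: dopD].
- by split.
Qed.

Section one_scale.
Variables (e : R) (M : nat) (B B' : R) (psi : 'rV[R]_n -> R).
Hypothesis e01 : 0 < e <= 1.
Hypothesis B1 : 1 <= B.
Hypothesis bumpB : forall u : R, `|'D_1 bump u| <= B.
Hypothesis tpsi : testR psi.
Hypothesis psiB : partials_le n B' psi.
Notation index := {ffun 'I_n -> 'I_M.*2.+1}.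
Variable G : {set index}.

Let e0 : 0 < e. Proof. by case/andP: e01. Qed.
Let B0 : 0 <= B. Proof. exact: le_trans B1. Qed.
Let B'0 : 0 <= B'.
Proof. exact: le_trans (normr_ge0 _) (partials_le_norm 0 psiB). Qed.

Definition cut_off x := \sum_(k in G) psi x * tensor (cell e k) x.

Lemma testR_cut_off : testR cut_off.
Proof. by apply: testR_sum => k _; exact: testR_cell. Qed.

Lemma cell_le (k : index) i u : `|cell e k i u| <= cell_bound e B k i u.
Proof.
apply: (@le_cell_bound _ _ _ _ _ bump) => // v; first exact: le_trans (bump_norm_le1 v) B1.
by move=> /ltW; exact: bump_out.
Qed.

Lemma derive_cell_le (k : index) i u : `|e * 'D_1 (cell e k i) u| <= cell_bound e B k i u.
Proof. by rewrite derive_cell//; apply: (@le_cell_bound _ _ _ _ _ (fun u => 'D_1 bump u)) => // v; exact: derive_bump_out. Qed.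

Lemma cut_off_le x : `|cut_off x| <= B' * \sum_(k in G) tensor (cell_bound e B k) x.
Proof.
rewrite (le_trans (ler_norm_sum _ _ _))// mulr_sumr; apply: ler_sum => k _.
rewrite normrM ler_pM//; first exact: partials_le_norm psiB.
rewrite normr_prod; apply: ler_prod => i _; rewrite normr_ge0/=; exact: cell_le.
Qed.

Lemma dop_cut_off_le x :
  `|dop e (index_enum 'I_n) cut_off x| <= 3 ^+ n * B' * \sum_(k in G) tensor (cell_bound e B k) x.
Proof.
rewrite /cut_off dop_sum; last by move=> k; exact: testR_smooth (testR_cell _ _ _).
rewrite (le_trans (ler_norm_sum _ _ _))// mulr_sumr; apply: ler_sum => k _.
have sz : size (index_enum 'I_n) = n by rewrite -[RHS](card_ord n) cardT enumT.
have := @dop_tensor_bound _ _ e (index_enum 'I_n) psi (cell e k) (cell_bound e B k) B' x.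
rewrite sz; apply.
- by case/andP: e01 => /ltW -> ->.
- exact: index_enum_uniq.
- exact: testR_smooth.
- exact: psiB.
- by move=> i; exact: smooth1_cell.
- by move=> i u; exact: cell_le.
- by move=> i u _; exact: derive_cell_le.
Qed.

Lemma integral_sum_cell_bound :
  mu.-integrable setT (EFin \o (fun x => \sum_(k in G) tensor (cell_bound e B k) x)) /\
  \int[mu]_x (\sum_(k in G) tensor (cell_bound e B k) x) = #|G|%:R * ((2 * B) ^+ n * e ^+ n).
Proof.
rewrite -sum1_card natr_sum mulr_suml -fct_sumE.
apply: (big_ind2 (fun g s => mu.-integrable setT (EFin \o g) /\ \int[mu]_x g x = s)).
- by split; [exact: integrable0|exact: Rintegral_eq0].
- move=> g s h t [ig <-] [ih <-]; split; first exact: (integrableD measurableT ig ih).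
  by rewrite -RintegralD.
- by move=> k _; rewrite mul1r; exact: integral_tensor_cell_bound.
Qed.

Lemma transforms_cut_off_le x : `|cosT cut_off x| + `|sinT cut_off x| <=
  2 * (B' * (#|G|%:R * ((2 * B) ^+ n * e ^+ n))).
Proof.
have ic := testR_integrable testR_cut_off.
have [iS ES] := integral_sum_cell_bound.
have H : \int[mu]_t `|cut_off t| <= B' * (#|G|%:R * ((2 * B) ^+ n * e ^+ n)).
  rewrite -ES -RintegralZl//; apply: le_Rintegral => //.
  - exact: integrable_norm ic.
  - exact: (integrableZl measurableT _ iS).
  - by move=> t _; exact: cut_off_le.
by rewrite mulr_natl mulr2n lerD// (le_trans _ H)// ?cosT_bound ?sinT_bound.
Qed.

(** On the support of the bounds at most [3 ^+ n] cells overlap, so the square of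
    the sum is controlled by the sum itself, whose integral is proportional to
    the number of cells. *)
Lemma energy_cut_off_le :
  (\int[mu]_x (weight e x * (cosT cut_off x ^+ 2 + sinT cut_off x ^+ 2))%:E <=
  ((2 * pi) ^+ n * ((3 ^+ n * B') ^+ 2 * (3 * B) ^+ n * (#|G|%:R * ((2 * B) ^+ n * e ^+ n))))%:E)%E.
Proof.
apply: (le_trans (weighted_plancherel e testR_cut_off)).
rewrite lee_fin ler_wpM2l// ?exprn_ge0 ?mulr_ge0 ?pi_ge0//.
have [iS ES] := integral_sum_cell_bound.
rewrite -ES -RintegralZl//; apply: le_Rintegral => //.
- have td := testR_dop e (index_enum 'I_n) testR_cut_off.
  have := testR_integrable (testRM td (testR_smooth td)).
  by apply: eq_integrable => // x _.
- exact: (integrableZl measurableT _ iS).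
move=> x _; set S := \sum_(k in G) _.
have S0 : 0 <= S.
  by apply: sumr_ge0 => k _; apply: prodr_ge0 => i _; exact: cell_bound_ge0.
have S1 : S <= (3 * B) ^+ n.
  apply: le_trans (@sum_tensor_cell_bound _ _ e M e0 B x B0).
  rewrite [leRHS](bigID (mem G))/= lerDl; apply: sumr_ge0 => k _.
  by apply: prodr_ge0 => i _; exact: cell_bound_ge0.
have D0 : 0 <= 3 ^+ n * B' by rewrite mulr_ge0 ?exprn_ge0.
rewrite -(real_normK (num_real _)).
apply: (@le_trans _ _ ((3 ^+ n * B' * S) ^+ 2)).
  rewrite lerXn2r ?nnegrE ?mulr_ge0 ?exprn_ge0//; exact: dop_cut_off_le.
rewrite exprMn -mulrA ler_wpM2l ?sqr_ge0// expr2 ler_wpM2r//.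
Qed.

End one_scale.
End cut_off.

(** * Vanishing near a set of finite packing content *)

Section local_vanishing.
Context {R : realType} {n : nat}.
Notation mu := (@lebesgue_rV R n).
Variables (p alpha : R) (y g1 g2 : 'rV[R]_n -> R).
Hypothesis p1 : 1 <= p.
Hypothesis alpha_bounds : 0 <= alpha < n%:R.
Hypothesis p_le : p * alpha <= 2 * n%:R.
Hypothesis y0 : forall x, 0 <= y x.
Hypothesis my : measurable_fun setT y.
Hypothesis iy : mu.-integrable setT (EFin \o (fun x => y x `^ p)).
Hypothesis mg1 : measurable_fun setT g1.
Hypothesis mg2 : measurable_fun setT g2.
Hypothesis g1y : forall x, `|g1 x| <= y x.
Hypothesis g2y : forall x, `|g2 x| <= y x.
Implicit Types (phi psi : 'rV[R]_n -> R) (x : 'rV[R]_n).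

Lemma pairing_fin_sum (I : finType) (P : pred I) (F : I -> 'rV[R]_n -> R) :
  (forall i, testR (F i)) ->
  pairing g1 g2 (fun x => \sum_(i | P i) F i x) = \sum_(i | P i) pairing g1 g2 (F i).
Proof.
by move=> tF; apply: (pairing_sum p1 alpha_bounds p_le y0 my iy mg1 mg2 g1y g2y) => i _.
Qed.

(** At scale [e], discarding the cells that miss [K] does not change the
    pairing, and [grid_count] leaves at most [C * e `^ (- alpha)] cells of volume
    [e ^+ n]. Both the supremum of the transform and its weighted energy are
    then of order [e `^ (n - alpha)], as [pairing_eq0] asks. *)
Lemma pairing_local_eq0 (K E : set 'rV[R]_n) (C eps : R) psi :
  testR psi -> 0 < eps -> (packing_eps alpha eps E <= C%:E)%E ->
  (forall phi, testR phi -> (forall x, suppR phi x -> ~ K x) -> pairing g1 g2 phi = 0) ->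
  (forall x, suppR psi x -> K x -> closure E x) ->
  pairing g1 g2 psi = 0.
Proof.
move=> tp eps0 PC van sE.
have [B0 bB0] := @derive_bump_bounded R.
pose B := Num.max 1 B0.
have B1 : 1 <= B by rewrite le_max lexx.
have bB u : `|'D_1 (@bump R) u| <= B by rewrite (le_trans (bB0 u))// le_max lexx orbT.
have [B' pB] := testR_partials_le n tp.
have B'0 : 0 <= B' by exact: le_trans (normr_ge0 _) (partials_le_norm 0 pB).
have B_ge0 : 0 <= B by exact: le_trans B1.
have C0 : 0 <= C.
  have := @packing_count _ _ alpha eps C eps E bool finset.set0 (fun=> 0) _ PC.
  rewrite cards0 mul0r; apply; first by rewrite eps0 lexx.
  - by move=> k; rewrite inE.
  - by move=> k k'; rewrite inE.
have [_ [N pN]] := tp.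
pose q := n%:R - alpha.
(* bounds for the supremum of the transform and for its weighted energy, per unit of [e `^ q] *)
pose Q1 := 2 * (B' * (5 ^+ n * C * (2 * B) ^+ n)).
pose Q2 := (2 * pi) ^+ n * ((3 ^+ n * B') ^+ 2 * (3 * B) ^+ n * (5 ^+ n * C * (2 * B) ^+ n)).
have cB : 0 <= 5 ^+ n * C * (2 * B) ^+ n by rewrite !mulr_ge0 ?exprn_ge0 ?mulr_ge0.
have Q10 : 0 <= Q1 by rewrite /Q1 mulr_ge0// mulr_ge0.
have Q20 : 0 <= Q2.
  by rewrite /Q2 mulr_ge0 ?exprn_ge0 ?mulr_ge0 ?sqr_ge0 ?exprn_ge0 ?mulr_ge0 ?pi_ge0.
apply: (pairing_eq0 p1 alpha_bounds p_le y0 my iy mg1 mg2 g1y g2y (K := Q1 + Q2) (e1 := eps)) => //.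
  exact: addr_ge0.
move=> e e01 ee; have /andP[e0 e1] := e01.
have [M NM] := exists_grid_size e N.
pose G := [set k : {ffun 'I_n -> 'I_M.*2.+1} | `[< exists x, [/\ suppR psi x, K x & cell_box e k x] >]]%SET.
have count : #|G|%:R * e ^+ n <= 5 ^+ n * C * e `^ q.
  have := @grid_count _ _ alpha eps C e M E G _ PC; rewrite e0 ee => /(_ isT) H.
  have -> : e ^+ n = e `^ alpha * e `^ q.
    rewrite -powRD; last by rewrite (gt_eqF e0) implybT.
    by rewrite addrC subrK powR_mulrn// ltW.
  rewrite mulrA ler_wpM2r ?powR_ge0//; apply: H => k; rewrite inE => /asboolP[x [sx Kx kx]].
  by exists x => //; exact: sE.
have count2 : #|G|%:R * ((2 * B) ^+ n * e ^+ n) <= 5 ^+ n * C * (2 * B) ^+ n * e `^ q.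
  by rewrite mulrCA (mulrAC _ ((2 * B) ^+ n)) [leRHS]mulrC ler_wpM2l// exprn_ge0// mulr_ge0.
exists (cut_off e psi G); split.
- exact: testR_cut_off.
- rewrite [in LHS](grid_decomposition e0 pN NM) pairing_fin_sum; last by move=> k; exact: testR_cell.
  rewrite /cut_off pairing_fin_sum; last by move=> k; exact: testR_cell.
  rewrite [LHS](bigID (mem G))/= [X in _ + X]big1 ?addr0// => k kG.
  apply: van; first exact: testR_cell.
  move=> x /(suppR_cell) [sx kx] Kx; move/negP: kG; apply.
  by rewrite inE; apply/asboolP; exists x.
- move=> x; apply: (le_trans (transforms_cut_off_le e01 B1 tp pB G x)).
  apply: (@le_trans _ _ (Q1 * e `^ q)); last by rewrite ler_wpM2r ?powR_ge0// lerDl.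
  by rewrite /Q1 -mulrA ler_wpM2l// -mulrA ler_wpM2l.
apply: (le_trans (energy_cut_off_le e01 B1 bB tp pB G)); rewrite lee_fin.
apply: (@le_trans _ _ (Q2 * e `^ q)); last by rewrite ler_wpM2r ?powR_ge0// lerDr.
rewrite /Q2 -[leRHS]mulrA ler_wpM2l ?exprn_ge0 ?mulr_ge0 ?pi_ge0// -[leRHS]mulrA ler_wpM2l//.
by rewrite mulr_ge0 ?sqr_ge0 ?exprn_ge0 ?mulr_ge0.
Qed.

End local_vanishing.

(** * Packing measure and the Baire argument *)

Section packing_pieces.
Context {R : realType} {n : nat}.
Implicit Types (A B E K : set 'rV[R]_n).

Lemma packing_eps_ge0 s eps A : (0 <= packing_eps s eps A :> \bar R)%E.
Proof.
apply: ereal_sup_ubound; exists set0, (fun=> 0), (fun=> 0); rewrite esum_set0; split => //.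
by split => //; exact: trivIset_set0.
Qed.

Lemma packing_eps_nd s A (e1 e2 : R) : e1 <= e2 -> (packing_eps s e1 A <= packing_eps s e2 A)%E.
Proof.
move=> e12; apply: le_ereal_sup => z [D [x [r [[Dxr tD] ->]]]].
exists D, x, r; split => //; split => // k /Dxr[Ax /andP[r0 re]]; split => //.
by rewrite r0 (le_trans re)// ler_wpM2r.
Qed.

Lemma packing_pre_cvg s A : packing_eps s e A @[e --> (0:R)^'+] -->
  ereal_inf ((fun e => packing_eps s e A) @` `]0%R, 1%R[).
Proof.
apply: (@nondecreasing_at_right_cvge _ _ _ (BLeft 1)); first by rewrite bnd_simp.
by move=> x z _ _; exact: packing_eps_nd.
Qed.

Lemma packing_preE s A : packing_pre s A = ereal_inf ((fun e => packing_eps s e A) @` `]0%R, 1%R[).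
Proof. by apply: cvg_lim => //; exact: packing_pre_cvg. Qed.

Lemma packing_pre_ge0 s A : (0 <= packing_pre s A)%E.
Proof.
by rewrite packing_preE; apply: le_ereal_inf_tmp => _ [e _ <-]; exact: packing_eps_ge0.
Qed.

(** The content decreases with the scale, so a finite limit forces a finite
    value at some positive scale. *)
Lemma packing_pre_lty s A : (packing_pre s A < +oo)%E ->
  exists eps, exists2 C : R, 0 < eps & (packing_eps s eps A <= C%:E)%E.
Proof.
rewrite packing_preE => /ereal_inf_lt[_ [eps /= + <-]].
rewrite in_itv/= => /andP[e0 _] fin; exists eps, (fine (packing_eps s eps A)) => //.
by rewrite fineK// ge0_fin_numE// packing_eps_ge0.
Qed.

Lemma packing_measure_lty s E : (packing_measure s E < +oo)%E ->
  exists2 B : nat -> set 'rV[R]_n, E = \bigcup_i B i &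
    forall i, exists eps, exists2 C : R, 0 < eps & (packing_eps s eps (B i) <= C%:E)%E.
Proof.
move=> /ereal_inf_lt[_ [B /= EB <-] fin]; exists B => // i; apply: packing_pre_lty.
apply: le_lt_trans fin.
have H := @nneseries_lim_ge R (fun i => packing_pre s (B i)) xpredT 0 i.+1.
apply: le_trans (H _); last by move=> k _ _; exact: packing_pre_ge0.
rewrite big_nat_recr//= leeDr// sume_ge0// => k _; exact: packing_pre_ge0.
Qed.

(** Baire's theorem on a closed set [K]: nested cubes centred in [K], the
    [i]-th one missing [F i], would have a common point outside every [F i]. *)
Lemma baire_closed K (F : nat -> set 'rV[R]_n) :
  closed K -> K !=set0 -> (forall i, closed (F i)) -> K `<=` \bigcup_i F i ->
  exists i x r, [/\ K x, 0 < r & K `&` ball x r `<=` F i].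
Proof.
move=> cK [x0 Kx0] cF KF; apply/not_existsP => nH.
have H i (c : 'rV[R]_n * R) : exists c' : 'rV[R]_n * R, K c.1 -> 0 < c.2 ->
    [/\ K c'.1, 0 < c'.2, c'.2 <= c.2 / 2, (forall j, `|c'.1 0 j - c.1 0 j| <= c.2 / 2) &
      forall w, F i w -> exists j, c'.2 < `|w 0 j - c'.1 0 j|].
  have [Kc|nKc] := pselect (K c.1); last by exists c.
  have [c0|c0] := ltP 0 c.2; last by exists c.
  have c20 : 0 < c.2 / 2 by rewrite divr_gt0.
  have [z [[Kz cz] nFz]] : exists z, (K `&` ball c.1 (c.2 / 2)) z /\ ~ F i z.
    apply: contra_notP (nH i) => nz; exists c.1, (c.2 / 2); split => // z Kz.
    by apply: contrapT => nFz; apply: nz; exists z.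
  have : nbhs z (~` F i) by apply: open_nbhs_nbhs; split => //; exact: closed_openC.
  move=> /nbhs_ballP[rho /= rho0 zF].
  exists (z, Num.min (rho / 2) (c.2 / 2)) => _ _; split => //=.
  - by rewrite lt_min c20 divr_gt0.
  - by rewrite ge_min lexx orbT.
  - move=> j; have /ball_rVE[_ /(_ j)] := cz.
    by rewrite distrC => /ltW.
  - move=> w Fw; apply: contrapT => nw; apply: (zF w) => //.
    apply/ball_rVE; split => // j; rewrite distrC ltNge; apply/negP => wj.
    apply: nw; exists j; apply: lt_le_trans wj; rewrite gt_min.
    by rewrite ltr_pdivrMr// ltr_pMr// ltr1n.
pose step i c := sval (cid (H i c)).
have stepP i c := svalP (cid (H i c)); rewrite -/(step _ _) in stepP.
pose c := fix c k : 'rV[R]_n * R := if k is i.+1 then step i (c i) else (x0, 1).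
have cP k : K (c k).1 /\ 0 < (c k).2.
  by elim: k => [|k [Kk k0]] //=; have [] := stepP k (c k) Kk k0.
have cS k := stepP k (c k) (cP k).1 (cP k).2.
(* the nested cubes are handled by the endpoints of their sides *)
pose lo k j : R := (c k).1 0 j - (c k).2; pose hi k j : R := (c k).1 0 j + (c k).2.
have mono k m j : (k <= m)%N -> lo k j <= lo m j /\ hi m j <= hi k j.
  elim: m => [|m IH]; first by rewrite leqn0 => /eqP ->.
  rewrite leq_eqVlt => /orP[/eqP ->//|/IH[l1 h1]].
  have [_ _ r1 /(_ j) + _] := cS m; rewrite ler_norml => /andP[d1 d2].
  move: l1 h1 r1 d1 d2; rewrite /lo /hi /= => l1 h1 r1 d1 d2.
  by split; lra.
have lohi k m j : lo k j <= hi m j.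
  have [l1 _] := mono k (maxn k m) j (leq_maxl _ _).
  have [_ h1] := mono m (maxn k m) j (leq_maxr _ _).
  apply: le_trans l1 (le_trans _ h1); rewrite /lo /hi.
  by have [_ c0] := cP (maxn k m); lra.
pose w : 'rV[R]_n := \row_j sup (range (lo ^~ j)).
have wP k j : `|w 0 j - (c k).1 0 j| <= (c k).2.
  have lw : lo k j <= w 0 j.
    rewrite mxE; apply: ub_le_sup; last by exists k.
    by exists (hi 0%N j) => _ [m _ <-]; exact: lohi.
  have wh : w 0 j <= hi k j.
    rewrite mxE; apply: ge_sup; first by exists (lo 0%N j); exists 0%N.
    by move=> _ [m _ <-]; exact: lohi.
  move: lw wh; rewrite /lo /hi ler_norml => ? ?; apply/andP; split; lra.
have rk k : (c k).2 <= k.+1%:R^-1.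
  elim: k => [|k IH]; first by rewrite invr1.
  have [_ _ r1 _ _] := cS k; apply: (le_trans r1).
  apply: (@le_trans _ _ (k.+1%:R^-1 / 2)); first by rewrite ler_wpM2r.
  rewrite -invfM lef_pV2 ?posrE ?mulr_gt0 ?ltr0n// -natrM ler_nat.
  by rewrite muln2 -addnn addSn ltnS leq_addl.
have Kw : K w.
  rewrite (closure_id K).1// => N /nbhs_ballP[e /= e0 eN].
  have [k _ /(_ k (leqnn k)) /= ke] := near_infty_natSinv_lt (PosNum e0).
  exists (c k).1; split; first exact: (cP k).1.
  apply: eN; apply/ball_rVE; split => // j.
  exact: le_lt_trans (wP k j) (le_lt_trans (rk k) ke).
have [i _ Fw] := KF w Kw.
have [_ _ _ _ /(_ w Fw)[j]] := cS i.
by rewrite ltNge => /negP; apply; exact: (wP i.+1 j).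
Qed.

End packing_pieces.

(** * Emptiness of the distributional support *)

Section fourier_pairing.
Context {R : realType} {n : nat}.
Notation mu := (@lebesgue_rV R n).
Implicit Types (phi psi : 'rV[R]_n -> R) (x : 'rV[R]_n).

Definition of_parts phi psi : 'rV[R]_n -> R[i] := fun x => (phi x +i* psi x)%C.

Lemma fourier_of_parts phi psi x :
  mu.-integrable setT (EFin \o phi) -> mu.-integrable setT (EFin \o psi) ->
  fourier (of_parts phi psi) x =
  ((2 * pi) `^ (- (n%:R / 2)) * (cosT phi x + sinT psi x) +i*
   ((2 * pi) `^ (- (n%:R / 2)) * (cosT psi x - sinT phi x)))%C.
Proof.
move=> ip iq; rewrite /fourier; set c := _ `^ _.
rewrite /cintegral.
have -> : \int[mu]_t complex.Re (of_parts phi psi t * expi (- dot t x)) = cosT phi x + sinT psi x.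
  rewrite /cosT /sinT -RintegralD//; [|exact: integrable_mul_cos|exact: integrable_mul_sin].
  by apply: eq_Rintegral => t _; rewrite /of_parts /expi /= cosN sinN; ring.
have -> : \int[mu]_t complex.Im (of_parts phi psi t * expi (- dot t x)) = cosT psi x - sinT phi x.
  rewrite /cosT /sinT -RintegralB//; [|exact: integrable_mul_cos|exact: integrable_mul_sin].
  by apply: eq_Rintegral => t _; rewrite /of_parts /expi /= cosN sinN; ring.
by rewrite /real_complex_def; congr (_ +i* _)%C; rewrite /= mul0r ?subr0 ?addr0.
Qed.

Section with_f.
Variables (p alpha : R) (f : 'rV[R]_n -> R[i]).
Hypothesis p1 : 1 <= p.
Hypothesis alpha_bounds : 0 <= alpha < n%:R.
Hypothesis p_le : p * alpha <= 2 * n%:R.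
Hypothesis fLp : in_Lp p f.

Definition modulus x : R := Normc.normc (f x).
Definition re x : R := complex.Re (f x).
Definition im x : R := complex.Im (f x).
Definition oppre x : R := - re x.

Lemma modulus_ge0 x : 0 <= modulus x.
Proof. by rewrite /modulus /Normc.normc; case: (f x) => a b; exact: sqrtr_ge0. Qed.

Lemma measurable_re : measurable_fun setT re. Proof. by case: fLp => -[]. Qed.
Lemma measurable_im : measurable_fun setT im. Proof. by case: fLp => -[]. Qed.
Lemma measurable_oppre : measurable_fun setT oppre.
Proof. by apply: measurableT_comp => //; exact: measurable_re. Qed.

Lemma measurable_modulus : measurable_fun setT modulus.
Proof.
rewrite (_ : modulus = fun x => Num.sqrt (re x ^+ 2 + im x ^+ 2)).
  have ms : measurable_fun setT (@Num.sqrt R).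
    by apply: continuous_measurable_fun; exact: sqrt_continuous.
  apply: (measurableT_comp ms).
  by apply: measurable_funD; apply: measurable_funX; [exact: measurable_re|exact: measurable_im].
by apply/funext => x; rewrite /modulus /re /im; case: (f x).
Qed.

Lemma re_le_modulus x : `|re x| <= modulus x.
Proof.
rewrite /modulus /re; case: (f x) => a b /=; rewrite -sqrtr_sqr ler_sqrt ?lerDl ?sqr_ge0//.
by rewrite addr_ge0 ?sqr_ge0.
Qed.

Lemma im_le_modulus x : `|im x| <= modulus x.
Proof.
rewrite /modulus /im; case: (f x) => a b /=; rewrite -sqrtr_sqr ler_sqrt ?lerDr ?sqr_ge0//.
by rewrite addr_ge0 ?sqr_ge0.
Qed.

Lemma oppre_le_modulus x : `|oppre x| <= modulus x.
Proof. by rewrite normrN re_le_modulus. Qed.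

Lemma integrable_modulus_pow : mu.-integrable setT (EFin \o (fun x => modulus x `^ p)).
Proof.
have p0 : 0 < p by exact: lt_le_trans ltr01 p1.
apply: ge0_integrable.
- exact: (measurableT_comp (measurable_powR p) measurable_modulus).
- by move=> x; exact: powR_ge0.
case: fLp => _; rewrite /finite_norm unlock => /lty_poweRy H.
apply: le_lt_trans (H _); last by rewrite invr_neq0// gt_eqF.
rewrite le_eqVlt; apply/orP; left; apply/eqP; apply: eq_integral => x _.
by rewrite /= ger0_norm ?modulus_ge0.
Qed.

Lemma integrable_pairing_re phi : testR phi ->
  mu.-integrable setT (EFin \o (fun x => re x * cosT phi x + im x * sinT phi x)).
Proof.
exact: (integrable_pairing p1 alpha_bounds p_le modulus_ge0 measurable_modulus
  integrable_modulus_pow measurable_re measurable_im re_le_modulus im_le_modulus).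
Qed.

Lemma integrable_pairing_im phi : testR phi ->
  mu.-integrable setT (EFin \o (fun x => im x * cosT phi x + oppre x * sinT phi x)).
Proof.
exact: (integrable_pairing p1 alpha_bounds p_le modulus_ge0 measurable_modulus
  integrable_modulus_pow measurable_im measurable_oppre im_le_modulus oppre_le_modulus).
Qed.

(** Testing on [phi + i psi] combines the two real pairings attached to
    [(Re f, Im f)] and [(Im f, - Re f)]; all the estimates are made on these. *)
Lemma distr_fourierE phi psi : testR phi -> testR psi ->
  distr_fourier (regular_distr f) (of_parts phi psi) =
  ((2 * pi) `^ (- (n%:R / 2)) * (pairing re im phi - pairing im oppre psi) +i*
   ((2 * pi) `^ (- (n%:R / 2)) * (pairing im oppre phi + pairing re im psi)))%C.
Proof.
move=> tp tq; have ip := testR_integrable tp; have iq := testR_integrable tq.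
rewrite /distr_fourier /regular_distr /cintegral; set c := _ `^ _.
have i1 := integrable_pairing_re tp; have i2 := integrable_pairing_im tp.
have i3 := integrable_pairing_re tq; have i4 := integrable_pairing_im tq.
congr (_ +i* _)%C; rewrite /pairing.
  rewrite -RintegralB// -RintegralZl//; last exact: (integrableB measurableT i1 i4).
  apply: eq_Rintegral => x _; rewrite fourier_of_parts// -/c /oppre /re /im.
  by case: (f x) => a b /=; ring.
rewrite -RintegralD// -RintegralZl//; last exact: (integrableD measurableT i2 i3).
apply: eq_Rintegral => x _; rewrite fourier_of_parts// -/c /oppre /re /im.
by case: (f x) => a b /=; ring.
Qed.

Lemma pairing_re_local (K E : set 'rV[R]_n) (C eps : R) psi :
  testR psi -> 0 < eps -> (packing_eps alpha eps E <= C%:E)%E ->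
  (forall phi, testR phi -> (forall x, suppR phi x -> ~ K x) -> pairing re im phi = 0) ->
  (forall x, suppR psi x -> K x -> closure E x) -> pairing re im psi = 0.
Proof.
exact: (pairing_local_eq0 p1 alpha_bounds p_le modulus_ge0 measurable_modulus
  integrable_modulus_pow measurable_re measurable_im re_le_modulus im_le_modulus).
Qed.

Lemma pairing_im_local (K E : set 'rV[R]_n) (C eps : R) psi :
  testR psi -> 0 < eps -> (packing_eps alpha eps E <= C%:E)%E ->
  (forall phi, testR phi -> (forall x, suppR phi x -> ~ K x) -> pairing im oppre phi = 0) ->
  (forall x, suppR psi x -> K x -> closure E x) -> pairing im oppre psi = 0.
Proof.
exact: (pairing_local_eq0 p1 alpha_bounds p_le modulus_ge0 measurable_modulus
  integrable_modulus_pow measurable_im measurable_oppre im_le_modulus oppre_le_modulus).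
Qed.

Lemma pairing_re_sum (I : finType) (F : I -> 'rV[R]_n -> R) : (forall i, testR (F i)) ->
  pairing re im (fun x => \sum_i F i x) = \sum_i pairing re im (F i).
Proof.
exact: (pairing_fin_sum p1 alpha_bounds p_le modulus_ge0 measurable_modulus
  integrable_modulus_pow measurable_re measurable_im re_le_modulus im_le_modulus).
Qed.

Lemma pairing_im_sum (I : finType) (F : I -> 'rV[R]_n -> R) : (forall i, testR (F i)) ->
  pairing im oppre (fun x => \sum_i F i x) = \sum_i pairing im oppre (F i).
Proof.
exact: (pairing_fin_sum p1 alpha_bounds p_le modulus_ge0 measurable_modulus
  integrable_modulus_pow measurable_im measurable_oppre im_le_modulus oppre_le_modulus).
Qed.

Let u := distr_fourier (regular_distr f).
Let K := distr_support u.

Lemma suppR_test_function phi (U : set 'rV[R]_n) : testR phi -> suppR phi `<=` U ->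
  test_function U (of_parts phi (fun=> 0)).
Proof.
move=> tp pU; have sE : fun_support (of_parts phi (fun=> 0)) = suppR phi.
  rewrite /fun_support /suppR; congr closure; apply/seteqP; split => x /=;
    by rewrite /of_parts eq_complex/= eqxx andbT.
split; rewrite ?sE//.
- exact/smoothP/testR_smooth.
- by apply/smoothP; exact: smoothR_cst.
- exact: suppR_compact.
Qed.

Lemma test_function_parts (U : set 'rV[R]_n) g : test_function U g ->
  [/\ g = of_parts (fun x => complex.Re (g x)) (fun x => complex.Im (g x)),
    testR (fun x => complex.Re (g x)), testR (fun x => complex.Im (g x)),
    suppR (fun x => complex.Re (g x)) `<=` U & suppR (fun x => complex.Im (g x)) `<=` U].
Proof.
move=> [sr si cg gU].
have Esub (h : 'rV[R]_n -> R) : (forall x, h x != 0 -> g x != 0) -> suppR h `<=` fun_support g.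
  by move=> hg; apply: closureS => x /hg.
have r0 x : complex.Re (g x) != 0 -> g x != 0.
  by apply: contra_neq => ->.
have i0 x : complex.Im (g x) != 0 -> g x != 0.
  by apply: contra_neq => ->.
have [N gN] : exists N, forall x, g x != 0 -> forall i, `|x 0 i| <= N.
  have /compact_bounded[N [_ NA]] := cg.
  have NN : N < `|N| + 1 by rewrite (le_lt_trans (ler_norm _))// ltrDl.
  exists (`|N| + 1) => x gx i.
  have H : `|x| <= `|N| + 1 by apply: (NA _ NN); apply: subset_closure.
  apply: le_trans H; rewrite /Num.norm/= mx_normrE.
  by apply/bigmax_geP; right; exists (0, i).
split.
- by apply/funext => x; rewrite /of_parts; case: (g x).
- split; first exact/smoothP.
  by exists N => x /r0 /gN.
- split; first exact/smoothP.
  by exists N => x /i0 /gN.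
- by apply: subset_trans gU; exact: Esub.
- by apply: subset_trans gU; exact: Esub.
Qed.

Lemma vanishes_onP (U : set 'rV[R]_n) : distr_vanishes_on u U <->
  forall phi, testR phi -> suppR phi `<=` U -> pairing re im phi = 0 /\ pairing im oppre phi = 0.
Proof.
have c0 : (2 * pi) `^ (- (n%:R / 2)) != 0 :> R.
  by rewrite gt_eqF// powR_gt0// mulr_gt0// pi_gt0.
have z1 : pairing re im (fun=> 0) = 0 by exact: pairing0.
have z2 : pairing im oppre (fun=> 0) = 0 by exact: pairing0.
split=> [uU phi tp pU|H g gU].
  have := uU _ (suppR_test_function tp pU); rewrite /u (distr_fourierE tp testR0) z1 z2.
  rewrite subr0 addr0 => /eqP; rewrite eq_complex/= !mulf_eq0 (negbTE c0)/=.
  by move=> /andP[/eqP -> /eqP ->].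
have [-> tr ti rU iU] := test_function_parts gU.
rewrite /u distr_fourierE//.
have [-> ->] := H _ tr rU; have [-> ->] := H _ ti iU.
by rewrite subr0 addr0 mulr0.
Qed.

Lemma closed_distr_support : closed K.
Proof.
rewrite /K /distr_support closedC; apply: bigcup_open => U [].
by [].
Qed.

(** The complement of the support is a union of open sets of vanishing; a test
    function supported there is cut into pieces carried by single ones. *)
Lemma pairing_off_support phi : testR phi -> (forall x, suppR phi x -> ~ K x) ->
  pairing re im phi = 0 /\ pairing im oppre phi = 0.
Proof.
move=> tp pK.
have loc x : suppR phi x -> exists2 U, nbhs x U & forall psi, testR psi -> suppR psi `<=` U ->
    pairing re im psi = 0 /\ pairing im oppre psi = 0.
  move=> /pK /contrapT [U [oU vU] Ux]; exists U; last exact/vanishes_onP.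
  exact: open_nbhs_nbhs.
split.
  apply: (additive_local (T := pairing re im)) => //; first exact: pairing_re_sum.
  by move=> x /loc[U xU UP]; exists U => // psi tq qU; exact: (UP _ tq qU).1.
apply: (additive_local (T := pairing im oppre)) => //; first exact: pairing_im_sum.
by move=> x /loc[U xU UP]; exists U => // psi tq qU; exact: (UP _ tq qU).2.
Qed.

(** A nonempty [K] would, by Baire's theorem, lie in the closure of a single
    piece of finite packing content inside some ball centred in [K]. The
    transform vanishes on that ball, so its centre is not in the support. *)
Lemma distr_support_eq0 (E : set 'rV[R]_n) : K `<=` E -> (packing_measure alpha E < +oo)%E ->
  K = set0.
Proof.
move=> KE /packing_measure_lty[B EB BP]; apply/eqP; apply: contraT => /set0P K0.
have [||i [x [r [Kx r0 KB]]]] := baire_closed (F := fun i => closure (B i)) closed_distr_support K0.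
- by move=> i; exact: closed_closure.
- move=> x /KE; rewrite EB => -[i _ Bix]; exists i => //; exact: subset_closure.
have [eps [C eps0 PC]] := BP i.
exfalso; apply: Kx; exists (ball x r); last exact: ballxx.
split; first exact: ball_open.
apply/vanishes_onP => phi tp pU.
have pB z : suppR phi z -> K z -> closure (B i) z by move=> /pU zr Kz; exact: KB.
split.
  apply: (pairing_re_local tp eps0 PC _ pB) => psi tq qK.
  exact: (pairing_off_support tq qK).1.
apply: (pairing_im_local tp eps0 PC _ pB) => psi tq qK.
exact: (pairing_off_support tq qK).2.
Qed.

End with_f.
End fourier_pairing.

(** * An approximate identity with compactly supported transform *)

Section kernel.
Context {R : realType}.
Notation leb := (@lebesgue_measure R).
Implicit Types s t x e : R.

Lemma vanishing_integrable (a : R -> R) : continuous a ->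
  (forall x, 1 < `|x| -> a x = 0) -> leb.-integrable setT (EFin \o a).
Proof.
move=> ca a0; have [B aB] := continuous_vanishing_bounded ca a0.
have := integrable_bounded_mul (integrable_indic_itv (- 1 : R) 1) (continuous_measurable_fun ca) aB.
apply: eq_integrable => // x _ /=; rewrite indicE.
have [x1|x1] := ltP 1 `|x|; first by rewrite a0// mulr0.
by rewrite mem_set ?mul1r//= in_itv/= -ler_norml.
Qed.

Lemma integrable_bump : leb.-integrable setT (EFin \o (@bump R)).
Proof.
apply: vanishing_integrable; first exact: smooth1_continuous smooth1_bump.
by move=> x /ltW; exact: bump_out.
Qed.

Definition kappa s : R := \int[leb]_t (bump t * cos (s * t)).

Let b1 t : R := 'D_1 (@bump R) t.
Let b2 t : R := 'D_1 b1 t.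
Let sb1 : smooth1 b1. Proof. exact: smooth1_derive smooth1_bump. Qed.
Let sb2 : smooth1 b2. Proof. exact: smooth1_derive sb1. Qed.

Let b1_out t : 1 < `|t| -> b1 t = 0. Proof. exact: derive_bump_out. Qed.

Let b2_out t : 1 < `|t| -> b2 t = 0. Proof. exact: derive_out b1_out t. Qed.

Let ib2 : leb.-integrable setT (EFin \o b2).
Proof. by apply: vanishing_integrable => //; exact: smooth1_continuous. Qed.

(** By two integrations by parts, [kappa s * oneDsqr s] is the cosine transform
    of the difference between the bump and its second derivative. *)
Lemma kappa_decay : exists2 C, 0 <= C & forall s, `|kappa s| <= C / oneDsqr s.
Proof.
have iw : leb.-integrable setT (EFin \o (fun t => bump t - b2 t)).
  exact: (integrableB measurableT integrable_bump ib2).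
exists (\int[leb]_t `|bump t - b2 t|); first by apply: Rintegral_ge0.
move=> s; rewrite ler_pdivlMr ?oneDsqr_gt0//.
have ic (a : R -> R) : leb.-integrable setT (EFin \o a) ->
    leb.-integrable setT (EFin \o (fun t => a t * cos (s * t))).
  by move=> ia; exact: integrable_bounded_mul ia (measurable_cosM s) (fun x => normr_cos_le1 _).
(* the boundary terms of the two integrations: [G] has derivative [(b2 + s ^+ 2 * bump) * cos (s * t)] *)
pose G t := b1 t * cos (s * t) + s * (bump t * sin (s * t)).
have sG : smooth1 G.
  have sc : smooth1 (fun t => cos (s * t + 0)) by apply: smooth1_affine; exact: smooth1_cos.
  have ss : smooth1 (fun t => sin (s * t + 0)) by apply: smooth1_affine; exact: smooth1_sin.
  move=> m; apply: (@eq_ctimes _ _ _ _ _ (fun t => b1 t * cos (s * t + 0) + s * (bump t * sin (s * t + 0)))).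
    by move=> t; rewrite addr0.
  apply: ctimesD; first by apply: ctimesM.
  apply: ctimesM; first exact: ctimes_cst.
  by apply: ctimesM => //; exact: smooth1_bump.
have DG t : 'D_1 G t = b2 t * cos (s * t) + s ^+ 2 * (bump t * cos (s * t)).
  have d0 : is_derive t 1 (@bump R) (b1 t).
    by apply: DeriveDef => //; exact: smooth1_derivable smooth1_bump.
  have d1 : is_derive t 1 b1 (b2 t).
    by apply: DeriveDef => //; exact: smooth1_derivable sb1.
  have dl : is_derive t 1 (fun t => s * t) s.
    by apply: is_derive_eq; rewrite /GRing.scale/= mulr1.
  have dc : is_derive t 1 (fun t => cos (s * t)) (- sin (s * t) * s).
    exact: (@is_derive1_comp _ cos (fun t => s * t) t _ _ (is_derive_cos _) dl).
  have ds : is_derive t 1 (fun t => sin (s * t)) (cos (s * t) * s).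
    exact: (@is_derive1_comp _ sin (fun t => s * t) t _ _ (is_derive_sin _) dl).
  have [_ ->] := is_deriveD (is_deriveM d1 dc) (is_deriveZ s (is_deriveM d0 ds)).
  by rewrite /GRing.scale/=; ring.
have G0 : \int[leb]_t 'D_1 G t = 0.
  apply: (@Rintegral_derive_eq0 _ G 1).
  - exact: smooth1_continuous.
  - by move=> t; exact: smooth1_derivable.
  - exact: smooth1_continuous (smooth1_derive sG).
  - by move=> t t1; rewrite /G b1_out// bump_out ?(ltW t1)// !mul0r mulr0 addr0.
have E : kappa s * oneDsqr s = \int[leb]_t ((bump t - b2 t) * cos (s * t)).
  have : \int[leb]_t (b2 t * cos (s * t) + s ^+ 2 * (bump t * cos (s * t))) = 0.
    by rewrite -[RHS]G0; apply: eq_Rintegral => t _; rewrite DG.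
  rewrite RintegralD//; last 2 first.
  - exact: ic.
  - exact: (integrableZl measurableT _ (ic _ integrable_bump)).
  rewrite RintegralZl//; last exact: ic integrable_bump.
  rewrite -/(kappa s) => H.
  transitivity (\int[leb]_t (bump t * cos (s * t) - b2 t * cos (s * t))); last first.
    by apply: eq_Rintegral => t _; rewrite [RHS]mulrBl.
  rewrite RintegralB//; [|exact: ic integrable_bump|exact: ic].
  rewrite -/(kappa s) /oneDsqr.
  have -> : \int[leb]_t (b2 t * cos (s * t)) = - (s ^+ 2 * kappa s).
    by apply/eqP; rewrite -addr_eq0 H.
  ring.
rewrite -[X in _ * X <= _]ger0_norm ?(ltW (oneDsqr_gt0 _))// -normrM E.
have iwc := ic _ iw.
apply: (le_trans (le_normr_Rintegral measurableT iwc)).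
apply: le_Rintegral => //; [exact: integrable_norm iwc|exact: integrable_norm iw|].
by move=> t _ /=; rewrite normrM -[leRHS]mulr1 ler_wpM2l// normr_cos_le1.
Qed.

Lemma measurable_kappa : measurable_fun setT kappa.
Proof.
apply: (@measurable_Rintegral_damped _ _ _ _ R leb leb abel (@bump R) (fun z => cos (z.1 * z.2))).
- by move=> x; exact: expR_gt0.
- exact: integrable_abel.1.
- rewrite (_ : (fun x => _) = fun s => expR `|s|); last by apply/funext => s; rewrite /abel expRN invrK.
  apply: continuous_measurable_fun => s.
  by apply: continuous_comp; [exact: norm_continuous|exact: continuous_expR].
- exact: integrable_bump.
- by apply: measurable_cosf; apply: measurable_funM; [exact: measurable_fst|exact: measurable_snd].
- by move=> z; exact: normr_cos_le1.
Qed.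

Lemma integrable_kappa : leb.-integrable setT (EFin \o kappa).
Proof.
have [C C0 kC] := kappa_decay.
apply: (@le_integrable _ _ _ leb setT _ _ (fun s => C%:E * ((oneDsqr s)^-1)%:E)%E) => //.
- by apply/measurable_EFinP; exact: measurable_kappa.
- move=> s _; rewrite -EFinM !abse_EFin lee_fin (le_trans (kC s))//; exact: ler_norm.
- exact: (integrableZl measurableT _ integrable_oneDsqrV).
Qed.

(** Abel summation of the inverse Fourier integral at the origin: Fubini's
    theorem, then a dilation. *)
Lemma abel_kappa e : 0 < e ->
  \int[leb]_s (kappa s * abel (e * s)) = \int[leb]_u (bump (e * u) * (2 / oneDsqr u)).
Proof.
move=> e0; have en0 : e != 0 by rewrite gt_eqF.
pose F (z : R * R) := abel (e * z.1) * bump z.2 * cos (z.1 * z.2).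
have mf : measurable_fun [set: measurableTypeR R * measurableTypeR R] (fun z => z.1 : R) by exact: measurable_fst.
have ms : measurable_fun [set: measurableTypeR R * measurableTypeR R] (fun z => z.2 : R) by exact: measurable_snd.
have mb : measurable_fun setT (@bump R) by apply/measurable_EFinP; exact: measurable_int integrable_bump.
have ia := integrable_abelM e0; have ma : measurable_fun setT (fun s => abel (e * s)).
  by apply/measurable_EFinP; exact: measurable_int ia.
have mF : measurable_fun [set: measurableTypeR R * measurableTypeR R] F.
  apply: measurable_funM; first by apply: measurable_funM; [exact: (measurableT_comp ma mf)|exact: (measurableT_comp mb ms)].
  by apply: measurable_cosf; exact: measurable_funM.
have Fab x t : `|F (x, t)| <= abel (e * x) * `|bump t|.
  rewrite /F/= !normrM (ger0_norm (abel_ge0 _)) -[leRHS]mulr1 ler_wpM2l ?normr_cos_le1//.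
  by rewrite mulr_ge0// abel_ge0.
transitivity (\int[leb]_s \int[leb]_t F (s, t)).
  apply: eq_Rintegral => s _; rewrite mulrC /kappa -RintegralZl//; last first.
    exact: integrable_bounded_mul integrable_bump (measurable_cosM s) (fun x => normr_cos_le1 _).
  by apply: eq_Rintegral => t _; rewrite /F/= mulrA.
rewrite (Rfubini mF ia (integrable_norm integrable_bump) Fab).
transitivity (\int[leb]_t (bump t * poisson e t)).
  apply: eq_Rintegral => t _; rewrite -(Rintegral_abelM_cos e0) -RintegralZl//; last first.
    exact: integrable_bounded_mul ia (measurable_cosM t) (fun x => normr_cos_le1 _).
  by apply: eq_Rintegral => s _; rewrite /F/= (mulrC s t); ring.
have ibp : leb.-integrable setT (EFin \o (fun t => bump t * poisson e t)).
  have mp : measurable_fun setT (poisson e) by apply: continuous_measurable_fun; exact: continuous_poisson.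
  apply: (integrable_bounded_mul integrable_bump mp (M := 2 * e^-1)) => t.
  by rewrite ger0_norm ?poisson_ge0// poisson_le.
rewrite -(Rintegral_affine 0 en0 ibp) gtr0_norm// -RintegralZl//; last exact: (integrable_affine 0 en0 ibp).
apply: eq_Rintegral => u _; rewrite addr0 /poisson mulKf//.
by field; rewrite en0 gt_eqF// oneDsqr_gt0.
Qed.

(** The inverse Fourier integral at 0 gives [2 * pi * bump 0], and [bump 0 = 1];
    both sides of [abel_kappa] converge by domination as [e] tends to 0. *)
Lemma integral_kappa : \int[leb]_s kappa s = 2 * pi.
Proof.
pose h k : R := k.+1%:R^-1; have h0 k : 0 < h k by rewrite invr_gt0 ltr0n.
have h_cvg : h @ \oo --> (0 : R) by exact: cvg_harmonic.
have mb : measurable_fun setT (@bump R) by apply/measurable_EFinP; exact: measurable_int integrable_bump.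
have hcvg (a : R -> R) x l : continuous a -> a 0 = l -> (fun k => a (h k * x)) @ \oo --> l.
  move=> ca <-; rewrite -(mul0r x).
  apply: (@cvg_comp _ _ _ (fun k => h k * x) a _ (nbhs (0 * x))); last exact: ca.
  exact: cvgMl.
have L1 : (fun k => \int[leb]_s (kappa s * abel (h k * s))) @ \oo --> \int[leb]_s kappa s.
  apply: (@Rintegral_dominated_cvg _ _ _ leb _ _ (fun s => `|kappa s|)).
  - move=> k; apply: measurable_funM; first exact: measurable_kappa.
    by apply/measurable_EFinP; exact: measurable_int (integrable_abelM (h0 k)).
  - exact: measurable_kappa.
  - apply: aeW => s; rewrite -[X in _ --> X]mulr1; apply: cvgMr; apply: hcvg; first exact: continuous_abel.
    by rewrite /abel normr0 oppr0 expR0.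
  - exact: integrable_norm integrable_kappa.
  - move=> k s; rewrite normrM -[leRHS]mulr1 ler_wpM2l// ger0_norm ?abel_ge0//.
    by rewrite /abel expR_le1 oppr_le0.
have L2 : (fun k => \int[leb]_u (bump (h k * u) * (2 / oneDsqr u))) @ \oo --> \int[leb]_u (2 / oneDsqr u).
  have iw : leb.-integrable setT (EFin \o (fun u => 2 / oneDsqr u)).
    exact: (integrableZl measurableT _ integrable_oneDsqrV).
  have mw : measurable_fun setT (fun u : R => 2 / oneDsqr u) by apply/measurable_EFinP; exact: measurable_int iw.
  apply: (@Rintegral_dominated_cvg _ _ _ leb _ _ (fun u => 2 / oneDsqr u)) => //.
  - move=> k; apply: measurable_funM => //.
    apply: (measurableT_comp mb); exact: measurable_funM.
  - apply: aeW => u; rewrite -[X in _ --> X]mul1r; apply: cvgMl; apply: hcvg; last exact: bump0.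
    exact: smooth1_continuous smooth1_bump.
  - move=> k u; rewrite normrM (ger0_norm (_ : 0 <= 2 / oneDsqr u)); last first.
      by rewrite divr_ge0// ltW// oneDsqr_gt0.
    by rewrite -[leRHS]mul1r ler_wpM2r ?bump_norm_le1// divr_ge0// ltW// oneDsqr_gt0.
have E : (fun k => \int[leb]_s (kappa s * abel (h k * s))) = (fun k => \int[leb]_u (bump (h k * u) * (2 / oneDsqr u))).
  by apply/funext => k; rewrite abel_kappa.
rewrite E in L1; rewrite -(cvg_lim _ L1)// (cvg_lim _ L2)//.
by rewrite RintegralZl ?Rintegral_oneDsqrV//; exact: integrable_oneDsqrV.
Qed.

(** The transform of the dilated bump [bump (e * t)]: an approximate identity of
    width [e], up to the factor [2 * pi]. *)
Definition kern e s : R := e^-1 * kappa (e^-1 * s).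

Lemma Rintegral_bump_cos e v : 0 < e -> \int[leb]_t (bump (e * t) * cos (v * t)) = kern e v.
Proof.
move=> e0; have en0 : e != 0 by rewrite gt_eqF.
have ib : leb.-integrable setT (EFin \o (fun t => bump t * cos ((e^-1 * v) * t))).
  exact: integrable_bounded_mul integrable_bump (measurable_cosM _) (fun x => normr_cos_le1 _).
rewrite /kern /kappa -(Rintegral_affine 0 en0 ib) gtr0_norm// mulKf//.
by apply: eq_Rintegral => t _; rewrite addr0; congr (_ * cos _); field.
Qed.

Lemma Rintegral_bump_sin e v : 0 < e -> \int[leb]_t (bump (e * t) * sin (v * t)) = 0.
Proof.
move=> e0; have en0 : e != 0 by rewrite gt_eqF.
apply: Rintegral_odd => [|t]; last by rewrite !mulrN bump_even sinN mulrN.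
have ib : leb.-integrable setT (EFin \o (fun t => bump (e * t))).
  by apply: eq_integrable (integrable_affine 0 en0 integrable_bump) => // t _; rewrite /= addr0.
exact: integrable_bounded_mul ib (measurable_sinM _) (fun x => normr_sin_le1 _).
Qed.

Lemma measurable_kern e : measurable_fun setT (kern e).
Proof. by apply: measurable_funM => //; apply: (measurableT_comp measurable_kappa); exact: measurable_funM. Qed.

End kernel.

Section window.
Context {R : realType}.
Notation leb := (@lebesgue_measure R).
Variables (a b : R).

Let ind s : R := \1_(`[a, b]%classic) s.

Definition smear e x : R := \int[leb]_s (ind s * kern e (x - s)).

Let V := Num.max `|a| `|b|.

Let ind_V s : ind s != 0 -> `|s| <= V.
Proof.
rewrite /ind indicE; case: (boolP (s \in _)) => [|_]; last by rewrite eqxx.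
rewrite inE/= in_itv/= => /andP[as_ sb] _; rewrite /V le_max.
by have [s0|s0] := leP 0 s; [rewrite ger0_norm//|rewrite ltr0_norm//]; apply/orP; [right|left];
  rewrite ler_normr; apply/orP; [left|right]; lra.
Qed.

Let ind01 s : ind s = 0 \/ ind s = 1.
Proof. by rewrite /ind indicE; case: (_ \in _); [right|left]. Qed.

Let ind_ge0 s : 0 <= ind s. Proof. by case: (ind01 s) => ->. Qed.

Let ind_abs_le1 s : `|ind s| <= 1. Proof. by case: (ind01 s) => ->; rewrite ?normr0 ?normr1. Qed.

Let iind : leb.-integrable setT (EFin \o ind). Proof. exact: integrable_indic_itv. Qed.

Let peetre s x : ind s != 0 -> oneDsqr x <= (2 + 2 * V ^+ 2) * oneDsqr (x - s).
Proof.
move=> /ind_V sV; have s2 : s ^+ 2 <= V ^+ 2.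
  by rewrite -(real_normK (num_real s)) lerXn2r ?nnegrE// (le_trans (normr_ge0 s)).
have := sqr_ge0 (x - 2 * s); have := mulr_ge0 (sqr_ge0 V) (sqr_ge0 (x - s)).
rewrite /oneDsqr; move: s2; rewrite !expr2; nra.
Qed.

Lemma kern_bound C e x s : 0 <= C -> (forall s, `|kappa s| <= C / oneDsqr s) -> 0 < e <= 1 ->
  `|ind s * kern e (x - s)| <= (C * e^-1 * (2 + 2 * V ^+ 2)) * (oneDsqr x)^-1 * ind s.
Proof.
move=> C0 kC /andP[e0 e1]; have [->|ns] := eqVneq (ind s) 0; first by rewrite mul0r mulr0 normr0.
have I1 : ind s = 1 by case: (ind01 s) => // E; rewrite E eqxx in ns.
rewrite I1 mul1r mulr1 /kern normrM gtr0_norm ?invr_gt0// mulrC.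
apply: (@le_trans _ _ ((C / oneDsqr (e^-1 * (x - s))) * e^-1)).
  by rewrite ler_wpM2r// invr_ge0 ltW.
have ei1 : 1 <= e^-1 by rewrite invr_ge1 ?unitfE ?gt_eqF.
have H : (oneDsqr (e^-1 * (x - s)))^-1 <= (2 + 2 * V ^+ 2) * (oneDsqr x)^-1.
  rewrite ler_pdivlMr ?oneDsqr_gt0// mulrC ler_pdivrMr ?oneDsqr_gt0//.
  apply: (le_trans (peetre x ns)); rewrite ler_wpM2l//.
    by rewrite addr_ge0// mulr_ge0// sqr_ge0.
  rewrite /oneDsqr lerD2l exprMn ler_peMl ?sqr_ge0//.
  by rewrite -[leLHS](expr1n _ 2) lerXn2r ?nnegrE// ltW// invr_gt0.
rewrite [leLHS](_ : _ = C * e^-1 * (oneDsqr (e^-1 * (x - s)))^-1); last by ring.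
by rewrite -[leRHS]mulrA ler_wpM2l// mulr_ge0// invr_ge0 ltW.
Qed.

Lemma measurable_kern_window e :
  measurable_fun [set: measurableTypeR R * measurableTypeR R] (fun z => ind z.2 * kern e (z.1 - z.2)).
Proof.
have mf : measurable_fun [set: measurableTypeR R * measurableTypeR R] (fun z => z.1 : R) by exact: measurable_fst.
have ms : measurable_fun [set: measurableTypeR R * measurableTypeR R] (fun z => z.2 : R) by exact: measurable_snd.
have mi : measurable_fun setT ind by apply/measurable_EFinP; exact: measurable_int iind.
apply: measurable_funM; first exact: (measurableT_comp mi ms).
by apply: (measurableT_comp (measurable_kern e)); exact: measurable_funB.
Qed.

Lemma measurable_smear e : 0 < e <= 1 -> measurable_fun setT (smear e).
Proof.
move=> e01; have [C C0 kC] := @kappa_decay R.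
have ia : leb.-integrable setT (EFin \o (fun x => (C * e^-1 * (2 + 2 * V ^+ 2)) * (oneDsqr x)^-1)).
  exact: (integrableZl measurableT _ integrable_oneDsqrV).
have H := @integrable_Rintegral_section1 _ _ _ _ R leb leb (fun z => ind z.2 * kern e (z.1 - z.2))
  _ ind (measurable_kern_window e) ia iind (fun x s => kern_bound x s C0 kC e01).
by apply/measurable_EFinP; exact: measurable_int H.
Qed.

Lemma integrable_kern e x : 0 < e -> leb.-integrable setT (EFin \o (fun s => kern e (x - s))) /\
  \int[leb]_s `|kern e (x - s)| = \int[leb]_s `|kappa s|.
Proof.
move=> e0; have en0 : - e^-1 != 0 by rewrite oppr_eq0 invr_eq0 gt_eqF.
have E s : kern e (x - s) = e^-1 * kappa (- e^-1 * s + e^-1 * x).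
  by rewrite /kern; congr (_ * kappa _); ring.
have i1 := integrable_affine (e^-1 * x) en0 integrable_kappa.
split; first by apply: eq_integrable (integrableZl measurableT e^-1 i1) => // s _ /=; rewrite E.
have ink := integrable_norm (@integrable_kappa R).
rewrite -(Rintegral_affine (e^-1 * x) en0 ink) normrN gtr0_norm ?invr_gt0// -RintegralZl//; last first.
  exact: (integrable_affine _ en0 ink).
by apply: eq_Rintegral => s _; rewrite E normrM gtr0_norm ?invr_gt0.
Qed.

Lemma integrable_window e x : 0 < e ->
  leb.-integrable setT (EFin \o (fun s => ind s * kern e (x - s))).
Proof.
move=> e0; have [ik _] := integrable_kern x e0.
have mi : measurable_fun setT ind by apply/measurable_EFinP; exact: measurable_int iind.
have i1 := integrable_bounded_mul ik mi (M := 1) ind_abs_le1.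
by apply: eq_integrable i1 => // s _ /=; rewrite mulrC.
Qed.

(** The decay must be uniform in [e]. Multiplying by [oneDsqr (x - s)] costs only
    a constant on the interval ([peetre]); of the two terms it creates, the
    first is bounded by the norm of the kernel, and in the second the factor
    [(x - s) ^+ 2] is absorbed by the quadratic decay of [kappa]. *)
Lemma smear_bound : exists2 D, 0 <= D & forall e x, 0 < e <= 1 -> `|smear e x| <= D * (oneDsqr x)^-1.
Proof.
have [C C0 kC] := @kappa_decay R.
pose Q := 2 + 2 * V ^+ 2; have Q0 : 0 <= Q by rewrite addr_ge0// mulr_ge0// sqr_ge0.
exists (Q * (\int[leb]_s `|kappa s| + C * \int[leb]_s ind s)).
  by rewrite mulr_ge0// addr_ge0 ?mulr_ge0 ?Rintegral_ge0.
move=> e x e01; have /andP[e0 e1] := e01.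
have [ik Ek] := integrable_kern x e0; have ink := integrable_norm ik.
have ii := integrable_window x e0.
rewrite ler_pdivlMr ?oneDsqr_gt0// mulrC -[X in X * _]ger0_norm ?(ltW (oneDsqr_gt0 _))//.
rewrite -normrM /smear -RintegralZl//.
have iZ : leb.-integrable setT (EFin \o (fun s => oneDsqr x * (ind s * kern e (x - s)))).
  exact: (integrableZl measurableT _ ii).
apply: (le_trans (le_normr_Rintegral measurableT iZ)).
rewrite -Ek -RintegralZl// -RintegralD//; last exact: (integrableZl measurableT _ iind).
have iS : leb.-integrable setT (EFin \o (fun s => `|kern e (x - s)| + C * ind s)).
  exact: (integrableD measurableT ink (integrableZl measurableT C iind)).
rewrite -RintegralZl//; apply: le_Rintegral => //.
- exact: integrable_norm iZ.
- exact: (integrableZl measurableT _ iS).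
move=> s _ /=; have [->|ns] := eqVneq (ind s) 0.
  by rewrite mul0r mulr0 normr0 mulr0 addr0 mulr_ge0.
have I1 : ind s = 1 by case: (ind01 s) => // E; rewrite E eqxx in ns.
rewrite I1 mul1r mulr1 normrM (ger0_norm (ltW (oneDsqr_gt0 _))).
apply: (@le_trans _ _ (Q * oneDsqr (x - s) * `|kern e (x - s)|)).
  by rewrite ler_wpM2r//; exact: peetre.
rewrite -mulrA ler_wpM2l// {1}/oneDsqr mulrDl mul1r lerD2l.
rewrite /kern normrM gtr0_norm ?invr_gt0//.
have k := kC (e^-1 * (x - s)).
apply: (@le_trans _ _ ((x - s) ^+ 2 * (e^-1 * (C / oneDsqr (e^-1 * (x - s)))))).
  by rewrite ler_wpM2l ?sqr_ge0// ler_wpM2l// invr_ge0 ltW.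
move: (x - s) => z {k}.
have w0 := oneDsqr_gt0 (e^-1 * z).
rewrite [leLHS](_ : _ = C * ((e^-1 * z ^+ 2) / oneDsqr (e^-1 * z))); last by ring.
rewrite -[leRHS]mulr1 ler_wpM2l// ler_pdivrMr// mul1r /oneDsqr.
have ei1 : 1 <= e^-1 by rewrite invr_ge1 ?unitfE ?gt_eqF.
rewrite exprMn (expr2 e^-1) -[leLHS]add0r lerD// ler_wpM2r ?sqr_ge0//.
by rewrite ler_peMl// invr_ge0 ltW.
Qed.

(** After the substitution [s = x - h u] the kernel no longer moves, and the
    indicator is constant near [x]. *)
Lemma smear_cvg x : x != a -> x != b ->
  (fun k : nat => smear k.+1%:R^-1 x) @ \oo --> 2 * pi * ind x.
Proof.
move=> xa xb; pose h k : R := k.+1%:R^-1; have h0 k : 0 < h k by rewrite invr_gt0 ltr0n.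
have mi : measurable_fun setT ind by apply/measurable_EFinP; exact: measurable_int iind.
have E : (fun k : nat => smear (h k) x) = fun k => \int[leb]_u (ind (- h k * u + x) * kappa u).
  apply/funext => k; have en0 : - h k != 0 by rewrite oppr_eq0 gt_eqF.
  have [ik _] := integrable_kern x (h0 k).
  have ii : leb.-integrable setT (EFin \o (fun s => kern (h k) (x - s) * ind s)).
    exact: integrable_bounded_mul ik mi ind_abs_le1.
  rewrite /smear; transitivity (\int[leb]_s (kern (h k) (x - s) * ind s)).
    by apply: eq_Rintegral => s _; rewrite mulrC.
  rewrite -(Rintegral_affine x en0 ii) normrN gtr0_norm// -RintegralZl//; last exact: (integrable_affine x en0 ii).
  apply: eq_Rintegral => u _; rewrite /kern.
  have -> : (h k)^-1 * (x - (- h k * u + x)) = u by field; rewrite gt_eqF.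
  by rewrite -mulrA mulVKf ?gt_eqF// mulrC.
rewrite [X in X @ _](E) -integral_kappa mulrC -RintegralZl//; last exact: integrable_kappa.
apply: (@Rintegral_dominated_cvg _ _ _ leb _ _ (fun u => `|kappa u|)).
- move=> k; apply: measurable_funM; last exact: measurable_kappa.
  by apply: (measurableT_comp mi); apply: measurable_funD => //; exact: measurable_funM.
- by apply: measurable_funM => //; exact: measurable_kappa.
- apply: aeW => u; apply: cvgMl.
  have hc : (fun k => - h k * u + x) @ \oo --> x.
    rewrite -[X in _ --> X]add0r -(mul0r u); apply: cvgD; last exact: cvg_cst.
    by apply: cvgMl; rewrite -oppr0; apply: cvgN; exact: cvg_harmonic.
  apply: (cvg_near_cst (ind x)).
  suff : \forall z \near x, ind z = ind x by move=> /hc.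
  have [xin|xout] := boolP (x \in `]a, b[).
    have : \forall z \near x, z \in `]a, b[ by exact: near_in_itvoo.
    apply: filterS => z zab; rewrite /ind !indicE !mem_set//=; exact: subset_itv_oo_cc.
  have Z z : z < a \/ b < z -> ind z = 0.
    rewrite /ind indicE => zab; rewrite memNset//= in_itv/= => /andP[az zb].
    by case: zab; rewrite ltNge ?az ?zb.
  have [xa1|ax] := ltP x a.
    near=> z; rewrite !Z//; left => //; near: z; exact: lt_nbhsl.
  have bx : b < x.
    rewrite lt_neqAle eq_sym xb/= leNgt; apply: contra xout => xb1.
    by rewrite in_itv/= xb1 lt_neqAle eq_sym xa ax.
  near=> z; rewrite !Z//; right => //; near: z; exact: lt_nbhsr.
- exact: integrable_norm (@integrable_kappa R).
- move=> k u; rewrite normrM -[leRHS]mul1r ler_wpM2r// ger0_norm//.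
Unshelve. all: by end_near.
Qed.

End window.

(** * Functions with vanishing integrals over boxes *)

Section boxes.
Context {R : realType} {n : nat}.
Notation mu := (lebesgue_rV R n).
Implicit Types a b : 'I_n -> R.

Definition cbox a b : set 'rV[R]_n := [set x | forall i, `[a i, b i]%classic (x 0 i)].

Definition cbox_ind a b : 'rV[R]_n -> R := tensor (fun i => \1_(`[a i, b i]%classic)).

Lemma cbox_indE a b : cbox_ind a b = \1_(cbox a b).
Proof.
apply/funext => x; rewrite indicE /cbox_ind /tensor; have [xab|xab] := pselect (cbox a b x).
  by rewrite mem_set// big1// => i _; rewrite indicE mem_set//; exact: xab.
rewrite memNset//; have /existsNP[i xi] : ~ (forall i, `[a i, b i]%classic (x 0 i)) by [].
by rewrite (bigD1 i)//= indicE memNset// mul0r.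
Qed.

Lemma measurable_cbox a b : measurable (cbox a b).
Proof. by apply: (@measurable_box R n (fun i => `[a i, b i]%classic)) => i; exact: measurable_itv. Qed.

Lemma cboxI a b a' b' : cbox a b `&` cbox a' b' =
  cbox (fun i => Num.max (a i) (a' i)) (fun i => Num.min (b i) (b' i)).
Proof.
apply/seteqP; split => [x [xab xab'] i|x xI].
  move: (xab i) (xab' i); rewrite /= !in_itv/= => /andP[? ?] /andP[? ?].
  by rewrite ge_max le_min; apply/andP; split; apply/andP.
by split => i; move: (xI i); rewrite /= !in_itv/= ge_max le_min => /andP[/andP[? ?] /andP[? ?]];
  apply/andP.
Qed.

Definition cboxes : set (set 'rV[R]_n) := [set A | exists a b, A = cbox a b].

Lemma cboxes_setI : setI_closed cboxes.
Proof. by move=> _ _ [a [b ->]] [a' [b' ->]]; rewrite cboxI; do 2 eexists. Qed.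

(** A half-space [x 0 i >= c] is the union of the boxes that bound the other
    coordinates by [N]; such half-spaces generate the coordinate
    sigma-algebra. *)
Lemma measurable_cboxesE : (measurable : set (set 'rV[R]_n)) = <<s cboxes >>.
Proof.
apply/seteqP; split; last first.
  apply: smallest_sub; first exact: sigma_algebra_measurable.
  by move=> _ [a [b ->]]; exact: measurable_cbox.
have : measurable_fun setT (idfun : g_sigma_algebraType cboxes -> 'rV[R]_n).
  apply/measurable_fun_coordP => i.
  apply: (measurability _ (@RGenCInfty.measurableE R)) => _ [_ [c ->] <-].
  rewrite setTI (_ : _ @^-1` _ =
    \bigcup_N cbox (fun j => if j == i then c else - N%:R) (fun=> N%:R)).
    apply: bigcup_measurable => N _; apply: sub_sigma_algebra; by do 2 eexists.
  apply/seteqP; split => [x|x [N _ /(_ i)]] /=.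
    rewrite in_itv/= andbT => cx.
    have [N xN] : exists N : nat, forall j, `|x 0 j| <= N%:R.
      exists (Num.trunc (\sum_j `|x 0 j|)).+1 => j.
      apply: (@le_trans _ _ (\sum_j `|x 0 j|)); last exact/ltW/truncnS_gt.
      by rewrite (bigD1 j)//= lerDl sumr_ge0.
    exists N => // j /=; rewrite in_itv/=; move: (xN j); rewrite ler_norml => /andP[x1 x2].
    by case: eqP => [E|_]; rewrite x2 andbT// E.
  by rewrite eqxx !in_itv/= andbT => /andP[].
by move=> m A mA; have := m measurableT A mA; rewrite setTI.
Qed.

(** The sets over which [g], cut off to a large box, has integral zero form a
    lambda-system, and boxes are a pi-system that generates. *)
Lemma cbox_integrals_eq0 (g : 'rV[R]_n -> R) : measurable_fun setT g ->
  (forall N, mu.-integrable setT (EFin \o (fun x => box_ind N x * g x))) ->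
  (forall a b, \int[mu]_x (cbox_ind a b x * g x) = 0) ->
  {ae mu, forall x, g x = 0}.
Proof.
move=> mg ig g0.
have H (N : nat) : {ae mu, forall x, setT x -> (box_ind N%:R x * g x)%:E = 0%E}.
  pose h := fun x => (box_ind N%:R x * g x)%:E.
  have ih A : measurable A -> mu.-integrable A h.
    by move=> mA; apply: integrableS (ig N%:R).
  have mh A : measurable A -> measurable_fun A h by move=> mA; exact: measurable_int (ih _ mA).
  apply: (@integral_ae_eq _ _ _ mu setT measurableT (cst 0%E) h (ih _ measurableT)) => // A _ mA.
  rewrite integral0.
  have B a b : (\int[mu]_(x in cbox a b) h x = 0)%E.
    pose F x := cbox_ind (fun i => Num.max (a i) (- N%:R)) (fun i => Num.min (b i) N%:R) x * g x.
    have E : h \_ (cbox a b) = EFin \o F.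
      apply/funext => x; rewrite patchE /h/= /F cbox_indE -cboxI indicI/= -(cbox_indE (fun=> - N%:R)) indicE.
      by case: ifP => _; rewrite ?mul1r ?mul0r.
    have iF : mu.-integrable setT (EFin \o F).
      by rewrite -E; apply/(integrable_mkcond h (measurable_cbox a b)).1; exact: ih (measurable_cbox a b).
    rewrite integral_mkcond E -[LHS]fineK ?integrable_fin_num//.
    by congr EFin; exact: g0.
  (* [h] vanishes outside one of the boxes, so its whole integral is an integral over a box *)
  have T0 : (\int[mu]_x h x = 0)%E.
    rewrite -(B (fun=> - N%:R) (fun=> N%:R)) [RHS]integral_mkcond.
    apply: eq_integral => x _; rewrite patchE; case: ifP => // xN.
    by rewrite /h /box_ind -/(cbox_ind _ _) cbox_indE indicE xN mul0r.
  move: A mA; rewrite measurable_cboxesE; apply: dynkin_induction => //.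
  - exact: measurable_cboxesE.
  - exact: cboxes_setI.
  - by move=> _ [a [b ->]].
  - move=> A mA hA; move: T0; rewrite -(setUCr A) (integral_setU _ mA (measurableC mA))//.
    + by rewrite hA add0e.
    + by rewrite setUCr; exact: mh.
    + by apply/disj_setPS => x [].
  - move=> F mF tF F0; rewrite integral_bigcup//; last by apply: ih; exact: bigcup_measurable.
    by rewrite eseries0.
have := ae_foralln H; apply: filterS => x Hx.
have := Hx (Num.trunc (\sum_j `|x 0 j|)).+1 I.
rewrite box_ind1 ?mul1r => [[]//|j].
apply: (@le_trans _ _ (\sum_j `|x 0 j|)); last exact/ltW/truncnS_gt.
by rewrite (bigD1 j)//= lerDl sumr_ge0.
Qed.

End boxes.

(** * Deconvolution *)

Section kernel_tests.
Context {R : realType} {n : nat}.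
Notation mu := (@lebesgue_rV R n).
Notation leb := (@lebesgue_measure R).
Implicit Types (x v z : 'rV[R]_n).

Definition dilated_bump (e : R) : 'rV[R]_n -> R := tensor (fun _ t => bump (e * t)).

Definition tensor_kern (e : R) : 'rV[R]_n -> R := tensor (fun _ => kern e).

Lemma testR_dilated_bump e : 0 < e -> testR (dilated_bump e).
Proof.
move=> e0; split.
  apply: smoothR_tensor => _ m; apply: (eq_ctimes _ (smooth1_affine e 0 smooth1_bump m)) => t.
  by rewrite addr0.
exists e^-1 => x fx i; rewrite leNgt; apply: contra_neqN fx => xi.
rewrite /dilated_bump /tensor (bigD1 i)//= bump_out ?mul0r// normrM gtr0_norm//.
by rewrite -ler_pdivrMl// mulr1 ltW.
Qed.

Lemma dilated_bump_cos e z : 0 < e ->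
  \int[mu]_t (dilated_bump e t * cos (dot t z)) = tensor_kern e z /\
  \int[mu]_t (dilated_bump e t * sin (dot t z)) = 0.
Proof.
move=> e0; have [||Ec Es] := @trig_tensor R n (fun _ s => bump (e * s)) z.
- move=> i; have := integrable_affine 0 (lt0r_neq0 e0) (@integrable_bump R).
  by apply: eq_integrable => // t _; rewrite /= addr0.
- by move=> i; exact: Rintegral_bump_sin.
split; last exact: Es.
by rewrite Ec; apply: eq_bigr => i _; rewrite Rintegral_bump_cos// mxE.
Qed.

(** The two tests are the real and imaginary parts of a bump modulated by
    [v]; modulation translates the transform, and the kernel is real. *)
Lemma modulated_transform e v x (phi := dilated_bump e) : 0 < e ->
  cosT (fun t => phi t * cos (dot t v)) x + sinT (fun t => phi t * sin (dot t v)) x =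
    tensor_kern e (x - v) /\
  sinT (fun t => phi t * cos (dot t v)) x - cosT (fun t => phi t * sin (dot t v)) x = 0.
Proof.
move=> e0; have tp := testR_dilated_bump e0.
have [Ec Es] := dilated_bump_cos (x - v) e0.
have tc : testR (fun t => phi t * cos (dot t v)).
  by apply: testRM => //; apply: smoothR_dot; exact: smooth1_cos.
have ts : testR (fun t => phi t * sin (dot t v)).
  by apply: testRM => //; apply: smoothR_dot; exact: smooth1_sin.
have dB t : dot t (x - v) = dot t x - dot t v by rewrite dotC dotBl !(dotC t).
rewrite -Ec -Es /cosT /sinT; split.
- rewrite -RintegralD//; [|exact: integrable_mul_cos (testR_integrable tc)
    |exact: integrable_mul_sin (testR_integrable ts)].
  by apply: eq_Rintegral => t _; rewrite dB cosB /phi; ring.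
- rewrite -RintegralB//; [|exact: integrable_mul_sin (testR_integrable tc)
    |exact: integrable_mul_cos (testR_integrable ts)].
  by apply: eq_Rintegral => t _; rewrite dB sinB /phi; ring.
Qed.

End kernel_tests.

Section deconvolution.
Context {R : realType} {n : nat}.
Notation mu := (@lebesgue_rV R n).
Notation leb := (@lebesgue_measure R).
Implicit Types (x v z : 'rV[R]_n) (w : 'rV[R]_n -> R).
Variables (p : R) (g y : 'rV[R]_n -> R).
Hypothesis p1 : 1 <= p.
Hypothesis iy : mu.-integrable setT (EFin \o (fun x => y x `^ p)).
Hypothesis mg : measurable_fun setT g.
Hypothesis gy : forall x, `|g x| <= y x.

(** Where [|g| <= 1] the product is at most [w], elsewhere at most [y `^ p]. *)
Lemma integrable_mul_Lp w : mu.-integrable setT (EFin \o w) -> (forall x, 0 <= w x <= 1) ->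
  mu.-integrable setT (EFin \o (fun x => w x * g x)).
Proof.
move=> iw w01; have iD := integrableD measurableT iw iy.
apply: (le_integrable measurableT _ _ iD).
  apply/measurable_EFinP; apply: measurable_funM => //.
  by apply/measurable_EFinP; exact: measurable_int iw.
move=> x _; rewrite /= lee_fin; have /andP[w0 w1] := w01 x.
rewrite [leRHS]ger0_norm ?addr_ge0 ?powR_ge0// normrM (ger0_norm w0).
have [g1|g1] := leP `|g x| 1.
  by apply: (@le_trans _ _ (w x)); [rewrite ler_piMr|rewrite lerDl powR_ge0].
apply: (@le_trans _ _ (y x `^ p)); last by rewrite lerDr.
have y1 : 1 <= y x by rewrite (le_trans (ltW g1)).
apply: (@le_trans _ _ (y x)); first by rewrite (le_trans _ (gy x))// ler_piMl.
by rewrite -[leLHS]powRr1 ?ler_powR// (le_trans (normr_ge0 _) (gy x)).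
Qed.

Variables a b : 'I_n -> R.

Let W : 'rV[R]_n -> R := tensor (fun _ s => (oneDsqr s)^-1).

Let W01 x : 0 <= W x <= 1.
Proof.
rewrite /W /tensor; apply/andP; split; first by apply: prodr_ge0 => i _; rewrite invr_ge0 ltW ?oneDsqr_gt0.
apply: prodr_ile1 => i _; rewrite invr_ge0 ltW ?oneDsqr_gt0//=.
by rewrite invf_le1 ?oneDsqr_gt0// oneDsqr_ge1.
Qed.

Let iW : mu.-integrable setT (EFin \o W).
Proof. by apply: (integral_tensor _).1 => i; exact: integrable_oneDsqrV. Qed.

Let igW : mu.-integrable setT (EFin \o (fun x => W x * `|g x|)).
Proof.
have := integrable_norm (integrable_mul_Lp iW W01); apply: eq_integrable => // x _ /=.
by rewrite normrM ger0_norm//; case/andP: (W01 x).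
Qed.

(** Integrating the hypothesis over [v] in the box and exchanging the integrals
    convolves the kernel with the indicator of the box. *)
Lemma Rintegral_smear e : 0 < e <= 1 ->
  (forall v, \int[mu]_x (g x * tensor_kern e (x - v)) = 0) ->
  \int[mu]_x (g x * \prod_i smear (a i) (b i) e (x 0 i)) = 0.
Proof.
move=> e01 H; have /andP[e0 e1] := e01; have [C C0 kC] := @kappa_decay R.
pose F (z : 'rV[R]_n * 'rV[R]_n) := g z.1 *
  \prod_i (\1_(`[a i, b i]%classic) (z.2 0 i) * kern e (z.1 0 i - z.2 0 i)).
pose M := \prod_i (C * e^-1 * (2 + 2 * (Num.max `|a i| `|b i|) ^+ 2)).
have ib : mu.-integrable setT (EFin \o (fun v => M * cbox_ind a b v)).
  apply: (integrableZl measurableT _ ((integral_tensor _).1)) => i.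
  exact: integrable_indic_itv.
have Fab x v : `|F (x, v)| <= (W x * `|g x|) * (M * cbox_ind a b v).
  rewrite /F normrM /= [leRHS](_ : _ = `|g x| * (M * W x * cbox_ind a b v)); last by ring.
  rewrite ler_wpM2l// normr_prod /M /W /cbox_ind /tensor -!big_split/=.
  by apply: ler_prod => i _; rewrite normr_ge0/=; exact: kern_bound.
have mF : measurable_fun setT F.
  apply: measurable_funM; first exact: (measurableT_comp mg measurable_fst).
  apply: measurable_prod => i _.
  apply: (measurableT_comp (measurable_kern_window (a i) (b i) e)
    (g := fun z : 'rV[R]_n * 'rV[R]_n => (z.1 0 i : measurableTypeR R, z.2 0 i : measurableTypeR R))).
  apply: measurable_fun_pair.
    exact: (measurableT_comp (@measurable_coord _ _ n i) measurable_fst).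
  exact: (measurableT_comp (@measurable_coord _ _ n i) measurable_snd).
transitivity (\int[mu]_x \int[mu]_v F (x, v)).
  apply: eq_Rintegral => x _; rewrite /F /=.
  have [iT ET] := @integral_tensor R n
    (fun i s => \1_(`[a i, b i]%classic) s * kern e (x 0 i - s))
    (fun i => integrable_window (a i) (b i) (x 0 i) e0).
  by rewrite -[X in _ * X]ET -RintegralZl.
rewrite (Rfubini mF igW ib Fab).
transitivity (\int[mu]_v (0 : R)); last by rewrite Rintegral_cst// mul0r.
apply: eq_Rintegral => v _.
transitivity (\int[mu]_x (cbox_ind a b v * (g x * tensor_kern e (x - v)))).
  apply: eq_Rintegral => x _; rewrite /F/= big_split/= /cbox_ind /tensor_kern /tensor.
  by rewrite mulrCA; congr (_ * (_ * _)); apply: eq_bigr => i _; rewrite !mxE.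
rewrite cbox_indE indicE; case: (_ \in _).
  by rewrite -[RHS](H v); apply: eq_Rintegral => x _; rewrite mul1r.
transitivity (\int[mu]_x (0 : R)); last by rewrite Rintegral_cst// mul0r.
by apply: eq_Rintegral => x _; rewrite mul0r.
Qed.

(** The scale tends to 0 along [1 / (k + 1)]; the smoothed indicators converge
    off the hyperplanes that carry the faces of the box, a null set. *)
Lemma Rintegral_cbox_eq0 :
  (forall e v, 0 < e <= 1 -> \int[mu]_x (g x * tensor_kern e (x - v)) = 0) ->
  \int[mu]_x (cbox_ind a b x * g x) = 0.
Proof.
move=> H; have /choice[D DP] i : exists D : R, 0 <= D /\ forall e s : R, 0 < e <= 1 ->
    `|smear (a i) (b i) e s| <= D * (oneDsqr s)^-1.
  by have [D D0 DD] := smear_bound (a i) (b i); exists D.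
pose h k : R := k.+1%:R^-1.
have h01 k : 0 < h k <= 1 by rewrite invr_gt0 ltr0n/= invf_le1 ?ltr0n// ler1n.
pose f_ k x := g x * \prod_i smear (a i) (b i) (h k) (x 0 i).
have lim0 : (fun k => \int[mu]_x f_ k x) @ \oo --> \int[mu]_x (g x * \prod_(i < n) (2 * pi * \1_(`[a i, b i]%classic) (x 0 i))).
  apply: (@Rintegral_dominated_cvg _ _ _ mu _ _ (fun x => (\prod_i D i) * (W x * `|g x|))).
  - move=> k; apply: measurable_funM => //; apply: measurable_prod => i _.
    by apply: (measurableT_comp (measurable_smear (a i) (b i) (h01 k))); exact: measurable_coord.
  - apply: measurable_funM => //; apply: measurable_prod => i _; apply: measurable_funM => //.
    have mi : measurable_fun setT (\1_(`[a i, b i]%classic) : R -> R).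
      by apply/measurable_EFinP; exact: measurable_int (integrable_indic_itv (a i) (b i)).
    by apply: (measurableT_comp mi); exact: measurable_coord.
  - have off i : {ae mu, forall x, x 0 i != a i /\ x 0 i != b i}.
      have N c : {ae mu, forall x, x 0 i != c}.
        exists ((fun x : 'rV[R]_n => x 0 i) @^-1` [set c]); split.
        + by rewrite -[X in measurable X]setTI; exact: (@measurable_coord _ _ n i measurableT [set c] (measurable_set1 c)).
        + exact: hyperplane_null.
        + by move=> x /= /negP; rewrite negbK => /eqP.
      by apply: filterS2 (N (a i)) (N (b i)) => x xa xb; split.
    apply: filterS (filter_forall _ off) => x xab.
    apply: cvgMr; apply: cvg_prod => i; apply: smear_cvg; by have [] := xab i.
  - exact: (integrableZl measurableT _ igW).
  - move=> k x; rewrite /f_ normrM normr_prod [leRHS](_ : _ = `|g x| * ((\prod_i D i) * W x)); last by ring.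
    rewrite ler_wpM2l// /W /tensor -big_split/=.
    by apply: ler_prod => i _; rewrite normr_ge0/=; exact: (DP i).2.
have E k : \int[mu]_x f_ k x = 0 by apply: Rintegral_smear => // v; exact: H.
move: lim0; rewrite (_ : (fun k => _) = fun=> 0); last exact/funext.
move=> L; have I0 := cvg_unique (@norm_hausdorff _ R) L (cvg_cst 0).
have c0 : (2 * pi) ^+ n != 0 :> R by rewrite expf_neq0// mulf_neq0// gt_eqF// pi_gt0.
have iC : mu.-integrable setT (EFin \o (fun x => cbox_ind a b x * g x)).
  apply: integrable_mul_Lp => [|x].
    by apply: (integral_tensor _).1 => i; exact: integrable_indic_itv.
  by rewrite cbox_indE indicE; case: (_ \in _); rewrite lexx ler01.
apply: (mulfI c0); rewrite mulr0 -[RHS]I0 -RintegralZl//; apply: eq_Rintegral => x _.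
by rewrite big_split/= prodr_const card_ord /cbox_ind /tensor; ring.
Qed.

End deconvolution.

Section deconvolution_ae.
Context {R : realType} {n : nat}.
Notation mu := (@lebesgue_rV R n).

Lemma kernel_orthogonal_ae0 (p : R) (g y : 'rV[R]_n -> R) : 1 <= p ->
  mu.-integrable setT (EFin \o (fun x => y x `^ p)) -> measurable_fun setT g ->
  (forall x, `|g x| <= y x) ->
  (forall e v, 0 < e <= 1 -> \int[mu]_x (g x * tensor_kern e (x - v)) = 0) ->
  {ae mu, forall x, g x = 0}.
Proof.
move=> p1 iy mg gy H; apply: cbox_integrals_eq0 => // [N|a b].
  apply: (integrable_mul_Lp p1 iy mg gy) => [|x]; first exact: integrable_box_ind.
  by rewrite box_ind_ge0 box_ind_le1.
exact: (Rintegral_cbox_eq0 p1 iy mg gy).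
Qed.

End deconvolution_ae.

(** * A function with empty distributional support vanishes *)

Section uniqueness.
Context {R : realType} {n : nat}.
Notation mu := (@lebesgue_rV R n).
Variables (p alpha : R) (f : 'rV[R]_n -> R[i]).
Hypothesis p1 : 1 <= p.
Hypothesis alpha_bounds : 0 <= alpha < n%:R.
Hypothesis p_le : p * alpha <= 2 * n%:R.
Hypothesis fLp : in_Lp p f.
Hypothesis f0 : forall phi, testR phi ->
  pairing (re f) (im f) phi = 0 /\ pairing (im f) (oppre f) phi = 0.

(** The pairings with the two modulated tests vanish; they are combined as in
    [modulated_transform]. *)
Lemma kernel_orthogonal e (v : 'rV[R]_n) : 0 < e ->
  \int[mu]_x (re f x * tensor_kern e (x - v)) = 0 /\
  \int[mu]_x (im f x * tensor_kern e (x - v)) = 0.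
Proof.
move=> e0; have tp := testR_dilated_bump (n := n) e0.
pose c t := dilated_bump e t * cos (dot t v); pose s t := dilated_bump e t * sin (dot t v).
have tc : testR c by apply: testRM => //; apply: smoothR_dot; exact: smooth1_cos.
have ts : testR s by apply: testRM => //; apply: smoothR_dot; exact: smooth1_sin.
have [c1 c2] := f0 tc; have [s1 s2] := f0 ts.
have i1 := integrable_pairing_re p1 alpha_bounds p_le fLp tc.
have i2 := integrable_pairing_im p1 alpha_bounds p_le fLp tc.
have i3 := integrable_pairing_re p1 alpha_bounds p_le fLp ts.
have i4 := integrable_pairing_im p1 alpha_bounds p_le fLp ts.
have E x : cosT c x + sinT s x = tensor_kern e (x - v) by exact: (modulated_transform v x e0).1.
have E' x : sinT c x = cosT s x by apply/eqP; rewrite -subr_eq0; apply/eqP; exact: (modulated_transform v x e0).2.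
split.
  rewrite -[RHS](subrr 0) -[X in X - _]c1 -[X in _ - X]s2 /pairing -RintegralB//.
  by apply: eq_Rintegral => x _; rewrite -E E' /oppre; ring.
rewrite -[RHS](addr0 0) -[X in X + _]c2 -[X in _ + X]s1 /pairing -RintegralD//.
by apply: eq_Rintegral => x _; rewrite -E E' /oppre; ring.
Qed.

Lemma fourier_pairing_eq0_ae : {ae mu, forall x, f x = 0}.
Proof.
have iy := integrable_modulus_pow p1 fLp.
have H1 : {ae mu, forall x, re f x = 0}.
  apply: (kernel_orthogonal_ae0 p1 iy (measurable_re fLp) (re_le_modulus f)).
  by move=> e v /andP[e0 _]; exact: (kernel_orthogonal v e0).1.
have H2 : {ae mu, forall x, im f x = 0}.
  apply: (kernel_orthogonal_ae0 p1 iy (measurable_im fLp) (im_le_modulus f)).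
  by move=> e v /andP[e0 _]; exact: (kernel_orthogonal v e0).2.
by apply: filterS2 H1 H2 => x; rewrite /re /im; case: (f x) => a b /= -> ->.
Qed.

End uniqueness.

(* For alpha = 0 the bound 2n/alpha is +oo, by the convention on ereal
   inverses. *)
Theorem theorem2p3 (R : realType) (n : nat) (p alpha : R)
    (f : 'rV[R]_n -> R[i]) (E : set 'rV[R]_n)
    (n_ge1 : (1 <= n)%N)
    (p_ge1 : 1 <= p)
    (f_Lp : in_Lp p f)
    (alpha_bounds : 0 <= alpha < n%:R)
    (supp_E : distr_support (distr_fourier (regular_distr f)) `<=` E)
    (E_packing : (packing_measure alpha E < +oo)%E)
    (p_le : (p%:E <= (2 * n%:R)%:E / alpha%:E)%E) :
  {ae lebesgue_rV R n, forall x, f x = 0}.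
Proof.
have pa : p * alpha <= 2 * n%:R.
  have /andP[a0 _] := alpha_bounds; have [->|an0] := eqVneq alpha 0.
    by rewrite mulr0 mulr_ge0.
  move: p_le; rewrite inver (negbTE an0) -EFinM lee_fin ler_pdivlMr//.
  by rewrite lt_neqAle eq_sym an0.
have K0 := distr_support_eq0 p_ge1 alpha_bounds pa f_Lp supp_E E_packing.
apply: (fourier_pairing_eq0_ae p_ge1 alpha_bounds pa f_Lp) => phi tp.
by apply: (pairing_off_support p_ge1 alpha_bounds pa f_Lp tp) => x _; rewrite K0.
Qed.
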